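(* Let $d\ge1$, $0\le\delta\le1$ and let $\Theta:[0,+\infty)\to[0,+\infty)$ be a non-negative continuous function. Let $M_p=\sup_{t\ge0}t^pe^{-\Theta(t)}$ for $p\in\mathbb{N}$, and assume that: (i) $0<M_p<+\infty$ for all $p\in\mathbb{N}$; (ii) there exist constants $C_\Theta>0$, $L_\Theta\ge1$ such that $p^p\le C_\Theta L_\Theta^pM_p$ for all $p\in\mathbb{N}$ (with $0^0=1$); (iii) the sequence $\big(M_p^{\frac{1+\delta}{2}}\big)_{p\in\mathbb{N}}$ is quasi-analytic, that is, $\sum_{p=1}^{+\infty}\Big(\frac{M_{p-1}}{M_p}\Big)^{\frac{1+\delta}{2}}=+\infty$. Let $\rho:\mathbb{R}^d\to(0,+\infty)$ be a positive contraction mapping satisfying $$\exists m>0,\ \exists R>0,\ \forall x\in\mathbb{R}^d,\quad 0<m\le\rho(x)\le R\langle x\rangle^\delta.$$ If $\omega$ is a measurable subset of $\mathbb{R}^d$ which is thick with respect to $\rho$ (that is, $\gamma$-thick with respect to $\rho$ for some $0<\gamma\le 1$), then there exists a positive constant $\varepsilon_0=\varepsilon_0(\Theta,d,\delta)>0$ such that for all $0<\varepsilon\le\varepsilon_0$ there exists a positive constant $D_\varepsilon=D(d,\Theta,\varepsilon,\delta,\rho,\gamma)>0$ so that $$\forall f\in GS_\Theta,\quad \|f\|^2_{L^2(\mathbb{R}^d)}\le D_\varepsilon\|f\|^2_{L^2(\omega)}+\varepsilon\|f\|^2_{GS_\Theta}.$$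
   Context: $\mathbb{N}$ is the set of non-negative integers, $\langle x\rangle=(1+\|x\|^2)^{1/2}$ with $\|\cdot\|$ the Euclidean norm. Hermite functions: for $k\in\mathbb{N}$, $x\in\mathbb{R}$, $\phi_k(x)=\frac{(-1)^k}{\sqrt{2^kk!\sqrt\pi}}e^{x^2/2}\frac{d^k}{dx^k}(e^{-x^2})$; for $\alpha\in\mathbb{N}^d$, $\Phi_\alpha(x)=\prod_{j=1}^d\phi_{\alpha_j}(x_j)$. $(\Phi_\alpha)_{\alpha\in\mathbb{N}^d}$ is a Hilbert basis of $L^2(\mathbb{R}^d)$; $|\alpha|=\alpha_1+\dots+\alpha_d$. $GS_\Theta=\Big\{f\in L^2(\mathbb{R}^d):\ \|f\|_{GS_\Theta}:=\Big\|\big(e^{\Theta(|\alpha|)}\langle f,\Phi_\alpha\rangle_{L^2(\mathbb{R}^d)}\big)_{\alpha\in\mathbb{N}^d}\Big\|_{l^2(\mathbb{N}^d)}<+\infty\Big\}$. A measurable $\omega\subset\mathbb{R}^d$ is $\gamma$-thick with respect to $\rho$ if $|\omega\cap B(x,\rho(x))|\ge\gamma|B(x,\rho(x))|$ for all $x\in\mathbb{R}^d$, where $B(x,L)$ is the Euclidean ball centered at $x$ with radius $L$ and $|\cdot|$ is Lebesgue measure. A positive function $\rho$ is a contraction mapping if there is $0\le L<1$ with $|\rho(x)-\rho(y)|\le L\|x-y\|$ for all $x,y\in\mathbb{R}^d$. *)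

(* Defs.v *)
From HB Require Import structures.
From mathcomp Require Import all_boot all_order all_algebra.
From mathcomp Require Import all_classical all_reals all_analysis.
From mathcomp Require Import complex.

Set Implicit Arguments.
Unset Strict Implicit.
Unset Printing Implicit Defensive.
Import Order.TTheory GRing.Theory Num.Theory.
Import numFieldNormedType.Exports.

Local Open Scope classical_set_scope.
Local Open Scope ring_scope.

(* Lebesgue measure on the Borel subsets of R^d, by recursion on d: R^0
   carries the Dirac mass at its only point, and R^(n+1) the image of the
   product measure under (t, x) |-> t :: x. *)

Section borel_lebesgue_step.
Context {R : realType} (n : nat).
Let B : measurableType _ := measurableTypeR R.
Variable m : {sigma_finite_measure set (n.-tuple B) -> \bar R}.

Definition cons_point (p : B * n.-tuple B) : n.+1.-tuple B :=
  [the n.+1.-tuple B of p.1 :: p.2].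

Definition uncons_point (x : n.+1.-tuple B) : B * n.-tuple B :=
  (thead x, [tuple of behead x]).

Lemma measurable_cons_point : measurable_fun [set: B * n.-tuple B] cons_point.
Proof. exact: measurable_cons. Qed.

Lemma measurable_uncons_point :
  measurable_fun [set: n.+1.-tuple B] uncons_point.
Proof.
apply: measurable_fun_pair.
- exact: (measurable_tnth ord0).
- exact: measurable_behead.
Qed.

Lemma cons_pointK : cancel cons_point uncons_point.
Proof.
move=> [t x]; rewrite /uncons_point /cons_point/= theadE; congr pair.
exact/val_inj.
Qed.

Definition borel_lebesgueS : set (n.+1.-tuple B) -> \bar R :=
  pushforward (@lebesgue_measure R \x m)%E cons_point.

HB.instance Definition _ := Measure.copy borel_lebesgueS
  (measure_function_pushforward__canonical__measure_function_Measure
    _ measurable_cons_point).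

Let borel_lebesgueS_sigma_finite : sigma_finite setT borel_lebesgueS.
Proof.
have /sigma_finiteP[F [TF ndF Foo]] := sigma_finiteT (@lebesgue_measure R).
have /sigma_finiteP[G [TG ndG Goo]] := sigma_finiteT m.
exists (fun i => uncons_point @^-1` (F i `*` G i)).
  rewrite predeqE => x; split=> // _.
  have [i _ Fi] : (\bigcup_i F i) (thead x) by rewrite -TF.
  have [j _ Gj] : (\bigcup_j G j) [tuple of behead x] by rewrite -TG.
  exists (maxn i j) => //; split => /=.
    by move: Fi; exact/subsetPset/ndF/leq_maxl.
  by move: Gj; exact/subsetPset/ndG/leq_maxr.
move=> i; have [mF Fioo] := Foo i; have [mG Gioo] := Goo i; split.
  rewrite -[X in measurable X]setTI.
  by apply: measurable_uncons_point => //; exact: measurableX.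
rewrite /borel_lebesgueS /pushforward -comp_preimage.
rewrite (_ : uncons_point \o cons_point = id); last exact/funext/cons_pointK.
by rewrite preimage_id product_measure1E// lte_mul_pinfty// ge0_fin_numE.
Qed.

HB.instance Definition _ := Measure_isSigmaFinite.Build _ _ _
  borel_lebesgueS borel_lebesgueS_sigma_finite.

End borel_lebesgue_step.

Fixpoint borel_lebesgue {R : realType} (d : nat) :
    {sigma_finite_measure set (d.-tuple (measurableTypeR R)) -> \bar R} :=
  if d is d'.+1 then borel_lebesgueS (borel_lebesgue d')
  else dirac [tuple].

(* R^d with its Lebesgue (that is, Caratheodory) sigma-algebra, and the
   complete Lebesgue measure on it. *)

Definition euclid_display (R : realType) (d : nat) : measure_display :=
  caratheodory_display ((@borel_lebesgue R d)^*)%mu.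

Definition euclid (R : realType) (d : nat) :
    measurableType (euclid_display R d) :=
  caratheodory_type ((@borel_lebesgue R d)^*)%mu.

Definition lebesgue_d (R : realType) (d : nat) :
    set (euclid R d) -> \bar R :=
  @completed_measure_extension _ _ _ (@borel_lebesgue R d).
Arguments lebesgue_d : clear implicits.

HB.instance Definition _ (R : realType) (d : nat) :=
  Measure.on (@lebesgue_d R d).

Section Euclidean.
Context {R : realType} {d : nat}.
Local Notation E := (euclid R d).
Local Notation mu := (lebesgue_d R d).

Definition coordinate (x : E) (i : 'I_d) : R := tnth x i.

Definition eucl_norm (x : E) : R := Num.sqrt (\sum_(i < d) coordinate x i ^+ 2).

Definition eucl_dist (x y : E) : R :=
  Num.sqrt (\sum_(i < d) (coordinate x i - coordinate y i) ^+ 2).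

Definition eucl_ball (x : E) (r : R) : set E := [set y | eucl_dist x y < r].

Definition japanese (x : E) : R := (1 + eucl_norm x ^+ 2) `^ 2^-1.

Definition contraction_mapping (rho : E -> R) : Prop :=
  exists2 L : R, 0 <= L < 1 &
    forall x y, `|rho x - rho y| <= L * eucl_dist x y.

Definition thick (gamma : R) (rho : E -> R) (omega : set E) : Prop :=
  forall x, (gamma%:E * mu (eucl_ball x (rho x))
             <= mu (omega `&` eucl_ball x (rho x)))%E.

End Euclidean.

Definition hermite {R : realType} (k : nat) (x : R) : R :=
  (-1) ^+ k / Num.sqrt (2 ^+ k * k`!%:R * Num.sqrt pi)
  * expR (x ^+ 2 / 2) * derive1n k (fun y : R => expR (- y ^+ 2)) x.

Section GelfandShilov.
Context {R : realType} {d : nat}.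
Local Notation E := (euclid R d).
Local Notation mu := (lebesgue_d R d).

Definition absC (z : R[i]) : R := ComplexField.Normc.normc z.

Definition hermite_d (alpha : d.-tuple nat) (x : E) : R :=
  \prod_(j < d) hermite (tnth alpha j) (coordinate x j).

Definition mindex_size (alpha : d.-tuple nat) : nat :=
  (\sum_(j < d) tnth alpha j)%N.

Definition complex_measurable (f : E -> R[i]) : Prop :=
  measurable_fun [set: E] (fun x => complex.Re (f x)) /\
  measurable_fun [set: E] (fun x => complex.Im (f x)).

Definition L2norm (omega : set E) (f : E -> R[i]) : \bar R :=
  ((\int[mu]_(x in omega) (absC (f x) ^+ 2)%:E) `^ 2^-1)%E.

(* Functions stand for their classes modulo equality almost everywhere. *)
Definition inL2 (f : E -> R[i]) : Prop :=
  complex_measurable f /\ (L2norm [set: E] f < +oo)%E.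

(* <f, Phi_alpha>; no conjugate is needed since Phi_alpha is real-valued. *)
Definition hermite_coef (f : E -> R[i]) (alpha : d.-tuple nat) : R[i] :=
  Complex (\int[mu]_x (complex.Re (f x) * hermite_d alpha x))
          (\int[mu]_x (complex.Im (f x) * hermite_d alpha x)).

Definition GSnorm (Theta : R -> R) (f : E -> R[i]) : \bar R :=
  ((\esum_(alpha in [set: d.-tuple nat])
     ((expR (Theta (mindex_size alpha)%:R)
       * absC (hermite_coef f alpha)) ^+ 2)%:E) `^ 2^-1)%E.

Definition inGS (Theta : R -> R) (f : E -> R[i]) : Prop :=
  inL2 f /\ (GSnorm Theta f < +oo)%E.

End GelfandShilov.

(* sup_(t >= 0) t^p e^(- Theta t); here t ^+ 0 = 1, including at t = 0. *)
Definition Mseq {R : realType} (Theta : R -> R) (p : nat) : \bar R :=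
  ereal_sup [set (t ^+ p * expR (- Theta t))%:E | t in `[0, +oo[].

(* Main.v *)
Require Import Defs.
From HB Require Import structures.
From mathcomp Require Import all_boot all_order all_algebra.
From mathcomp Require Import all_classical all_reals all_analysis.
From mathcomp Require Import measurable_realfun complex ring lra.

Set Implicit Arguments.
Unset Strict Implicit.
Unset Printing Implicit Defensive.
Import Order.TTheory GRing.Theory Num.Theory.
Import numFieldNormedType.Exports.

Local Open Scope classical_set_scope.
Local Open Scope ring_scope.

(** The inequality comes from a compactness argument that rests on unique
continuation for rapidly convergent Hermite series.

The real and the imaginary part of [f] are treated separately, so let [g] be
real valued, with L^2 norm 1. If the inequality fails for [g] then
S = ||g||_GS^2 satisfies S < 1/eps, hence the Hermite coefficients of [g] are
dominated by w(alpha) = eps^(-1/2) e^(-Theta |alpha|). All moments M_p of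
e^(-Theta) being finite, the sums of w(alpha) |alpha|^(p/2) are bounded by
A sqrt(M_p) ([weight_moments]). Now suppose that no constant D works. Then
there are functions g_n of this kind and sets omega_n with
int_(omega_n) g_n^2 -> 0, while thickness at the origin gives
|omega_n `&` K| >= kappa for K the ball B(0, rho 0) and
kappa = gamma |K| > 0. Domination by w lets the coefficient families
approach a limit family in l^1 ([dominated_subsequence]), so the Hermite
series of g_n approach the series F of the limit uniformly on K. The limit
cannot vanish, because the norms are 1. By unique continuation the zero set
of F is then null, so |F| > eta on K outside a set of measure < kappa/2 for
some eta > 0; therefore |g_n| >= eta/2 on a part of omega_n of measure at
least kappa/2, for infinitely many n, which is absurd ([compactness_core]).

Unique continuation ([tensor_series_unique]) says that F = 0 as soon as F
vanishes on a set of positive measure. Slicing with Tonelli's theorem reduces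
it to one variable. There the p-th derivative of the k-th Hermite function is
at most e^(x^2/2) (2 (k + p))^(p/2), and the growth p^p <= C L^p M_p absorbs
the part of this bound that does not depend on k, so that
|F^(p)| <= A B^p sqrt(M_p) on bounded intervals. The ratios M_(p-1)/M_p
decrease, so divergence of the sum of their powers of exponent (1 + delta)/2
implies divergence of the sum of sqrt(M_(p-1)/M_p), and the class of such F
is quasi-analytic by the Denjoy-Carleman theorem, for which Bang's elementary
proof is followed ([bang_flat]). A non-null zero set has an accumulation
point, where all derivatives vanish by Rolle's theorem.

The expansion of g_n into its Hermite series holds almost everywhere because
the Hermite functions are orthonormal and complete. Completeness is obtained
from Gaussian weights: a function orthogonal to all Hermite functions of a
coordinate is orthogonal to indicators of intervals of that coordinate
([Rint_interval_eq0]), hence to boxes, hence to Borel sets. *)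

(** * Differentiation rules and comparison *)

Section pointwise_derivatives.
Context {R : realType}.
Implicit Types (f g : R -> R) (x a b c k : R).

(** The rules below speak of explicit functions [fun t => ...], so that a chain
of applications builds a derivative by unification; [deq] then leaves one
identity between real numbers. *)
Lemma dcst c x : is_derive x 1 (fun _ : R => c) 0.
Proof. exact: is_derive_cst. Qed.

Lemma did x : is_derive x 1 (fun t : R => t) 1.
Proof. exact: is_derive_id. Qed.

Lemma dadd f g x a b : is_derive x 1 f a -> is_derive x 1 g b ->
  is_derive x 1 (fun t => f t + g t) (a + b).
Proof. by move=> df dg; exact: is_deriveD. Qed.

Lemma dsub f g x a b : is_derive x 1 f a -> is_derive x 1 g b ->
  is_derive x 1 (fun t => f t - g t) (a - b).
Proof. by move=> df dg; exact: is_deriveB. Qed.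

Lemma dopp f x a : is_derive x 1 f a -> is_derive x 1 (fun t => - f t) (- a).
Proof. by move=> df; exact: is_deriveN. Qed.

Lemma dmul f g x a b : is_derive x 1 f a -> is_derive x 1 g b ->
  is_derive x 1 (fun t => f t * g t) (f x * b + g x * a).
Proof. by move=> df dg; exact: is_deriveM. Qed.

Lemma dscale f x k a : is_derive x 1 f a -> is_derive x 1 (fun t => k * f t) (k * a).
Proof. by move=> df; exact: is_deriveZ. Qed.

Lemma dcomp f g x a b : is_derive (g x) 1 f a -> is_derive x 1 g b ->
  is_derive x 1 (fun t => f (g t)) (a * b).
Proof. by move=> df dg; exact: is_derive1_comp. Qed.

Lemma dexp f x a : is_derive x 1 f a ->
  is_derive x 1 (fun t => expR (f t)) (expR (f x) * a).
Proof. by move=> df; apply: dcomp => //; exact: is_derive_expR. Qed.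

Lemma deq f x a b : is_derive x 1 f a -> a = b -> is_derive x 1 f b.
Proof. by move=> ? <-. Qed.

Lemma dfun f g x a : is_derive x 1 f a -> f =1 g -> is_derive x 1 g a.
Proof. by move=> + /funext <-. Qed.

End pointwise_derivatives.

(** * Bang's theorem on flat functions *)

Section derivative_comparison.
Context {R : realType}.

Lemma deriv_continuous (u u' : R -> R) (a b : R) :
  (forall x : R, is_derive x 1 u (u' x)) -> {within `[a, b], continuous u}.
Proof.
move=> du; apply: continuous_subspaceT => x.
by apply: differentiable_continuous; apply/derivable1_diffP; have [] := du x.
Qed.

Lemma deriv_ge0_le (u u' : R -> R) (a b : R) : a <= b ->
  (forall x : R, is_derive x 1 u (u' x)) ->
  (forall x, a <= x <= b -> 0 <= u' x) -> u a <= u b.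
Proof.
move=> ab du u0; rewrite -subr_ge0.
have [c cab ->] := MVT_segment ab (fun x _ => du x) (deriv_continuous du).
by rewrite mulr_ge0 ?subr_ge0// u0//; move: cab; rewrite in_itv.
Qed.

(** The mean value theorem applied to [v - u] and [v + u]. *)
Lemma deriv_compare (u u' v v' : R -> R) (a b : R) : a <= b ->
  (forall x : R, is_derive x 1 u (u' x)) -> (forall x : R, is_derive x 1 v (v' x)) ->
  (forall x, a <= x <= b -> `|u' x| <= v' x) -> `|u b| <= `|u a| + (v b - v a).
Proof.
move=> ab du dv uv.
have H1 : v a - u a <= v b - u b.
  apply: (@deriv_ge0_le (fun x => v x - u x) (fun x => v' x - u' x)) => // x xab.
  by rewrite subr_ge0 (le_trans (ler_norm _))// uv.
have H2 : v a + u a <= v b + u b.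
  apply: (@deriv_ge0_le (fun x => v x + u x) (fun x => v' x + u' x)) => // x xab.
  by have := uv x xab; rewrite ler_norml => /andP[]; lra.
have := ler_norm (u a); have := ler_norm (- u a); rewrite normrN.
by move=> *; rewrite ler_norml; apply/andP; split; lra.
Qed.

End derivative_comparison.

Section bang.
Context {R : realType}.
Variables (N : nat -> R) (h : nat -> R -> R).
Hypothesis N_gt0 : forall p, 0 < N p.
Hypothesis N_logconvex : forall p, N p.+1 ^+ 2 <= N p * N p.+2.
Hypothesis dh : forall p (x : R), is_derive x 1 (h p) (h p.+1 x).
Hypothesis h_le : forall p (x : R), 0 <= x <= 1 -> `|h p x| <= N p.

Lemma logconvex_ratio n k : (n <= k)%N -> N n.+1 / N n <= N k.+1 / N k.
Proof.
move=> /subnK <-; elim: (k - n)%N => // j IH; rewrite addSn.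
apply: (le_trans IH); rewrite ler_pdivrMr// mulrAC ler_pdivlMr//.
by rewrite mulrC -expr2 mulrC N_logconvex.
Qed.

(** Bang's induction. A bound b e^n N_n on all derivatives at [x] propagates over
a distance [y] at the cost of the factor exp(e y N_K / N_(K-1)). The orders
n >= K satisfy it by [h_le], because b e^n >= 1 there; one descends from K
by comparing h_n with the claimed bound, whose derivative dominates h_(n+1)
since N_(n+1) / N_n <= N_K / N_(K-1) by log-convexity. *)
Lemma bang_step K (b x y : R) : (0 < K)%N -> expR (- K%:R) <= b ->
  0 <= x -> 0 <= y -> x + y <= 1 ->
  (forall n, `|h n x| <= b * expR n%:R * N n) ->
  forall n, `|h n (x + y)| <=
    b * expR (expR 1 * y * (N K / N K.-1)) * expR n%:R * N n.
Proof.
move=> K0 Kb x0 y0 xy hx n.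
have b0 : 0 < b by apply: lt_le_trans Kb; exact: expR_gt0.
have r0 : 0 < N K / N K.-1 by rewrite divr_gt0.
set v := fun n (y : R) => b * expR (expR 1 * y * (N K / N K.-1)) * expR n%:R * N n.
have big m (z : R) : (K <= m)%N -> 0 <= z -> x + z <= 1 -> `|h m (x + z)| <= v m z.
  move=> Km z0 xz; apply: (@le_trans _ _ (N m)).
    by rewrite h_le// xz addr_ge0.
  rewrite /v ler_peMl//; first exact: ltW.
  have : 1 <= b * expR m%:R.
    apply: (@le_trans _ _ (expR (- K%:R) * expR m%:R)).
      by rewrite -expRD -[leLHS]expR0 ler_expR addrC subr_ge0 ler_nat.
    by rewrite ler_wpM2r// expR_ge0.
  move/le_trans; apply; rewrite mulrAC ler_peMr//.
    by rewrite mulr_ge0 ?expR_ge0 ?ltW.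
  by rewrite -[leLHS]expR0 ler_expR !mulr_ge0 ?expR_ge0 ?invr_ge0// ltW.
suff main j (z : R) m : (m + j)%N = K -> 0 <= z -> x + z <= 1 -> `|h m (x + z)| <= v m z.
  have [Kn|nK] := leqP K n; first exact: big.
  by apply: (main (K - n)%N) => //; rewrite subnKC// ltnW.
elim: j z m => [|j IH] z m; first by rewrite addn0 => ->; exact: big.
move=> mK z0 xz.
have dv (t : R) : is_derive t 1 (v m) (expR 1 * (N K / N K.-1) * v m t).
  apply: (@dfun _ (fun t => (b * expR m%:R * N m) *
      expR ((expR 1 * (N K / N K.-1)) * t))).
    apply: (deq (dscale _ (dexp (dscale _ (did t))))).
    by rewrite /v [_ * t]mulrAC; ring.
  by move=> s; rewrite /v [_ * s]mulrAC; ring.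
have dhx (t : R) : is_derive t 1 (fun t => h m (x + t)) (h m.+1 (x + t)).
  apply: (deq (dcomp (dh m (x + t)) (dadd (dcst x t) (did t)))).
  by rewrite add0r mulr1.
have := @deriv_compare _ (fun t => h m (x + t)) (fun t => h m.+1 (x + t)) (v m) _ 0 z z0 dhx dv.
move=> /(_ _)/le_trans; apply => [t /andP[t0 tz]|].
  apply: (le_trans (IH t m.+1 _ t0 _)); first by rewrite addSnnS.
    by apply: le_trans xz; rewrite lerD2l.
  rewrite /v -natr1 expRD.
  have -> : N m.+1 = (N m.+1 / N m) * N m by rewrite divfK// gt_eqF.
  have := @logconvex_ratio m K.-1.
  have K1 : K.-1.+1 = K by rewrite prednK// -mK addnS.
  rewrite K1 => /(_ _) rr.
  have {}rr : N m.+1 / N m <= N K / N K.-1.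
    by apply: rr; rewrite -ltnS K1 -mK addnS ltnS leq_addr.
  set E := expR (_ * _ * _).
  have -> : b * E * (expR m%:R * expR 1) * (N m.+1 / N m * N m) =
     (b * E * expR m%:R * expR 1 * N m) * (N m.+1 / N m) by ring.
  have -> : expR 1 * (N K / N K.-1) * (b * E * expR m%:R * N m) =
     (b * E * expR m%:R * expR 1 * N m) * (N K / N K.-1) by ring.
  by rewrite ler_wpM2l// !mulr_ge0 ?expR_ge0 ?ltW.
rewrite addr0 [leRHS](_ : _ = v m 0 + (v m z - v m 0)); last by ring.
by rewrite lerD2r /v mulr0 mul0r expR0 mulr1.
Qed.

Hypothesis h0 : forall p, h p 0 = 0.
Hypothesis N_div : forall A, exists n, A <= \sum_(1 <= p < n) N p.-1 / N p.

(** A move by e^-1 N_(K-1) / N_K costs a factor e in the bound. As all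
derivatives vanish at 0 the bound is available there with an arbitrarily
small factor e^-(J+k), and k moves bring it to e^-J. *)
Lemma bang_reach J k (x : R) : (0 < J)%N -> 0 <= x <= 1 ->
  x <= expR (-1) * \sum_(J.+1 <= p < (J + k).+1) N p.-1 / N p ->
  forall n, `|h n x| <= expR (- J%:R) * expR n%:R * N n.
Proof.
elim: k J x => [|k IH] J x J0 /andP[x0 x1].
  rewrite addn0 big_geq// mulr0 => x0' n.
  have -> : x = 0 by apply/eqP; rewrite eq_le x0 x0'.
  by rewrite h0 normr0 !mulr_ge0 ?expR_ge0 ?ltW.
rewrite big_nat_recl/=; last by rewrite -addSnnS leq_addr.
rewrite mulrDr; set a := expR (-1) * (N J / N J.+1).
have a0 : 0 <= a by rewrite mulr_ge0 ?expR_ge0 ?divr_ge0 ?ltW.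
move=> xle n.
pose y := Num.min x a; pose x' := x - y.
have y0 : 0 <= y by rewrite le_min x0.
have x'0 : 0 <= x' by rewrite subr_ge0 ge_min lexx.
have x'1 : x' <= 1 by rewrite lerBlDr (le_trans x1)// lerDl.
have := IH J.+1 x' (ltn0Sn _); rewrite x'0 x'1 => /(_ isT).
have big_shift : \sum_(J.+1 <= i < J + k.+1) N i / N i.+1 =
    \sum_(J.+2 <= p < (J.+1 + k).+1) N p.-1 / N p.
  by rewrite addSn -addnS (@big_add1 _ _ _ J.+1 _).
have S0 : 0 <= \sum_(J.+2 <= p < (J.+1 + k).+1) N p.-1 / N p.
  by apply: sumr_ge0 => i _; rewrite divr_ge0 ?ltW.
have -> : x' <= expR (-1) * \sum_(J.+2 <= p < (J.+1 + k).+1) N p.-1 / N p.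
  rewrite -big_shift /x' /y; case: (leP x a) => xa.
    by rewrite subrr big_shift mulr_ge0// expR_ge0.
  by rewrite lerBlDr addrC.
move=> /(_ isT) Hx'.
have := @bang_step J.+1 _ x' y _ (lexx _) x'0 y0 _ Hx' n.
rewrite /x' subrK => /(_ isT x1) /le_trans; apply.
rewrite ler_wpM2r ?(ltW (N_gt0 _))// ler_wpM2r ?expR_ge0//.
rewrite -expRD ler_expR -natr1 opprD -addrA gerDl.
rewrite addrC subr_le0 /=.
have : y <= a by rewrite ge_min lexx orbT.
move=> ya; apply: (@le_trans _ _ (expR 1 * a * (N J.+1 / N J))).
  apply: ler_wpM2r; first by rewrite divr_ge0 ?ltW.
  by rewrite ler_pM2l ?expR_gt0.
rewrite /a [expR 1 * _]mulrA -expRD subrr expR0 mul1r.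
by rewrite mulrA divfK ?gt_eqF// divff ?gt_eqF.
Qed.

(** The partial sums beyond any index J are unbounded, so [bang_reach] gives
|h 0 x| <= e^-J N_0 for every J. *)
Lemma bang_flat (x : R) : 0 <= x <= 1 -> h 0 x = 0.
Proof.
move=> x01; apply/eqP; rewrite -normr_le0.
have H J : (0 < J)%N -> `|h 0 x| <= expR (- J%:R) * N 0.
  move=> J0; have [n nA] := N_div (expR 1 + \sum_(1 <= p < J.+1) N p.-1 / N p).
  have [nJ|Jn] := leqP n J.+1.
    have : \sum_(1 <= p < n) N p.-1 / N p <= \sum_(1 <= p < J.+1) N p.-1 / N p.
      have [n0|n0] := posnP n.
        rewrite n0 big_geq//; apply: sumr_ge0 => i _; rewrite divr_ge0 ?ltW//.
      rewrite (big_cat_nat n0 nJ)/= lerDl sumr_ge0// => i _.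
      by rewrite divr_ge0 ?ltW.
    by move=> /(le_trans nA); rewrite gerDr leNgt expR_gt0.
  have := @bang_reach J (n - J.+1) x J0 x01.
  rewrite -addSn subnKC; last exact: ltnW.
  rewrite (big_cat_nat (isT : (1 <= J.+1)%N) (ltnW Jn))/= in nA.
  rewrite [expR 1 + _]addrC lerD2l in nA.
  move=> /(_ _ 0); rewrite expR0 mulr1; apply.
  have /andP[_ x1] := x01; apply: (le_trans x1).
  rewrite -[leLHS](_ : expR (-1) * expR 1 = 1); last first.
    by rewrite -expRD addrC subrr expR0.
  by rewrite ler_wpM2l ?expR_ge0.
apply/ler_addgt0Pl => e e0; rewrite addr0.
have [j jge] : exists j : nat, N 0 / e <= j.+1%:R.
  exists (Num.Def.archi_bound (N 0 / e)).
  rewrite (le_trans (ltW (archi_boundP _)))//; first by rewrite divr_ge0 ?ltW.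
  by rewrite ler_nat.
apply: (le_trans (H j.+1 _)) => //.
rewrite expRN mulrC ler_pdivrMr ?expR_gt0//.
rewrite ler_pdivrMr// mulrC in jge; apply: (le_trans jge).
rewrite ler_pM2l//; apply: le_trans (expR_ge1Dx _); by rewrite lerDr.
Qed.

End bang.

(** * Uniqueness in a quasi-analytic class *)

Section quasi_analytic.
Context {R : realType}.
Variables (N : nat -> R) (G : nat -> R -> R).
Hypothesis N_gt0 : forall p, 0 < N p.
Hypothesis N_logconvex : forall p, N p.+1 ^+ 2 <= N p * N p.+2.
Hypothesis N_div : forall A : R, exists n, A <= \sum_(1 <= p < n) N p.-1 / N p.
Hypothesis dG : forall p (x : R), is_derive x 1 (G p) (G p.+1 x).
Hypothesis G_le : forall T : R, exists A B : R,
  forall p (x : R), `|x| <= T -> `|G p x| <= A * B ^+ p * N p.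

(** Restriction to the segment from [x0] to [x] reduces this to [bang_flat]: the
derivatives of the restriction are bounded by A' B'^p N_p, and a geometric
factor preserves both log-convexity and divergence. *)
Lemma flat_everywhere (x0 : R) : (forall p, G p x0 = 0) -> forall x, G 0 x = 0.
Proof.
move=> flat x; pose T := Num.max `|x0| `|x|.
have [A [B GAB]] := G_le T.
pose r := x - x0; pose A' := `|A| + 1; pose B' := `|B * r| + 1.
have A'0 : 0 < A' by rewrite ltr_wpDl.
have B'0 : 0 < B' by rewrite ltr_wpDl.
have seg (t : R) : 0 <= t <= 1 -> `|x0 + t * r| <= T.
  move=> /andP[t0 t1].
  have -> : x0 + t * r = (1 - t) * x0 + t * x by rewrite /r; ring.
  apply: (le_trans (ler_normD _ _)); rewrite !normrM.
  rewrite (ger0_norm t0) ger0_norm ?subr_ge0//.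
  have -> : T = (1 - t) * T + t * T by ring.
  by apply: lerD; apply: ler_wpM2l; rewrite ?subr_ge0// /T le_max lexx ?orbT.
have := @bang_flat _ (fun p => A' * B' ^+ p * N p)
  (fun p t => r ^+ p * G p (x0 + t * r)) _ _ _ _ _ _ 1.
rewrite expr0 mul1r mul1r /r (_ : x0 + (x - x0) = x); last by rewrite addrC subrK.
apply; last by rewrite ler01 lexx.
- by move=> p; rewrite !mulr_gt0 ?exprn_gt0.
- move=> p; rewrite !exprMn -exprM.
  rewrite [leRHS](_ : _ = A' ^+ 2 * B' ^+ (p.+1 * 2) * (N p * N p.+2)).
    by apply: ler_wpM2l => //; rewrite mulr_ge0 ?exprn_ge0 ?(ltW A'0) ?(ltW B'0).
  by rewrite mulnC mul2n -addnn -addSnnS exprD expr2; ring.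
- move=> p t; rewrite -/r exprSr -mulrA; apply: dscale.
  apply: (deq (dcomp (dG p _) (dadd (dcst x0 t) (dmul (did t) (dcst r t))))).
  by rewrite add0r mulr0 add0r mulr1 mulrC.
- move=> p t /seg tT; rewrite normrM normrX -/r.
  apply: (le_trans (ler_wpM2l _ (GAB p _ tT))); first exact: exprn_ge0.
  rewrite mulrA ler_wpM2r//; first exact: ltW.
  rewrite mulrCA -exprMn; apply: (le_trans (ler_norm _)).
  rewrite normrM normrX normrM normr_id; apply: ler_pM => //.
  - by rewrite /A' lerDl.
  - by rewrite lerXn2r ?nnegrE ?mulr_ge0// ?(ltW B'0)// /B' normrM mulrC lerDl.
- by move=> p; rewrite mul0r addr0 flat mulr0.
- move=> c; have [n nc] := N_div (c * B'); exists n.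
  rewrite -(ler_pM2r B'0) mulr_suml; apply: (le_trans nc).
  rewrite le_eqVlt; apply/orP; left; apply/eqP.
  rewrite !big_nat; apply: eq_bigr => -[//|i] _ /=.
  have Ni : N i.+1 != 0 by rewrite gt_eqF.
  have Bi : B' ^+ i != 0 by rewrite gt_eqF ?exprn_gt0.
  have B1 : B' != 0 by rewrite gt_eqF.
  have A1 : A' != 0 by rewrite gt_eqF.
  by rewrite exprSr; field; rewrite Ni Bi B1 A1.
Qed.

(** Between [x0] and each nearby zero Rolle's theorem gives a zero of the
derivative, and these zeros accumulate at [x0] too. *)
Lemma flat_at_limit_of_zeros (x0 : R) :
  (forall e : R, 0 < e -> exists2 z, 0 < `|z - x0| < e & G 0 z = 0) ->
  forall p, G p x0 = 0.
Proof.
move=> H0 p.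
suff [] : G p x0 = 0 /\
  (forall e : R, 0 < e -> exists2 z, 0 < `|z - x0| < e & G p z = 0) by [].
have cont q : (forall e : R, 0 < e -> exists2 z, 0 < `|z - x0| < e & G q z = 0) ->
    G q x0 = 0.
  move=> H; apply/eqP; apply/negPn/negP => Gx0.
  have : continuous_at x0 (G q).
    by apply/differentiable_continuous/derivable1_diffP; have [] := dG q x0.
  move=> /cvgrPdist_lt/(_ `|G q x0|); rewrite normr_gt0 => /(_ Gx0).
  move=> /nbhs_ballP[e /= e0 He].
  have [z /andP[_ ze] Gz] := H e e0.
  have := He z; rewrite /ball/= distrC => /(_ ze).
  by rewrite Gz subr0 ltxx.
elim: p => [|p [G0 H]]; first by split => //; exact: cont.
suff H' : forall e : R, 0 < e -> exists2 z, 0 < `|z - x0| < e & G p.+1 z = 0.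
  by split => //; exact: cont.
move=> e e0; have [z /andP[z0 ze] Gz] := H e e0.
have der (y : R) : derivable (G p) y 1 by have [] := dG p y.
have [zx|xz|zx] := ltgtP z x0; last by rewrite zx subrr normr0 ltxx in z0.
- have [c cI dc] := Rolle zx (fun y _ => der y) (deriv_continuous (dG p)) (etrans Gz (esym G0)).
  exists c; last by have [_ <-] := dc; have [_ ->] := dG p c.
  move: cI; rewrite in_itv/= => /andP[zc cx].
  rewrite normr_gt0 subr_eq0 lt_eqF//= ltr0_norm ?subr_lt0//.
  by move: ze; rewrite ltr0_norm ?subr_lt0//; lra.
- have [c cI dc] := Rolle xz (fun y _ => der y) (deriv_continuous (dG p)) (etrans G0 (esym Gz)).
  exists c; last by have [_ <-] := dc; have [_ ->] := dG p c.
  move: cI; rewrite in_itv/= => /andP[zc cx].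
  rewrite normr_gt0 subr_eq0 gt_eqF//= gtr0_norm ?subr_gt0//.
  by move: ze; rewrite gtr0_norm ?subr_gt0//; lra.
Qed.

(** A set whose bounded parts are all finite is countable, hence null; so a
non-null zero set has an accumulation point. *)
Lemma quasi_analytic_unique : lebesgue_measure [set x | G 0 x = 0] != 0%E ->
  forall x, G 0 x = 0.
Proof.
move=> Z0; set Z := [set x | _] in Z0.
have [n Zn] : exists n : nat, infinite_set (Z `&` `[- n%:R, n%:R]).
  apply: contrapT => /forallNP fin; move/eqP: Z0; apply.
  apply: countable_lebesgue_measure0.
  have -> : Z = \bigcup_n (Z `&` `[- n%:R, n%:R]).
    rewrite -setI_bigcupr; apply/esym/setIidPl => x _.
    exists (Num.Def.archi_bound `|x|) => //=; rewrite in_itv/= -ler_norml.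
    exact/ltW/archi_boundP.
  apply: bigcup_countable => // i _; apply: finite_set_countable.
  by have := fin i => /contrapT.
have Zb : bounded_set (Z `&` `[- n%:R, n%:R]).
  exists n%:R; split; first exact: num_real.
  move=> M nM x [_ /=]; rewrite in_itv/= -ler_norml => /le_trans; apply.
  exact: ltW.
have [x0 x0l] := infinite_bounded_limit_point_nonempty Zn Zb.
apply: (@flat_everywhere x0); apply: flat_at_limit_of_zeros => e e0.
have [z [z0 [Zz _] ze]] := x0l (ball x0 e) (nbhsx_ballx _ _ e0).
exists z => //; rewrite normr_gt0 subr_eq0 z0/= distrC.
by move: ze; rewrite /ball/=.
Qed.

End quasi_analytic.

(** * Hermite functions on the line *)

Section hermite_functions.
Context {R : realType}.
Implicit Types (x : R) (k p : nat).

(** The physicists' Hermite polynomials: this recursion is what differentiating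
H_k e^(-x^2) gives, up to sign. *)
Fixpoint hermite_poly k : {poly R} :=
  if k is k'.+1 then 2%:P * 'X * hermite_poly k' - (hermite_poly k')^`() else 1.

Lemma dhorner (P : {poly R}) x : is_derive x 1 (horner P) P^`().[x].
Proof. exact: is_derive_poly. Qed.

Lemma dgauss x : is_derive x 1 (fun t : R => expR (- t ^+ 2)) (- 2 * x * expR (- x ^+ 2)).
Proof.
apply: (@dfun R (fun t : R => expR (- (t * t)))); last by move=> t; rewrite expr2.
apply: (deq (dexp (dopp (dmul (did x) (did x))))).
by rewrite expr2; ring.
Qed.

Lemma derive1n_gauss k : derive1n k (fun t : R => expR (- t ^+ 2)) =
  (fun x => (-1) ^+ k * (hermite_poly k).[x] * expR (- x ^+ 2)).
Proof.
elim: k => [|k IH].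
  by apply/funext => x; rewrite derive1n0 expr0 hornerC !mul1r.
rewrite derive1nS IH; apply/funext => x; rewrite derive1E.
apply: derive_val; apply: (deq (dmul (dscale _ (dhorner _ x)) (dgauss x))).
rewrite /= !(hornerD, hornerN, hornerM, hornerC, hornerX) [(-1) ^+ k.+1]exprS; ring.
Qed.

Lemma deriv_hermite_poly k :
  (hermite_poly k)^`() = (2 * k)%:R%:P * hermite_poly k.-1.
Proof.
elim: k => [|k IH]; first by rewrite derivC muln0 mul0r.
have E : (hermite_poly k)^`()^`() =
    2%:P * 'X * (hermite_poly k)^`() - (2 * k)%:R%:P * hermite_poly k.
  rewrite {1}IH derivM derivC mul0r add0r.
  case: k IH => [|k] IH; first by rewrite muln0 polyC0 !mul0r subr0 /= derivC mulr0.
  by rewrite IH /=; ring.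
rewrite /= derivB E !derivM derivX derivC mul0r add0r mulr1.
rewrite (_ : (2 * k.+1)%:R%:P = 2%:P + (2 * k)%:R%:P :> {poly R}); first by ring.
by rewrite -polyCD -natrD mulnS.
Qed.

Definition hermite_scale k : R := Num.sqrt (2 ^+ k * k`!%:R * Num.sqrt pi).

Lemma hermite_scale_gt0 k : 0 < hermite_scale k.
Proof.
by rewrite sqrtr_gt0 !mulr_gt0 ?exprn_gt0 ?ltr0n ?fact_gt0// sqrtr_gt0 pi_gt0.
Qed.

Lemma hermite_scaleS k :
  hermite_scale k.+1 = Num.sqrt (2 * k.+1%:R) * hermite_scale k.
Proof.
rewrite /hermite_scale -sqrtrM; last by rewrite mulr_ge0.
by congr Num.sqrt; rewrite factS natrM exprS; ring.
Qed.

Lemma hermiteE k x :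
  hermite k x = (hermite_poly k).[x] / hermite_scale k * expR (- (x ^+ 2 / 2)).
Proof.
rewrite /hermite derive1n_gauss -/(hermite_scale k).
have E : expR (x ^+ 2 / 2) * expR (- x ^+ 2) = expR (- (x ^+ 2 / 2)).
  by rewrite -expRD; congr expR; field.
rewrite -E.
have S : (-1) ^+ k * (-1) ^+ k = 1 :> R by rewrite -exprMn mulrNN mulr1 expr1n.
transitivity (((-1) ^+ k * (-1) ^+ k) *
  ((hermite_poly k).[x] / hermite_scale k * (expR (x ^+ 2 / 2) * expR (- x ^+ 2)))).
  by ring.
by rewrite S mul1r.
Qed.

(** The coefficient that links a Hermite function to its two neighbours, both in
the three-term recurrence and in the formula for the derivative. *)
Definition ladder k : R := Num.sqrt (2 * k%:R).

Lemma ladder_ge0 k : 0 <= ladder k. Proof. exact: sqrtr_ge0. Qed.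

Lemma ladder0 : ladder 0 = 0. Proof. by rewrite /ladder mulr0 sqrtr0. Qed.

Lemma ladder_gt0 k : 0 < ladder k.+1.
Proof. by rewrite sqrtr_gt0 mulr_gt0. Qed.

Lemma ladder_sqr k : ladder k ^+ 2 = 2 * k%:R.
Proof. by rewrite sqr_sqrtr// mulr_ge0. Qed.

Lemma hermite_rec k x :
  2 * x * hermite k x = ladder k.+1 * hermite k.+1 x + ladder k * hermite k.-1 x.
Proof.
rewrite !hermiteE hermite_scaleS -/(ladder k.+1) /=.
rewrite !(hornerD, hornerN, hornerM, hornerC, hornerX) deriv_hermite_poly.
rewrite !(hornerD, hornerN, hornerM, hornerC, hornerX).
have s0 : hermite_scale k != 0 by rewrite gt_eqF// hermite_scale_gt0.
have l0 : ladder k.+1 != 0 by rewrite gt_eqF// ladder_gt0.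
case: k s0 l0 => [|k] s0 l0.
  by rewrite ladder0 muln0 /=; field; rewrite s0 l0.
have l1 : ladder k.+1 != 0 by rewrite gt_eqF// ladder_gt0.
have s1 : hermite_scale k != 0 by rewrite gt_eqF// hermite_scale_gt0.
rewrite hermite_scaleS -/(ladder k.+1) /= natrM -ladder_sqr.
by field; rewrite s1 l0 l1.
Qed.

Lemma dhermite k x :
  is_derive x 1 (hermite k) (x * hermite k x - ladder k.+1 * hermite k.+1 x).
Proof.
apply: (@dfun R (fun x : R => (hermite_scale k)^-1 * ((hermite_poly k).[x] * expR (- (x * x * 2^-1))))).
  apply: (deq (dscale _ (dmul (dhorner _ x) (dexp (dopp (dmul (dmul (did x) (did x)) (dcst _ x))))))).
  rewrite !hermiteE hermite_scaleS -/(ladder k.+1) /= !(hornerD, hornerN, hornerM, hornerC, hornerX) expr2.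
  have s0 : hermite_scale k != 0 by rewrite gt_eqF// hermite_scale_gt0.
  have l0 : ladder k.+1 != 0 by rewrite gt_eqF// ladder_gt0.
  by field; rewrite s0 l0.
by move=> t; rewrite hermiteE expr2; ring.
Qed.

Lemma dhermiteS k x :
  is_derive x 1 (hermite k.+1) (ladder k.+1 * hermite k x - x * hermite k.+1 x).
Proof.
apply: (deq (dhermite k.+1 x)).
have := hermite_rec k.+1 x; rewrite /=; lra.
Qed.

Lemma dhermite_ladder k x : is_derive x 1 (hermite k)
  ((ladder k * hermite k.-1 x - ladder k.+1 * hermite k.+1 x) / 2).
Proof.
apply: (deq (dhermite k x)); have := hermite_rec k x; lra.
Qed.

(** At 0 the recurrence reads
[ladder k.+2 * hermite k.+2 0 = - ladder k.+1 * hermite k 0], so the values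
decrease. *)
Lemma hermite0_sqr_le k : hermite k.+1 0 ^+ 2 + hermite k 0 ^+ 2 <= 1 :> R.
Proof.
elim: k => [|k IH].
  have -> : hermite 1 0 = 0 :> R.
    have := hermite_rec 0 0; rewrite ladder0 mulr0 !mul0r addr0 => /esym/eqP.
    by rewrite mulf_eq0 gt_eqF ?ladder_gt0//= => /eqP.
  rewrite expr0n/= add0r hermiteE /= hornerC /hermite_scale expr0 fact0 !mul1r.
  rewrite expr0n/= mul0r oppr0 expR0 mulr1 exprVn sqr_sqrtr ?sqrtr_ge0//.
  rewrite invf_le1 ?sqrtr_gt0 ?pi_gt0//.
  rewrite -[leLHS]sqrtr1 ler_sqrt ?pi_ge0//.
  by have := @pi_ge2 R; lra.
apply: le_trans IH; rewrite addrC lerD2l.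
have := hermite_rec k.+1 0; rewrite mulr0 !mul0r /= => /esym/eqP.
rewrite addr_eq0 => /eqP E.
rewrite -(@ler_pM2l _ (ladder k.+2 ^+ 2)); last by rewrite exprn_gt0 ?ladder_gt0.
rewrite -exprMn E sqrrN exprMn ler_wpM2r ?sqr_ge0//.
by rewrite !ladder_sqr ler_pM2l// ler_nat.
Qed.

(** The function (phi_(k+1)^2 + phi_k^2) e^(-x^2) has derivative
- 4 x phi_(k+1)^2 e^(-x^2), the cross terms cancelling; so it is largest at 0.
This bound is crude for large x, but it is uniform in k. *)
Lemma hermite_le k x : `|hermite k x| <= expR (x ^+ 2 / 2).
Proof.
rewrite -(@ler_pXn2r _ 2)// ?nnegrE ?expR_ge0//.
rewrite real_normK ?num_real// -expRM_natr -mulr_natr divfK//.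
pose g t : R := (hermite k.+1 t ^+ 2 + hermite k t ^+ 2) * expR (- t ^+ 2).
have dg (t : R) : is_derive t 1 g (- (4 * t * hermite k.+1 t ^+ 2 * expR (- t ^+ 2))).
  apply: (@dfun R (fun t : R => (hermite k.+1 t * hermite k.+1 t + hermite k t * hermite k t) *
     expR (- t ^+ 2))); last by move=> s; rewrite /g !expr2.
  apply: (deq (dmul (dadd (dmul (dhermiteS k t) (dhermiteS k t))
    (dmul (dhermite k t) (dhermite k t))) (dgauss t))).
  by rewrite !expr2; ring.
have g0 : g x <= g 0.
  have [x0|x0] := leP 0 x.
    rewrite -lerN2; apply: (deriv_ge0_le x0 (fun t => dopp (dg t))) => t /andP[t0 _].
    rewrite opprK; apply: mulr_ge0; last exact: expR_ge0.
    by apply: mulr_ge0; rewrite ?sqr_ge0 ?mulr_ge0.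
  apply: (deriv_ge0_le (ltW x0) dg) => t /andP[_ t0].
  rewrite -mulNr; apply: mulr_ge0; last exact: expR_ge0.
  by rewrite -mulNr; apply: mulr_ge0; [lra | exact: sqr_ge0].
have : g x <= 1.
  apply: (le_trans g0); rewrite /g expr0n/= oppr0 expR0 mulr1.
  exact: hermite0_sqr_le.
rewrite /g expRN ler_pdivrMr ?expR_gt0// mul1r; apply: le_trans.
by rewrite lerDr sqr_ge0.
Qed.

(** Iterated derivatives, expressed through Hermite functions by the ladder
relation; the term with [k.-1] is harmless at 0 since [ladder 0 = 0]. *)
Fixpoint hermite_deriv p k (x : R) : R :=
  if p is p'.+1 then
    (ladder k * hermite_deriv p' k.-1 x - ladder k.+1 * hermite_deriv p' k.+1 x) / 2
  else hermite k x.

Lemma dhermite_deriv p k x :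
  is_derive x 1 (hermite_deriv p k) (hermite_deriv p.+1 k x).
Proof.
elim: p k x => [|p IH] k x; first exact: dhermite_ladder.
apply: (deq (dmul (dsub (dscale _ (IH k.-1 x)) (dscale _ (IH k.+1 x))) (dcst 2^-1 x))).
by rewrite mulr0 add0r mulrC.
Qed.

Lemma ladder_le k l : (k <= l)%N -> ladder k <= ladder l.
Proof. by move=> kl; rewrite ler_sqrt ?mulr_ge0// ler_pM2l// ler_nat. Qed.

Lemma hermite_deriv_le p k x :
  `|hermite_deriv p k x| <= expR (x ^+ 2 / 2) * ladder (k + p) ^+ p.
Proof.
elim: p k => [|p IH] k; first by rewrite expr0 mulr1 hermite_le.
rewrite /= normrM [`|2^-1|]ger0_norm// ler_pdivrMr//.
apply: (le_trans (ler_normB _ _)).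
have H j i : (j <= k + p.+1)%N -> (i + p <= k + p.+1)%N ->
    `|ladder j * hermite_deriv p i x| <= expR (x ^+ 2 / 2) * ladder (k + p.+1) ^+ p.+1.
  move=> ji ip; rewrite normrM ger0_norm ?ladder_ge0//.
  rewrite [ladder _ ^+ _]exprS mulrCA; apply: ler_pM => //; first exact: ladder_ge0.
    exact: ladder_le.
  apply: (le_trans (IH i)); apply: ler_wpM2l; first exact: expR_ge0.
  by apply: lerXn2r; rewrite ?nnegrE ?ladder_ge0// ladder_le.
rewrite mulr_natr mulr2n; apply: lerD; apply: H.
- by rewrite leq_addr.
- by rewrite leq_add// leq_pred.
- by rewrite addnS ltnS leq_addr.
- by rewrite addSnnS.
Qed.

Lemma continuous_hermite k : continuous (@hermite R k).
Proof.
move=> x; apply: differentiable_continuous; apply/derivable1_diffP.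
by have [] := dhermite k x.
Qed.

Lemma measurable_hermite k : measurable_fun [set: R] (@hermite R k).
Proof. by apply: continuous_measurable_fun; exact: continuous_hermite. Qed.

End hermite_functions.

(** * Absolutely convergent series and their derivatives *)

Section absolute_sums.
Context {R : realType}.
Implicit Types (u v : nat -> R) (A B : R).

(** Absolute summability together with an explicit bound, which is what must be
kept uniform in the estimates below. *)
Definition abs_sum_le u A := forall n, \sum_(0 <= i < n) `|u i| <= A.

Definition tsum u : R := limn (series u).

Lemma abs_sum_le_ge0 u A : abs_sum_le u A -> 0 <= A.
Proof. by move=> /(_ 0); rewrite big_geq. Qed.

Lemma abs_sum_cvg_norm u A : abs_sum_le u A -> cvgn [normed series u].
Proof.
move=> uA; apply: nondecreasing_is_cvgn.
  by apply: nondecreasing_series => n _ _; exact: normr_ge0.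
by exists A => _ [n _ <-]; exact: uA.
Qed.

Lemma abs_sum_cvg u A : abs_sum_le u A -> cvgn (series u).
Proof. by move=> /abs_sum_cvg_norm/normed_cvg. Qed.

Lemma tsum_le u A : abs_sum_le u A -> `|tsum u| <= A.
Proof.
move=> uA; apply: (le_trans (lim_series_norm (abs_sum_cvg_norm uA))).
apply: limr_le; first exact: abs_sum_cvg_norm uA.
by near=> n; exact: uA.
Unshelve. all: by end_near. Qed.

Lemma abs_sum_leW u v A : (forall i, `|u i| <= `|v i|) -> abs_sum_le v A -> abs_sum_le u A.
Proof. by move=> uv vA n; apply: le_trans (vA n); exact: ler_sum. Qed.

Lemma abs_sum_leZ k u A : abs_sum_le u A -> abs_sum_le (fun i => k * u i) (`|k| * A).
Proof.
move=> uA n; under eq_bigr do rewrite normrM.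
by rewrite -mulr_sumr ler_wpM2l.
Qed.

Lemma abs_sum_leD u v A B : abs_sum_le u A -> abs_sum_le v B ->
  abs_sum_le (fun i => u i + v i) (A + B).
Proof.
move=> uA vB n; apply: le_trans (lerD (uA n) (vB n)).
by rewrite -big_split/=; apply: ler_sum => i _; exact: ler_normD.
Qed.

Lemma abs_sum_le_ext u v A : u =1 v -> abs_sum_le u A -> abs_sum_le v A.
Proof. by move=> /funext ->. Qed.

Lemma tsumZ k u A : abs_sum_le u A -> tsum (fun i => k * u i) = k * tsum u.
Proof. by move=> /abs_sum_cvg uA; exact: lim_seriesZ. Qed.

Lemma tsumB u v A B : abs_sum_le u A -> abs_sum_le v B ->
  tsum (fun i => u i - v i) = tsum u - tsum v.
Proof. by move=> /abs_sum_cvg uA /abs_sum_cvg vB; exact: lim_seriesB. Qed.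

End absolute_sums.

Section series_derivative.
Context {R : realType}.

Lemma is_derive_of_quadratic (g : R -> R) (x l A : R) :
  (forall h, `|h| <= 1 -> `|g (x + h) - g x - h * l| <= A * h ^+ 2) ->
  is_derive x 1 g l.
Proof.
move=> H.
have A0 : 0 <= A.
  have := H 1; rewrite normr1 expr1n mulr1 => /(_ (lexx _)); exact: le_trans.
have C : h^-1 *: (g (h *: 1 + x) - g x) @[h --> 0^'] --> l.
  apply/cvgrPdist_le => e e0; near=> h.
  have h0 : h != 0 by near: h; exact: nbhs_dnbhs_neq.
  have h1 : `|h| <= 1.
    near: h; apply: dnbhs0_le; exact: ltr01.
  have he : `|h| <= e / (A + 1).
    by near: h; apply: dnbhs0_le; rewrite divr_gt0// ltr_wpDl.
  rewrite distrC.
  have -> : h^-1 *: (g (h *: 1 + x) - g x) - l = h^-1 * (g (x + h) - g x - h * l).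
    rewrite mulrBr mulrA mulVf// mul1r /GRing.scale/= mulr1.
    by rewrite [h + x]addrC.
  rewrite normrM normfV ler_pdivrMl ?normr_gt0//.
  apply: (le_trans (H h h1)).
  rewrite -real_normK ?num_real// expr2 mulrCA ler_wpM2l//.
  apply: (@le_trans _ _ ((A + 1) * (e / (A + 1)))).
    by apply: ler_pM => //; rewrite lerDl.
  by rewrite mulrC divfK// gt_eqF// ltr_wpDl.
by apply: DeriveDef; [apply/cvg_ex; exists l | exact/cvg_lim].
Unshelve. all: by end_near. Qed.

(** Two applications of [deriv_compare] on the segment from [x] to [x + h]. *)
Lemma second_order (u u' u'' : R -> R) (x h C : R) :
  (forall x : R, is_derive x 1 u (u' x)) -> (forall x : R, is_derive x 1 u' (u'' x)) ->
  `|h| <= 1 -> (forall y, `|y| <= `|x| + 1 -> `|u'' y| <= C) ->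
  `|u (x + h) - u x - h * u' x| <= C * h ^+ 2.
Proof.
move=> du du' h1 uC.
have C0 : 0 <= C by apply: le_trans (uC 0 _); rewrite ?normr0 ?addr_ge0.
have dsh (f f' : R -> R) k (t : R) : (forall x : R, is_derive x 1 f (f' x)) ->
    is_derive t 1 (fun t => f (x + k * t)) (k * f' (x + k * t)).
  move=> df; apply: (deq (dcomp (df _) (dadd (dcst x t) (dscale k (did t))))).
  by rewrite add0r mulr1 mulrC.
have seg t : 0 <= t <= 1 -> `|x + h * t| <= `|x| + 1.
  move=> /andP[t0 t1]; apply: (le_trans (ler_normD _ _)); rewrite lerD2l normrM.
  by rewrite (ger0_norm t0) mulr_ile1.
have D1 t : 0 <= t <= 1 -> `|u' (x + h * t) - u' x| <= C * `|h|.
  move=> /andP[t0 t1].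
  have := @deriv_compare _ (fun t => u' (x + h * t) - u' x) (fun t => h * u'' (x + h * t))
    (fun t => (C * `|h|) * t) (fun=> C * `|h|) 0 t t0.
  rewrite mulr0 addr0 subrr normr0 add0r mulr0 subr0 => H.
  apply: (le_trans (H _ _ _)).
  - move=> s; apply: (deq (dsub (dsh _ _ h s du') (dcst _ s))); by rewrite subr0.
  - by move=> s; apply: (deq (dscale _ (did s))); rewrite mulr1.
  - move=> s /andP[s0 st]; rewrite normrM mulrC ler_wpM2r// uC// seg// s0/=.
    exact: le_trans t1.
  - by rewrite ler_piMr// mulr_ge0.
have := @deriv_compare _ (fun t => u (x + h * t) - u x - h * t * u' x)
    (fun t => h * (u' (x + h * t) - u' x))
    (fun t => (C * h ^+ 2) * t) (fun=> C * h ^+ 2) 0 1 ler01.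
rewrite !mulr0 addr0 !mul0r subrr subr0 normr0 add0r subr0 !mulr1; apply.
- move=> s; apply: (deq (dsub (dsub (dsh _ _ h s du) (dcst _ s)) (dmul (dscale h (did s)) (dcst (u' x) s)))).
  by rewrite subr0 mulr0 add0r mulr1; ring.
- by move=> s; apply: (deq (dscale _ (did s))); rewrite mulr1.
- move=> s s01; rewrite normrM.
  apply: (le_trans (ler_wpM2l _ (D1 s s01))) => //.
  by rewrite mulrCA -expr2 real_normK ?num_real.
Qed.

(** Termwise differentiation under a summable bound on the second derivatives:
the second-order remainders add up to a quadratic one. *)
Lemma dtsum (u u' u'' : nat -> R -> R) (x A' A'' : R) (C : nat -> R) :
  (forall n (x : R), is_derive x 1 (u n) (u' n x)) ->
  (forall n (x : R), is_derive x 1 (u' n) (u'' n x)) ->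
  (forall y, exists A, abs_sum_le (fun n => u n y) A) ->
  abs_sum_le (fun n => u' n x) A' ->
  (forall n y, `|y| <= `|x| + 1 -> `|u'' n y| <= C n) -> abs_sum_le C A'' ->
  is_derive x 1 (fun y => tsum (fun n => u n y)) (tsum (fun n => u' n x)).
Proof.
move=> du du' uA uA' uC CA; apply: (@is_derive_of_quadratic _ _ _ A'') => h h1.
have [B1 H1] := uA (x + h); have [B2 H2] := uA x.
have N1k (k : R) : `|-1| * k = k by rewrite normrN1 mul1r.
have H12 : abs_sum_le (fun n => u n (x + h) - u n x) (B1 + B2).
  have := abs_sum_leD H1 (abs_sum_leZ (-1) H2); rewrite N1k.
  by apply: abs_sum_le_ext => n; rewrite mulN1r.
have H3 := abs_sum_leZ h uA'.
rewrite -(tsumB H1 H2) -(tsumZ h uA') -(tsumB H12 H3) mulrC.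
apply: tsum_le.
rewrite -[X in abs_sum_le _ (X * _)]ger0_norm ?sqr_ge0//.
have := abs_sum_leZ (h ^+ 2) CA; apply: abs_sum_leW => n.
apply: (le_trans (second_order (du n) (du' n) h1 (uC n))).
by rewrite mulrC ler_norm.
Qed.

End series_derivative.

(** * Unique continuation for Hermite series on the line *)

Section hermite_series_1d.
Context {R : realType}.
Variables (M : nat -> R).
Hypothesis M_gt0 : forall p, 0 < M p.
Hypothesis M_logconvex : forall p, M p.+1 ^+ 2 <= M p * M p.+2.
Hypothesis M_pp : exists C L : R, [/\ 0 < C, 1 <= L &
  forall p : nat, p%:R ^+ p <= C * L ^+ p * M p].
Local Notation N p := (Num.sqrt (M p)).
Hypothesis N_div : forall A : R, exists n, A <= \sum_(1 <= p < n) N p.-1 / N p.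

Let N_gt0 p : 0 < N p. Proof. by rewrite sqrtr_gt0. Qed.

Let N_logconvex p : N p.+1 ^+ 2 <= N p * N p.+2.
Proof.
rewrite -sqrtrM; last exact: ltW.
rewrite sqr_sqrtr; last exact: ltW.
rewrite -[leLHS]ger0_norm; last exact: ltW.
rewrite -sqrtr_sqr ler_sqrt ?mulr_ge0//; exact: ltW.
Qed.

(** The larger of k and p controls k + p. This separates the index of the
Hermite function from the order of derivation. *)
Lemma ladder_split (k p : nat) :
  (ladder (k + p) : R) ^+ p <= 2 ^+ p * (Num.sqrt k%:R ^+ p + Num.sqrt p%:R ^+ p).
Proof.
have H (i j : nat) : (i <= j)%N -> (ladder (i + j) : R) ^+ p <= 2 ^+ p * Num.sqrt j%:R ^+ p.
  move=> ij; rewrite -exprMn; apply: lerXn2r; rewrite ?nnegrE ?ladder_ge0 ?mulr_ge0 ?sqrtr_ge0//.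
  rewrite /ladder -[2 in leRHS]ger0_norm// -sqrtr_sqr -sqrtrM ?sqr_ge0//.
  rewrite ler_sqrt ?mulr_ge0 ?sqr_ge0//.
  rewrite expr2 -mulrA ler_pM2l// -natrM ler_nat mul2n -addnn leq_add2r//.
have [kp|pk] := leqP k p.
  apply: (le_trans (H k p kp)); rewrite ler_pM2l ?exprn_gt0// lerDr.
  by rewrite exprn_ge0 ?sqrtr_ge0.
rewrite addnC; apply: (le_trans (H p k (ltnW pk))); rewrite ler_pM2l ?exprn_gt0// lerDl.
by rewrite exprn_ge0 ?sqrtr_ge0.
Qed.

Section one_series.
Variables (k : nat -> nat) (b : nat -> R) (A : R).
Hypothesis bA : forall p, abs_sum_le (fun n => b n * Num.sqrt (k n)%:R ^+ p) (A * N p).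

(** The part k^(p/2) is paid for by the summability hypothesis of order p, the
part p^(p/2) by [M_pp]. *)
Lemma ladder_sum : exists A1 B1 : R, forall p,
  abs_sum_le (fun n => b n * ladder (k n + p) ^+ p) (A1 * B1 ^+ p * N p).
Proof.
have [C [L [C0 L1 Mpp]]] := M_pp.
exists (A + A * N 0 * Num.sqrt C), (2 * Num.sqrt L) => p.
have A0 : 0 <= A by rewrite -(@pmulr_lge0 _ (N 0))//; exact: abs_sum_le_ge0 (bA 0).
have sp : Num.sqrt p%:R ^+ p <= Num.sqrt C * Num.sqrt L ^+ p * N p.
  rewrite -(@ler_pXn2r _ 2)// ?nnegrE ?mulr_ge0 ?exprn_ge0 ?sqrtr_ge0//.
  rewrite !exprMn -!exprM ![(p * 2)%N]mulnC !exprM !sqr_sqrtr// ?(ltW C0) ?(ltW (M_gt0 _))//.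
  exact: le_trans ler01 L1.
have sL : 1 <= Num.sqrt L by rewrite -[leLHS]sqrtr1 ler_sqrt// (le_trans ler01).
have b0 : abs_sum_le b (A * N 0).
  by have := bA 0; apply: abs_sum_le_ext => n; rewrite expr0 mulr1.
have := abs_sum_leZ (2 ^+ p) (abs_sum_leD (bA p) (abs_sum_leZ (Num.sqrt p%:R ^+ p) b0)).
set u := fun i => _; move=> H.
have {H} H : abs_sum_le (fun i => `|b i| * (2 ^+ p * (Num.sqrt (k i)%:R ^+ p + Num.sqrt p%:R ^+ p)))
     (`|2 ^+ p| * (A * N p + `|Num.sqrt p%:R ^+ p| * (A * N 0))).
  move: H; apply: abs_sum_leW => i; rewrite /u normrM normr_id -normrM.
  rewrite le_eqVlt; apply/orP; left; apply/eqP; congr `|_|; ring.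
move=> n; apply: (@le_trans _ _ (`|2 ^+ p| * (A * N p + `|Num.sqrt p%:R ^+ p| * (A * N 0)))).
  move: n; apply: abs_sum_leW H => i; rewrite !normrM normr_id ler_wpM2l//.
  rewrite ger0_norm ?exprn_ge0 ?ladder_ge0// -normrM.
  by apply: (le_trans (ladder_split _ _)); rewrite ler_norm.
rewrite !ger0_norm ?exprn_ge0 ?sqrtr_ge0// exprMn.
have -> : (A + A * N 0 * Num.sqrt C) * (2 ^+ p * Num.sqrt L ^+ p) * N p =
   2 ^+ p * (A * N p * Num.sqrt L ^+ p + (Num.sqrt C * Num.sqrt L ^+ p * N p) * (A * N 0)).
  by ring.
rewrite ler_pM2l ?exprn_gt0//; apply: lerD.
  rewrite ler_peMr ?mulr_ge0 ?sqrtr_ge0//.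
  by rewrite exprn_ege1.
by rewrite ler_wpM2r// mulr_ge0 ?sqrtr_ge0.
Qed.

Definition hermite_series p (x : R) := tsum (fun n => b n * hermite_deriv p (k n) x).

Lemma hermite_series_abs : exists A1 B1 : R, forall p (T x : R), `|x| <= T ->
  abs_sum_le (fun n => b n * hermite_deriv p (k n) x) (expR (T ^+ 2 / 2) * A1 * B1 ^+ p * N p).
Proof.
have [A1 [B1 H]] := ladder_sum; exists A1, B1 => p T x xT.
have := abs_sum_leZ (expR (T ^+ 2 / 2)) (H p).
rewrite ger0_norm ?expR_ge0// !mulrA; apply: abs_sum_leW => i.
rewrite normrM mulrCA [leRHS]normrM ler_wpM2l//.
apply: (le_trans (hermite_deriv_le _ _ _)).
rewrite [leRHS]ger0_norm; last by rewrite mulr_ge0 ?expR_ge0 ?exprn_ge0 ?ladder_ge0.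
rewrite ler_wpM2r ?exprn_ge0 ?ladder_ge0// ler_expR ler_pM2r//.
rewrite -(real_normK (num_real x)); apply: lerXn2r; rewrite ?nnegrE//.
exact: le_trans xT.
Qed.

Lemma dhermite_series p (x : R) : is_derive x 1 (hermite_series p) (hermite_series p.+1 x).
Proof.
have [A1 [B1 H]] := hermite_series_abs; have [A2 [B2 H2]] := ladder_sum.
pose T := `|x| + 1.
apply: (@dtsum R (fun n y => b n * hermite_deriv p (k n) y)
  (fun n y => b n * hermite_deriv p.+1 (k n) y)
  (fun n y => b n * hermite_deriv p.+2 (k n) y) x
  (expR (T ^+ 2 / 2) * A1 * B1 ^+ p.+1 * N p.+1)
  (expR (T ^+ 2 / 2) * (A2 * B2 ^+ p.+2 * N p.+2))
  (fun n => expR (T ^+ 2 / 2) * (`|b n| * ladder (k n + p.+2) ^+ p.+2))).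
- by move=> n y; apply: dscale; exact: dhermite_deriv.
- by move=> n y; apply: dscale; exact: dhermite_deriv.
- by move=> y; eexists; exact: (H p `|y| y (lexx _)).
- by apply: H; rewrite lerDl.
- move=> n y yT; rewrite normrM mulrCA ler_wpM2l//.
  apply: (le_trans (hermite_deriv_le _ _ _)).
  rewrite ler_wpM2r ?exprn_ge0 ?ladder_ge0// ler_expR ler_pM2r//.
  rewrite -(real_normK (num_real y)); apply: lerXn2r; rewrite ?nnegrE//.
  exact: le_trans yT.
- rewrite -[X in abs_sum_le _ (X * _)]ger0_norm ?expR_ge0//.
  apply: abs_sum_leZ; apply: abs_sum_leW (H2 p.+2) => i.
  by rewrite !normrM normr_id.
Qed.

(** By [hermite_series_abs] the derivatives are bounded by A B^p sqrt(M_p) on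
bounded intervals, so the sum belongs to a quasi-analytic class. *)
Lemma hermite_series_unique :
  lebesgue_measure [set x | tsum (fun n => b n * hermite (k n) x) = 0] != 0%E ->
  forall x, tsum (fun n => b n * hermite (k n) x) = 0.
Proof.
apply: (@quasi_analytic_unique _ (fun p => N p) hermite_series) => //.
- exact: dhermite_series.
- move=> T; have [A1 [B1 H]] := hermite_series_abs.
  exists (expR (T ^+ 2 / 2) * A1), B1 => p x xT.
  exact: tsum_le (H p T x xT).
Qed.

End one_series.

End hermite_series_1d.

(** * Integrals of tensor products *)

Section tensor_product.
Context d1 d2 (T1 : measurableType d1) (T2 : measurableType d2) (R : realType).
Variable m1 : {sigma_finite_measure set T1 -> \bar R}.
Variable m2 : {sigma_finite_measure set T2 -> \bar R}.
Variables (u : T1 -> R) (v : T2 -> R).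
Hypothesis iu : m1.-integrable setT (EFin \o u).
Hypothesis iv : m2.-integrable setT (EFin \o v).
Local Open Scope ereal_scope.

Lemma integrable_tensor :
  (m1 \x m2).-integrable setT (fun z => (u z.1 * v z.2)%:E).
Proof.
have mu : measurable_fun setT u by apply/measurable_EFinP; exact: measurable_int iu.
have mv : measurable_fun setT v by apply/measurable_EFinP; exact: measurable_int iv.
apply/integrable12ltyP.
  apply/measurable_EFinP; apply: measurable_funM.
    exact: measurableT_comp.
  exact: measurableT_comp.
rewrite (eq_integral (fun x => `|(u x)%:E| * \int[m2]_y `|(v y)%:E|)); last first.
  move=> x _; rewrite -ge0_integralZl//=.
    by apply: eq_integral => y _; rewrite /= normrM.
  by apply/measurable_EFinP; exact: measurableT_comp.
have /integrableP[_ iv'] := iv; have /integrableP[_ iu'] := iu.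
rewrite ge0_integralZr//=; last 2 first.
- by apply/measurable_EFinP; exact: measurableT_comp.
- by apply: integral_ge0.
by apply: lte_mul_pinfty => //; [exact: integral_ge0 | rewrite ge0_fin_numE//; exact: integral_ge0].
Qed.

Lemma integral_tensor :
  \int[m1 \x m2]_z (u z.1 * v z.2)%:E = (\int[m1]_x (u x)%:E) * (\int[m2]_y (v y)%:E).
Proof.
rewrite -(integral12_prod_meas1 integrable_tensor) /fubini_F/=.
rewrite (eq_integral (fun x => (u x)%:E * \int[m2]_y (v y)%:E)); last first.
  move=> x _; rewrite -integralZl//.
have /fineK <- : \int[m2]_y (v y)%:E \is a fin_num by apply: integrable_fin_num.
by rewrite integralZr.
Qed.

End tensor_product.

Section euclidean_borel.
Context {R : realType}.
Local Notation B := (measurableTypeR R).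
Local Notation leb := (@lebesgue_measure R).
Local Open Scope ereal_scope.

Lemma borel_tonelli d (f : d.+1.-tuple B -> \bar R) :
  measurable_fun setT f -> (forall x, 0 <= f x) ->
  \int[borel_lebesgue d.+1]_x f x =
  \int[borel_lebesgue d]_y \int[leb]_t f (cons_point (t, y)).
Proof.
move=> mf f0; rewrite /= /borel_lebesgueS.
rewrite (ge0_integral_pushforward (@measurable_cons_point R d))//.
have mg : measurable_fun setT (f \o @cons_point R d).
  by apply: measurableT_comp => //; exact: (@measurable_cons_point R d).
rewrite preimage_setT (fubini_tonelli2 (f \o @cons_point R d))//.
by move=> z; exact: f0.
Qed.

Lemma integrable_prod d (u : 'I_d -> B -> R) :
  (forall i, leb.-integrable setT (EFin \o u i)) ->
  (borel_lebesgue d).-integrable setT (fun x : d.-tuple B => (\prod_(i < d) u i (tnth x i))%:E) /\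
  \int[borel_lebesgue d]_x (\prod_(i < d) u i (tnth x i))%:E =
    (\prod_(i < d) fine (\int[leb]_t (u i t)%:E))%:E.
Proof.
elim: d u => [|d IH] u iu.
  split.
    rewrite (_ : (fun _ => _) = cst 1).
      by apply: finite_measure_integrable_cst.
    by apply/funext => x; rewrite big_ord0.
  rewrite (eq_integral (cst 1)); last by move=> x _; rewrite big_ord0.
  by rewrite integral_cst//= big_ord0 diracT mule1.
have [iV EV] := IH (fun i => u (lift ord0 i)) (fun i => iu _).
set V := fun x : d.-tuple B => (\prod_(i < d) u (lift ord0 i) (tnth x i))%R.
have E : (fun x : d.+1.-tuple B => (\prod_(i < d.+1) u i (tnth x i))%:E) \o @cons_point R d =
    (fun z => (u ord0 z.1 * V z.2)%:E).
  apply/funext => -[t x] /=; rewrite big_ord_recl /=; congr ((_ * _)%:E)%R.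
  by apply: eq_bigr => i _; rewrite tnthS.
have iT : (leb \x borel_lebesgue d).-integrable setT
    ((fun x : d.+1.-tuple B => (\prod_(i < d.+1) u i (tnth x i))%:E) \o @cons_point R d).
  by rewrite E; exact: integrable_tensor.
have mP : measurable_fun setT (fun x : d.+1.-tuple B => (\prod_(i < d.+1) u i (tnth x i))%:E).
  apply/measurable_EFinP; apply: measurable_prod => i _.
  apply: measurableT_comp; last exact: measurable_tnth.
  by apply/measurable_EFinP; exact: measurable_int (iu i).
split.
  rewrite /= /borel_lebesgueS.
  apply: integrable_pushforward => //; exact: (@measurable_cons_point R d).
rewrite /= /borel_lebesgueS integral_pushforward//; last exact: (@measurable_cons_point R d).
rewrite preimage_setT E integral_tensor// EV big_ord_recl EFinM fineK//.
exact: (integrable_fin_num measurableT (iu ord0)).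
Qed.

End euclidean_borel.

(** * Unique continuation for Hermite series in several variables *)

Section hermite_tensor.
Context {R : realType}.
Local Notation B := (measurableTypeR R).

Definition hermite_tensor d (a : d.-tuple nat) (x : d.-tuple B) : R :=
  \prod_(j < d) hermite (tnth a j) (tnth x j).

Lemma hermite_tensor_cons d (a : d.+1.-tuple nat) (t : B) (x : d.-tuple B) :
  hermite_tensor a (cons_point (t, x)) =
  hermite (thead a) t * hermite_tensor [tuple of behead a] x.
Proof.
rewrite /hermite_tensor big_ord_recl /=; congr (_ * _).
apply: eq_bigr => i _; rewrite tnthS; congr (hermite _ _).
by rewrite tnth_behead; congr tnth; apply: val_inj; rewrite /= inordK// ltnS.
Qed.

Lemma hermite_tensor_le d (a : d.-tuple nat) (x : d.-tuple B) :
  `|hermite_tensor a x| <= \prod_(j < d) expR (tnth x j ^+ 2 / 2).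
Proof.
rewrite /hermite_tensor normr_prod; apply: ler_prod => j _.
by rewrite normr_ge0 hermite_le.
Qed.

Lemma measurable_hermite_tensor d (a : d.-tuple nat) :
  measurable_fun setT (hermite_tensor a).
Proof.
apply: measurable_prod => j _; apply: (measurableT_comp (@measurable_hermite R _)).
exact: measurable_tnth.
Qed.

Lemma mindex_sizeS d (a : d.+1.-tuple nat) :
  mindex_size a = (thead a + mindex_size [tuple of behead a])%N.
Proof.
rewrite /mindex_size big_ord_recl; congr addn; apply: eq_bigr => i _.
by rewrite tnth_behead; congr tnth; apply: val_inj; rewrite /= inordK// ltnS.
Qed.

Lemma hermite_tensor_sum d (a : nat -> d.-tuple nat) (c : nat -> R) (A : R) :
  abs_sum_le c A -> forall x : d.-tuple B,
  abs_sum_le (fun n => c n * hermite_tensor (a n) x) (\prod_(j < d) expR (tnth x j ^+ 2 / 2) * A).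
Proof.
move=> cA x.
have p0 : 0 <= \prod_(j < d) expR (tnth x j ^+ 2 / 2) by apply: prodr_ge0 => j _; exact: expR_ge0.
rewrite -[X in abs_sum_le _ (X * _)]ger0_norm//.
apply: abs_sum_leW (abs_sum_leZ _ cA) => n.
by rewrite !normrM mulrC (ger0_norm p0) ler_wpM2r// hermite_tensor_le.
Qed.

Lemma measurable_tensor_series d (a : nat -> d.-tuple nat) (c : nat -> R) (A : R) :
  abs_sum_le c A -> measurable_fun setT (fun x => tsum (fun n => c n * hermite_tensor (a n) x)).
Proof.
move=> cA.
apply: (@measurable_fun_cvg _ _ R setT (fun m x => series (fun n => c n * hermite_tensor (a n) x) m)).
  move=> m; rewrite /series/=; apply: measurable_sum => n.
  by apply: measurable_funM => //; exact: measurable_hermite_tensor.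
by move=> x _; exact: abs_sum_cvg (hermite_tensor_sum a cA x).
Qed.

End hermite_tensor.

Section null_slices.
Context {R : realType}.
Local Notation B := (measurableTypeR R).
Local Notation leb := (@lebesgue_measure R).
Local Open Scope ereal_scope.

(** Tonelli's theorem for the indicator of [Z], integrating first in the first
coordinate. *)
Lemma borel_null_slices d (Z : set (d.+1.-tuple B)) (Y : set (d.-tuple B)) :
  measurable Z -> measurable Y -> borel_lebesgue d Y = 0 ->
  (forall y, ~ Y y -> leb [set t | Z (cons_point (t, y))] = 0) ->
  borel_lebesgue d.+1 Z = 0.
Proof.
move=> mZ mY Y0 sl.
have m1 : measurable_fun setT (fun x => (\1_Z x)%:E : \bar R).
  exact/measurable_EFinP/measurable_indic.
rewrite -[Z]setIT -integral_indic// borel_tonelli//.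
have E y : \int[leb]_t (\1_Z (cons_point (t, y)))%:E = leb [set t | Z (cons_point (t, y))].
  rewrite -[[set t | Z _]]setIT -integral_indic//.
  rewrite -[X in measurable X]setTI.
  have mt : measurable_fun setT (fun t : B => (t, y)) by apply: measurable_fun_pair.
  exact: (measurableT_comp (@measurable_cons_point R d) mt).
under eq_integral do rewrite E.
rewrite (@ge0_ae_eq_integral _ _ _ _ _ _ (cst 0))//.
- by rewrite integral0.
- rewrite (_ : (fun _ => _) = fubini_G leb ((fun x => (\1_Z x)%:E) \o @cons_point R d)).
    apply: measurable_fun_fubini_tonelli_G; last by move=> z; rewrite lee_fin.
    by apply: measurableT_comp => //; exact: (@measurable_cons_point R d).
  by apply/funext => y; rewrite -E.
- exists Y; split => // y /=; apply: contra_notP => Yy _.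
  exact: sl.
Qed.

End null_slices.

Lemma norm_weight_le {R : realType} (c h s e s' : R) : `|h| <= e -> `|s| <= `|s'| ->
  `|(c * h) * s| <= `|e * (c * s')|.
Proof.
move=> he ss; have e0 : 0 <= e by exact: le_trans he.
rewrite !normrM [`|e|]ger0_norm// mulrCA -mulrA ler_wpM2l//.
exact: ler_pM.
Qed.

Section tensor_uniqueness.
Context {R : realType}.
Local Notation B := (measurableTypeR R).
Variables (M : nat -> R).
Hypothesis M_gt0 : forall p, 0 < M p.
Hypothesis M_logconvex : forall p, M p.+1 ^+ 2 <= M p * M p.+2.
Hypothesis M_pp : exists C L : R, [/\ 0 < C, 1 <= L &
  forall p : nat, p%:R ^+ p <= C * L ^+ p * M p].
Local Notation N p := (Num.sqrt (M p)).
Hypothesis N_div : forall A : R, exists n, A <= \sum_(1 <= p < n) N p.-1 / N p.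

(** Induction on the dimension. With all coordinates but the first frozen at y,
the sum is a Hermite series on the line, so it vanishes identically in t or
only on a null set of t. With the first coordinate frozen at t it is a series
to which the induction hypothesis applies. If the sum is not zero at some
(t, y), the y where it vanishes for this t form a null set; every other slice
is not identically zero, hence has a null zero set, and the whole zero set is
null. *)
Lemma tensor_series_unique d (a : nat -> d.-tuple nat) (c : nat -> R) (A : R) :
  (forall p, abs_sum_le (fun n => c n * Num.sqrt (mindex_size (a n))%:R ^+ p) (A * N p)) ->
  borel_lebesgue d [set x : d.-tuple B | tsum (fun n => c n * hermite_tensor (a n) x) = 0] != 0%E ->
  forall x : d.-tuple B, tsum (fun n => c n * hermite_tensor (a n) x) = 0.
Proof.
elim: d a c A => [|d IH] a c A cA Z0 x.
  have [y /= <-] : [set x : 0.-tuple B | tsum (fun n => c n * hermite_tensor (a n) x) = 0] !=set0.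
    by apply/set0P; apply: contraNneq Z0 => ->; rewrite measure0.
  by congr tsum; apply/funext => n; rewrite /hermite_tensor !big_ord0.
have c0 : abs_sum_le c (A * N 0).
  by have := cA 0; apply: abs_sum_le_ext => n; rewrite expr0 mulr1.
pose b n := [tuple of behead (a n)].
pose F (t : B) (y : d.-tuple B) :=
  tsum (fun n => (c n * hermite (thead (a n)) t) * hermite_tensor (b n) y).
have FE t y : tsum (fun n => c n * hermite_tensor (a n) (cons_point (t, y))) = F t y.
  by congr tsum; apply/funext => n; rewrite hermite_tensor_cons mulrA.
have ct (t : R) p : abs_sum_le (fun n => (c n * hermite (thead (a n)) t) *
     Num.sqrt (mindex_size (b n))%:R ^+ p) (expR (t ^+ 2 / 2) * A * N p).
  rewrite -mulrA -[X in abs_sum_le _ (X * _)]ger0_norm ?expR_ge0//.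
  apply: abs_sum_leW (abs_sum_leZ _ (cA p)) => n.
  apply: norm_weight_le; first exact: hermite_le.
  rewrite !normrX; apply: lerXn2r; rewrite ?nnegrE//.
  by rewrite !ger0_norm ?sqrtr_ge0// ler_sqrt// ler_nat mindex_sizeS leq_addl.
have slice y : lebesgue_measure [set t : B | F t y = 0] != 0%E -> forall t, F t y = 0.
  have F1 t : F t y = tsum (fun n => (c n * hermite_tensor (b n) y) * hermite (thead (a n)) t).
    by congr tsum; apply/funext => n; ring.
  move=> F0 t; rewrite F1.
  apply: (@hermite_series_unique R M M_gt0 M_logconvex M_pp N_div _ _
    (\prod_(j < d) expR (tnth y j ^+ 2 / 2) * A)); last first.
    apply: contra_neq F0 => <-; congr lebesgue_measure.
    by apply/seteqP; split => s /=; rewrite F1.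
  move=> p; rewrite -mulrA.
  have p0 : 0 <= \prod_(j < d) expR (tnth y j ^+ 2 / 2) by apply: prodr_ge0 => j _; exact: expR_ge0.
  rewrite -[X in abs_sum_le _ (X * _)]ger0_norm//.
  apply: abs_sum_leW (abs_sum_leZ _ (cA p)) => n.
  apply: norm_weight_le; first exact: hermite_tensor_le.
  rewrite !normrX; apply: lerXn2r; rewrite ?nnegrE//.
  by rewrite !ger0_norm ?sqrtr_ge0// ler_sqrt// ler_nat mindex_sizeS leq_addr.
have ct0 (t : R) : abs_sum_le (fun n => c n * hermite (thead (a n)) t) (expR (t ^+ 2 / 2) * A * N 0).
  by have := ct t 0; apply: abs_sum_le_ext => n; rewrite expr0 mulr1.
suff Fz t y : F t y = 0.
  have -> : x = cons_point (thead x, [tuple of behead x]) by apply: val_inj; case: x => -[].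
  by rewrite FE.
apply: (IH b _ _ (ct t)); apply: contra_neq Z0 => Yt0.
apply: (@borel_null_slices R d _ [set y | F t y = 0]) => //.
- rewrite -[X in measurable X]setTI; exact: (measurable_tensor_series a c0 measurableT (measurable_set1 0)).
- rewrite -[X in measurable X]setTI; exact: (measurable_tensor_series b (ct0 t) measurableT (measurable_set1 0)).
- move=> z /= Fz; apply/eqP; apply: contraPT Fz => Fz; apply.
  apply: slice; apply: contra_neq Fz => <-; congr lebesgue_measure.
  by apply/seteqP; split => s /=; rewrite FE.
Qed.

End tensor_uniqueness.

(** * Real-valued integrals *)

Lemma normM_le_sqrD {R : realType} (u v : R) : `|u * v| <= u ^+ 2 + v ^+ 2.
Proof.
rewrite normrM -(real_normK (num_real u)) -(real_normK (num_real v)).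
have := sqr_ge0 (`|u| - `|v|); rewrite sqrrB.
have : 0 <= `|u| * `|v| by rewrite mulr_ge0.
rewrite -mulr_natr; lra.
Qed.

Section real_integrals.
Context d (T : measurableType d) (R : realType) (mu : {measure set T -> \bar R}).
Implicit Types f g : T -> R.

Definition intg f := mu.-integrable setT (EFin \o f).

Lemma intg_measurable f : intg f -> measurable_fun setT f.
Proof. by move=> fi; apply/measurable_EFinP; exact: measurable_int fi. Qed.

Lemma intg_le f g : measurable_fun setT f -> (forall x, `|f x| <= g x) -> intg g -> intg f.
Proof.
move=> mf fg; apply: le_integrable => //; first exact/measurable_EFinP.
by move=> x _; rewrite lee_fin (le_trans (fg x))// ler_norm.
Qed.

Lemma intgD f g : intg f -> intg g -> intg (fun x => f x + g x).
Proof. by move=> fi gi; exact: (integrableD measurableT fi gi). Qed.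

Lemma intgB f g : intg f -> intg g -> intg (fun x => f x - g x).
Proof. by move=> fi gi; exact: (integrableB measurableT fi gi). Qed.

Lemma intgZ k f : intg f -> intg (fun x => k * f x).
Proof. by move=> fi; exact: (integrableZl measurableT k fi). Qed.

Lemma intg_sum n (f : nat -> T -> R) : (forall i, intg (f i)) ->
  intg (fun x => \sum_(0 <= i < n) f i x).
Proof.
move=> fi; elim: n => [|n IH].
  rewrite (_ : (fun _ => _) = cst 0); first exact: integrable0.
  by apply/funext => x; rewrite big_geq.
rewrite (_ : (fun _ => _) = (fun x => (\sum_(0 <= i < n) f i x) + f n x)); first exact: intgD.
by apply/funext => x; rewrite big_nat_recr.
Qed.

Lemma Rint_sum n (f : nat -> T -> R) : (forall i, intg (f i)) ->
  \int[mu]_x (\sum_(0 <= i < n) f i x) = \sum_(0 <= i < n) \int[mu]_x f i x.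
Proof.
move=> fi; elim: n => [|n IH].
  rewrite big_geq// -[RHS](@Rintegral_set0 _ _ _ mu (fun=> 0)) /Rintegral; congr fine.
  rewrite integral_set0 integral0_eq// => x _; by rewrite big_geq.
rewrite big_nat_recr//= -IH -(RintegralD measurableT (intg_sum n fi) (fi n)).
by apply: eq_Rintegral => x _; rewrite big_nat_recr.
Qed.

Lemma dominated_Rint (f_ : nat -> T -> R) f g :
  (forall n, measurable_fun setT (f_ n)) ->
  (forall x, f_ ^~ x @ \oo --> f x) ->
  (forall n x, `|f_ n x| <= g x) -> intg g ->
  intg f /\ (fun n => \int[mu]_x f_ n x) @ \oo --> \int[mu]_x f x.
Proof.
move=> mf_ ff fg gi.
have mf : measurable_fun setT f by exact: measurable_fun_cvg (fun x _ => ff x).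
have [] := @dominated_convergence _ _ _ mu setT measurableT (fun n => EFin \o f_ n)
  (EFin \o f) (EFin \o g) _ _ _ gi.
- by move=> n; exact/measurable_EFinP.
- exact/measurable_EFinP.
- by apply: aeW => x _; apply/fine_cvgP; split; [exact: nearW|exact: ff].
- by apply: aeW => x n _ /=; rewrite lee_fin.
move=> fi _ H; split => //.
apply: fine_cvg; rewrite fineK; last exact: (integrable_fin_num measurableT fi).
exact: H.
Qed.

Lemma ae_eq_Rint f g : measurable_fun setT f -> measurable_fun setT g ->
  {ae mu, forall x, f x = g x} -> \int[mu]_x f x = \int[mu]_x g x.
Proof.
move=> mf mg fg; rewrite /Rintegral; congr fine.
apply: ae_eq_integral => //; [exact/measurable_EFinP|exact/measurable_EFinP|].
by apply: filterS fg => x + _ => ->.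
Qed.

Definition sq_intg f := measurable_fun setT f /\ intg (fun x => f x ^+ 2).

Lemma sq_intgM f g : sq_intg f -> sq_intg g -> intg (fun x => f x * g x).
Proof.
move=> [mf fi] [mg gi]; apply: (@intg_le _ (fun x => f x ^+ 2 + g x ^+ 2)).
- exact: measurable_funM.
- by move=> x; exact: normM_le_sqrD.
- exact: intgD.
Qed.

Lemma sq_intg_le f g : measurable_fun setT f -> (forall x, `|f x| <= `|g x|) ->
  sq_intg g -> sq_intg f.
Proof.
move=> mf fg [mg gi]; split => //; apply: intg_le gi; first exact: measurable_funX.
by move=> x; rewrite normrX -[leRHS]real_normK ?num_real// lerXn2r ?nnegrE.
Qed.

Lemma intg_sqr_indic f (A : set T) : sq_intg f -> measurable A ->
  intg (fun x => f x ^+ 2 * \1_A x).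
Proof.
move=> [mf fi] mA; apply: intg_le fi.
  by apply: measurable_funM; [exact: measurable_funX|exact: measurable_indic].
move=> x; rewrite ger0_norm; last by rewrite mulr_ge0 ?sqr_ge0.
by rewrite ler_piMr ?sqr_ge0// indicE; case: (_ \in _).
Qed.

Lemma measurable_sublevel f (a : R) : measurable_fun setT f ->
  measurable [set x | `|f x| <= a].
Proof.
move=> mf; have mN : measurable_fun setT (fun x => `|f x|) by exact: measurableT_comp.
have := mN measurableT `]-oo, a]%classic (measurable_itv _); rewrite setTI.
by congr measurable; apply/seteqP; split => x /=; rewrite in_itv.
Qed.

Lemma Rint_eq0_limit (f_ : nat -> T -> R) f g :
  (forall n, measurable_fun setT (f_ n)) ->
  (forall x, f_ ^~ x @ \oo --> f x) ->
  (forall n x, `|f_ n x| <= g x) -> intg g ->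
  (forall n, \int[mu]_x f_ n x = 0) -> \int[mu]_x f x = 0.
Proof.
move=> mf ff fg gi f0; have [_ /cvg_lim <-//] := dominated_Rint mf ff fg gi.
by under eq_fun do rewrite f0; exact: lim_cst.
Qed.

End real_integrals.

(** * Gaussian moments and orthonormality *)

(** The difference of the two sides is (t - 2 s)^2 / 2. *)
Lemma shifted_sqr_ge {R : realType} (t s : R) : 2^-1 * t ^+ 2 - s ^+ 2 <= (t - s) ^+ 2.
Proof.
rewrite -subr_ge0 (_ : _ - _ = (t - 2 * s) ^+ 2 / 2); last by field.
by apply: divr_ge0 => //; exact: sqr_ge0.
Qed.

Section gaussian_moments.
Context {R : realType}.
Local Notation leb := (@lebesgue_measure R).

(** Any polynomial is absorbed by half of the Gaussian exponent. In Horner form,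
each factor t costs half of what is left. *)
Lemma poly_gauss_le (P : {poly R}) (l : R) : 0 < l -> exists2 C : R, 0 <= C &
  forall t, `|P.[t]| * expR (- (l * t ^+ 2)) <= C * expR (- (l / 2 * t ^+ 2)).
Proof.
have small (c l' : R) t : 0 <= c -> 0 < l' ->
    c * expR (- (l' * t ^+ 2)) <= c * expR (- (l' / 2 * t ^+ 2)).
  move=> c0 l0; rewrite ler_wpM2l// ler_expR lerN2.
  by rewrite ler_wpM2r ?sqr_ge0//; lra.
elim/poly_ind: P l => [|P c IH] l l0.
  by exists 0 => // t; rewrite horner0 normr0 !mul0r.
have [C C0 HC] := IH (l / 2) ltac:(by rewrite divr_gt0).
exists (C * (1 + 4 / l) + `|c|); first by rewrite addr_ge0// mulr_ge0// addr_ge0// divr_ge0// ltW.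
move=> t; rewrite hornerMXaddC.
apply: (@le_trans _ _ ((`|P.[t]| * `|t| + `|c|) * expR (- (l * t ^+ 2)))).
  by rewrite ler_wpM2r ?expR_ge0// -normrM ler_normD.
rewrite [leLHS]mulrDl [leRHS]mulrDl; apply: lerD; last exact: small.
have E2 : expR (- (l * t ^+ 2)) = expR (- (l / 2 * t ^+ 2)) * expR (- (l / 2 * t ^+ 2)).
  by rewrite -expRD; congr expR; field.
have E4 : expR (- (l / 2 * t ^+ 2)) = expR (- (l / 2 / 2 * t ^+ 2)) * expR (- (l / 2 / 2 * t ^+ 2)).
  by rewrite -expRD; congr expR; field.
have tle : `|t| * expR (- (l / 2 * t ^+ 2)) <= (1 + 4 / l) * expR (- (l / 2 / 2 * t ^+ 2)).
  rewrite E4 mulrA ler_wpM2r ?expR_ge0//.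
  rewrite expRN ler_pdivrMr ?expR_gt0//.
  apply: (@le_trans _ _ ((1 + 4 / l) * (1 + l / 2 / 2 * t ^+ 2))); last first.
    rewrite ler_wpM2l ?expR_ge1Dx// addr_ge0// divr_ge0// ltW//.
  have -> : (1 + 4 / l) * (1 + l / 2 / 2 * t ^+ 2) =
     1 + t ^+ 2 + (4 / l + l / 2 / 2 * t ^+ 2) by field; rewrite gt_eqF.
  apply: (@le_trans _ _ (1 + t ^+ 2)).
    rewrite -(real_normK (num_real t)); have := sqr_ge0 (`|t| - 1); rewrite sqrrB.
    have := normr_ge0 t; rewrite expr1n mulr1 -mulr_natr; nra.
  rewrite lerDl; apply: addr_ge0; first by rewrite divr_ge0// ltW.
  by rewrite mulr_ge0 ?sqr_ge0// !divr_ge0// ltW.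
rewrite E2 mulrACA.
apply: (le_trans (ler_pM _ _ (HC t) tle)); rewrite ?mulr_ge0 ?expR_ge0//.
by rewrite mulrACA -E4.
Qed.

Lemma gauss_intg (l : R) : 0 < l -> intg leb (fun t => expR (- (l * t ^+ 2))).
Proof.
move=> l0; pose s := (Num.sqrt (2 * l))^-1.
have s0 : s != 0 by rewrite invr_neq0// gt_eqF// sqrtr_gt0 mulr_gt0.
have := @integrable_normal_pdf R 0 s.
rewrite normal_pdfE// => /(intgZ (normal_peak s)^-1).
set f := fun _ => _; set g := fun _ => _; suff -> : f = g by [].
apply/funext => t; rewrite /f /g mulKf; last by rewrite gt_eqF// normal_peak_gt0.
rewrite /normal_fun subr0 /s exprVn sqr_sqrtr ?mulr_ge0 ?(ltW l0)//.
congr expR; rewrite -mulr_natr; field; rewrite gt_eqF//.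
Qed.

Lemma measurable_horner (P : {poly R}) : measurable_fun setT (fun t : R => P.[t]).
Proof. by apply: continuous_measurable_fun; exact: continuous_horner. Qed.

Lemma measurable_gaussl (l : R) : measurable_fun setT (fun t : R => expR (- (l * t ^+ 2))).
Proof.
apply: measurableT_comp => //; apply: measurableT_comp => //.
by apply: measurable_funM => //; exact: measurable_funX.
Qed.

Lemma poly_gauss_intg (P : {poly R}) (l : R) : 0 < l ->
  intg leb (fun t => P.[t] * expR (- (l * t ^+ 2))).
Proof.
move=> l0; have [C C0 HC] := poly_gauss_le P l0.
apply: (intg_le _ _ (intgZ C (@gauss_intg (l / 2) _))); last by rewrite divr_gt0.
- by apply: measurable_funM; [exact: measurable_horner|exact: measurable_gaussl].
- by move=> t; rewrite normrM (ger0_norm (expR_ge0 _)).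
Qed.

Lemma hermite_decay k : exists2 C : R, 0 <= C &
  forall t, `|hermite k t| <= C * expR (- (4^-1 * t ^+ 2)).
Proof.
have [C C0 HC] := @poly_gauss_le (hermite_poly k) 2^-1 ltac:(by []).
exists (C / hermite_scale k) => [|t]; first by rewrite divr_ge0// ltW// hermite_scale_gt0.
rewrite hermiteE normrM [X in _ * X]ger0_norm ?expR_ge0// normrM.
have si : 0 <= (hermite_scale k)^-1 :> R by rewrite invr_ge0 ltW// hermite_scale_gt0.
rewrite (ger0_norm si) mulrAC [leRHS]mulrAC ler_wpM2r//.
have := HC t; rewrite (_ : 2^-1 / 2 = 4^-1); last by field.
by rewrite [t ^+ 2 / 2]mulrC.
Qed.

(** The factor [1 *] makes the weight an instance of [expR (- (l * t ^+ 2))]. *)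
Definition gauss_moment (P : {poly R}) : R := \int[leb]_t (P.[t] * expR (- (1 * t ^+ 2))).

Lemma gauss_momentB P Q : gauss_moment (P - Q) = gauss_moment P - gauss_moment Q.
Proof.
rewrite /gauss_moment -(RintegralB measurableT (poly_gauss_intg P ltr01) (poly_gauss_intg Q ltr01)).
by apply: eq_Rintegral => t _; rewrite hornerD hornerN mulrBl.
Qed.

Lemma gauss_momentZ c P : gauss_moment (c%:P * P) = c * gauss_moment P.
Proof.
rewrite /gauss_moment -(RintegralZl c measurableT (poly_gauss_intg P ltr01)).
by apply: eq_Rintegral => t _; rewrite hornerM hornerC -mulrA.
Qed.

(** The integrand is the derivative of P e^(-t^2), which vanishes at infinity. *)
Lemma gauss_moment_deriv P : gauss_moment (P^`() - 2%:P * 'X * P) = 0.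
Proof.
pose Q := P^`() - 2%:P * 'X * P.
pose g t := P.[t] * expR (- (1 * t ^+ 2)).
pose g' t := Q.[t] * expR (- (1 * t ^+ 2)).
have dg (t : R) : is_derive t 1 g (g' t).
  apply: (@dfun R (fun t : R => P.[t] * expR (- t ^+ 2))); last by move=> s; rewrite /g mul1r.
  apply: (deq (dmul (dhorner P t) (dgauss t))).
  by rewrite /g' /Q mul1r !(hornerD, hornerN, hornerM, hornerC, hornerX); ring.
have cg : continuous g.
  by move=> t; apply/differentiable_continuous/derivable1_diffP; have [] := dg t.
have cg' : continuous g'.
  move=> t; apply: cvgM; first exact: continuous_horner.
  apply: continuous_comp; last exact: continuous_expR.
  by apply: cvgN; apply: cvgM; [exact: cvg_cst|exact: exprn_continuous].
have [C C0 HC] := @poly_gauss_le P 1 ltr01.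
have int_n n : \int[leb]_(t in `[- n.+1%:R, n.+1%:R]) g' t = g n.+1%:R - g (- n.+1%:R).
  rewrite /Rintegral (@continuous_FTC2 _ _ g)//.
  - by rewrite -subr_gt0 opprK addr_gt0.
  - exact: continuous_subspaceT.
  - split.
    + by move=> x _; have [] := dg x.
    + exact/cvg_at_right_filter/cg.
    + exact/cvg_at_left_filter/cg.
  - by move=> x _; rewrite derive1E; have [_ ->] := dg x.
have sqn n : (- n.+1%:R) ^+ 2 = n.+1%:R ^+ 2 :> R by rewrite sqrrN.
have lim1 : (fun n => g n.+1%:R - g (- n.+1%:R)) @ \oo --> (0 : R).
  have lim0 : (fun n : nat => C * expR (- (1 / 2 * n.+1%:R ^+ 2)) +
      C * expR (- (1 / 2 * n.+1%:R ^+ 2)) : R) @ \oo --> (0 : R).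
    rewrite -[X in _ --> X](addr0 0).
    suff H : (fun n : nat => C * expR (- (1 / 2 * n.+1%:R ^+ 2)) : R) @ \oo --> (0:R).
      exact: cvgD.
    rewrite -[X in _ --> X](mulr0 C); apply: cvgM; first exact: cvg_cst.
    apply: (@squeeze_cvgr _ _ _ _ (cst 0) (fun n : nat => 2 * n.+1%:R^-1 : R)).
    - apply: nearW => n; rewrite expR_ge0/= expRN.
      rewrite -[2]invrK -invfM lef_pV2 ?posrE ?expR_gt0 ?mulr_gt0//.
      apply: (le_trans _ (expR_ge1Dx _)).
      have : 1 <= n.+1%:R :> R by rewrite ler1n.
      set m := n.+1%:R; move=> m1; rewrite mul1r.
      have : m <= m ^+ 2 by rewrite expr2 ler_peMl// (le_trans ler01).
      lra.
    - exact: cvg_cst.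
    - rewrite -[X in _ --> X](mulr0 2); apply: cvgM; first exact: cvg_cst.
      exact: cvg_harmonic.
  apply/norm_cvg0P.
  apply: (@squeeze_cvgr _ _ _ _ (cst 0) (fun n : nat => C * expR (- (1 / 2 * n.+1%:R ^+ 2)) +
    C * expR (- (1 / 2 * n.+1%:R ^+ 2)))); [|exact: cvg_cst|exact: lim0].
  apply: nearW => n; rewrite normr_ge0/=.
  apply: (le_trans (ler_normB _ _)); apply: lerD.
    by rewrite /g normrM (ger0_norm (expR_ge0 _)).
  by rewrite /g normrM (ger0_norm (expR_ge0 _)) (le_trans (HC _))// sqn.
pose f_ (n : nat) : R -> R := g' \_ `[- n.+1%:R, n.+1%:R].
have H1 n : measurable_fun setT (f_ n).
  apply/(measurable_restrictT _ _).1 => //.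
  by apply: measurable_funTS; exact: continuous_measurable_fun.
have H2 t : f_ ^~ t @ \oo --> g' t.
  apply: cvg_near_cst; near=> n.
  rewrite /f_ patchE mem_set//= in_itv/= -ler_norml.
  apply: (@le_trans _ _ n%:R); last by rewrite ler_nat.
  by near: n; exact: nbhs_infty_ger.
have H3 n t : `|f_ n t| <= `|g' t|.
  by rewrite /f_ patchE; case: ifP => // _; rewrite normr0.
have H4 : intg leb (fun t => `|g' t|) := integrable_norm (poly_gauss_intg Q ltr01).
have [_ lim2] := @dominated_Rint _ (measurableTypeR R) R leb f_ g' (fun t => `|g' t|) H1 H2 H3 H4.
apply: (cvg_unique _ lim2) => //.
rewrite (_ : (fun n => _) = (fun n => g n.+1%:R - g (- n.+1%:R)))//.
by apply/funext => n; rewrite -Rintegral_mkcond int_n.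
Unshelve. all: by end_near. Qed.

End gaussian_moments.

Section hermite_orthonormal.
Context {R : realType}.
Local Notation leb := (@lebesgue_measure R).

(** By [gauss_moment_deriv], passing from H_k to H_(k+1) is adjoint to
differentiation for the Gaussian weight. *)
Lemma gauss_moment_hermiteS k (Q : {poly R}) :
  gauss_moment (hermite_poly k.+1 * Q) = gauss_moment (hermite_poly k * Q^`()).
Proof.
rewrite (_ : hermite_poly k.+1 * Q = hermite_poly k * Q^`() -
    ((hermite_poly k * Q)^`() - 2%:P * 'X * (hermite_poly k * Q))).
  by rewrite gauss_momentB gauss_moment_deriv subr0.
by rewrite derivM /=; ring.
Qed.

Lemma gauss_moment1 : gauss_moment 1 = Num.sqrt pi :> R.
Proof.
rewrite /gauss_moment /Rintegral -[RHS]/(fine (Num.sqrt pi)%:E) -integralT_gauss.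
by congr fine; apply: eq_integral => t _; rewrite hornerC mul1r mul1r.
Qed.

Lemma gauss_moment_hermite k j : gauss_moment (hermite_poly k * hermite_poly j) =
  (k == j)%:R * (2 ^+ k * k`!%:R * Num.sqrt pi) :> R.
Proof.
elim: k j => [|k IH] [|j].
- by rewrite mulr1 gauss_moment1 eqxx expr0 fact0 !mul1r.
- by rewrite mulrC gauss_moment_hermiteS derivC mulr0 -[0](subrr 0) gauss_momentB subrr mul0r.
- by rewrite gauss_moment_hermiteS derivC mulr0 -[0](subrr 0) gauss_momentB subrr mul0r.
rewrite gauss_moment_hermiteS deriv_hermite_poly /= mulrCA gauss_momentZ IH eqSS.
have [->|kj] := eqVneq k j; last by rewrite !mul0r mulr0.
by rewrite !mul1r factS exprS !natrM; ring.
Qed.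

Lemma sq_intg_hermite k : sq_intg leb (hermite k).
Proof.
split; first exact: measurable_hermite.
have [C C0 HC] := @hermite_decay R k.
apply: (intg_le _ _ (intgZ (C ^+ 2) (@gauss_intg R 2^-1 _))) => //.
  by apply: measurable_funX; exact: measurable_hermite.
move=> t; rewrite normrX.
have -> : expR (- (2^-1 * t ^+ 2)) = expR (- (4^-1 * t ^+ 2)) ^+ 2.
  by rewrite -expRM_natr; congr expR; field.
rewrite -exprMn; apply: lerXn2r; rewrite ?nnegrE ?mulr_ge0 ?expR_ge0//.
Qed.

Lemma hermite_orthonormal j k : \int[leb]_t (hermite j t * hermite k t) = (j == k)%:R :> R.
Proof.
have sj := @hermite_scale_gt0 R j; have sk := @hermite_scale_gt0 R k.
transitivity (\int[leb]_t ((hermite_scale j * hermite_scale k)^-1 *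
   ((hermite_poly j * hermite_poly k).[t] * expR (- (1 * t ^+ 2)))) : R).
  apply: eq_Rintegral => t _; rewrite !hermiteE hornerM.
  have -> : expR (- (1 * t ^+ 2)) = expR (- (t ^+ 2 / 2)) * expR (- (t ^+ 2 / 2)).
    by rewrite -expRD; congr expR; field.
  by field; rewrite !gt_eqF.
rewrite (RintegralZl _ measurableT (poly_gauss_intg _ ltr01)).
rewrite -/(gauss_moment _) gauss_moment_hermite.
have [->|_] := eqVneq j k; last by rewrite mul0r mulr0.
rewrite mul1r -[X in _ * X](@sqr_sqrtr _ (2 ^+ k * k`!%:R * Num.sqrt pi)).
  by rewrite -/(hermite_scale k) expr2 mulVf// mulf_neq0// gt_eqF.
by rewrite !mulr_ge0// sqrtr_ge0.
Qed.

End hermite_orthonormal.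

(** * Borel sets and the completed Lebesgue measure *)

Section complete_versus_borel.
Context {R : realType} (d : nat).
Local Notation B := (measurableTypeR R).
Local Notation mu := (lebesgue_d R d).
Local Notation nu := (@borel_lebesgue R d).

(** The identity map, seen as a measurable map from the complete sigma-algebra to
the Borel one; the facts on products are proved for Borel functions and
pulled back along it. *)
Definition forget_complete (x : euclid R d) : d.-tuple B := x.

Lemma measurable_forget_complete : measurable_fun setT forget_complete.
Proof.
move=> _ Y mY; rewrite setTI.
by apply: sub_caratheodory; exact: sub_sigma_algebra.
Qed.

Lemma measurable_euclid (A : set (d.-tuple B)) :
  measurable A -> measurable (A : set (euclid R d)).
Proof. by move=> mA; rewrite -[A]setTI; exact: measurable_forget_complete. Qed.

Lemma lebesgue_d_borel (A : set (d.-tuple B)) : measurable A -> mu A = nu A.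
Proof. by move=> mA; exact: measurable_mu_extE. Qed.

Lemma integral_borel_ge0 (f : d.-tuple B -> \bar R) :
  measurable_fun setT f -> (forall x, (0 <= f x)%E) ->
  (\int[mu]_x f (forget_complete x) = \int[nu]_x f x)%E.
Proof.
move=> mf f0.
transitivity (\int[pushforward mu forget_complete]_x f x)%E.
  by rewrite (ge0_integral_pushforward measurable_forget_complete).
apply: eq_measure_integral => [|mphi A mA _]; first exact: measurable_forget_complete.
exact: (lebesgue_d_borel mA).
Qed.

Lemma intg_borel (f : d.-tuple B -> R) : intg nu f -> intg mu (f \o forget_complete).
Proof.
move=> /integrableP[mf fi]; apply/integrableP; split.
  by apply: (measurableT_comp mf); exact: measurable_forget_complete.
rewrite (integral_borel_ge0 (f := fun x => `|(f x)%:E|%E))//.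
exact: measurableT_comp.
Qed.

Lemma Rint_borel (f : d.-tuple B -> R) : intg nu f ->
  \int[mu]_x f (forget_complete x) = \int[nu]_x f x.
Proof.
move=> fi; rewrite /Rintegral; congr fine.
have mf := measurable_int _ fi.
transitivity (\int[pushforward mu forget_complete]_x (EFin \o f) x)%E.
  by rewrite (integral_pushforward measurable_forget_complete mf (intg_borel fi)).
apply: eq_measure_integral => [|mphi A mA _]; first exact: measurable_forget_complete.
exact: (lebesgue_d_borel mA).
Qed.

Lemma measurable_borel (f : d.-tuple B -> R) : measurable_fun setT f ->
  measurable_fun setT (f \o forget_complete).
Proof. by move=> mf; apply: (measurableT_comp mf); exact: measurable_forget_complete. Qed.

(** The outer measure is an infimum over countable Borel covers; intersecting
covers with excess 1/(n+1) attains it. *)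
Lemma borel_hull (A : set (euclid R d)) : measurable A -> (mu A < +oo)%E ->
  exists F : set (d.-tuple B), [/\ measurable F, A `<=` F & mu F = mu A].
Proof.
move=> mA Aoo.
have Afin : mu A \is a fin_num by rewrite ge0_fin_numE.
have cov n : exists G : set (d.-tuple B), [/\ measurable G, A `<=` G &
    (mu G <= mu A + n.+1%:R^-1%:E)%E].
  have := Afin; rewrite /lebesgue_d /completed_measure_extension /mu_ext.
  have n0 : 0 < n.+1%:R^-1 :> R by rewrite invr_gt0.
  move=> /(lb_ereal_inf_adherent n0)[_ [/= G [mG AG] <-] Glt]; exists (\bigcup_k G k); split => //.
    by apply: bigcupT_measurable.
  apply: (le_trans _ (ltW Glt)).
  apply: (le_trans (outer_measure_sigma_subadditive (nu^*)%mu G)).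
  apply: lee_nneseries => [k _ _|k _]; first exact: outer_measure_ge0.
  by rewrite le_eqVlt; apply/orP; left; apply/eqP; exact: measurable_mu_extE.
pose G n := projT1 (cid (cov n)).
have [mG AG Gle] : [/\ forall n, measurable (G n), forall n, A `<=` G n &
    forall n, (mu (G n) <= mu A + n.+1%:R^-1%:E)%E].
  by split => n; rewrite /G; case: cid => ? [].
exists (\bigcap_n G n); split.
- exact: bigcapT_measurable.
- exact: sub_bigcap.
- apply/eqP; rewrite eq_le; apply/andP; split; last first.
    by apply: (le_outer_measure (nu^*)%mu); exact: sub_bigcap.
  apply/lee_addgt0Pr => e e0; near \oo => n.
  apply: (@le_trans _ _ (mu (G n))).
    by apply: (le_outer_measure (nu^*)%mu); exact: bigcap_inf.
  rewrite (le_trans (Gle n))// leeD// lee_fin ltW//.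
  by near: n; exact: near_infty_natSinv_lt (PosNum e0).
Unshelve. all: by end_near. Qed.

End complete_versus_borel.

(** * Functions orthogonal to every Hermite function *)

Lemma expR_partial_sum {R : realType} (y : R) n :
  `|\sum_(0 <= j < n) exp_coeff y j.+1| <= expR `|y| - 1.
Proof.
apply: (le_trans (ler_norm_sum _ _ _)).
have E j : `|exp_coeff y j.+1| = exp_coeff `|y| j.+1.
  by rewrite /exp_coeff /= normrM normfV normrX normr_nat.
under eq_bigr do rewrite E.
rewrite lerBrDl -[1 in leLHS](_ : exp_coeff `|y| 0 = 1); last first.
  by rewrite /exp_coeff /= expr0 fact0 divr1.
rewrite -(@big_nat_recl _ _ _ n 0 (exp_coeff `|y|))// /expR.
apply: nondecreasing_cvgn_le; last exact: is_cvg_series_exp_coeff.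
apply: nondecreasing_series => i _ _; exact: exp_coeff_ge0.
Qed.

Section exponential_expansion.
Context d (T : measurableType d) (R : realType) (mu : {measure set T -> \bar R}).
Variables (G y : T -> R).
Hypotheses (mG : measurable_fun setT G) (my : measurable_fun setT y).

(** Term-by-term integration of the series of e^y - 1. It starts at j = 1, so only
the products of [G] with positive powers of [y] have to be integrable. *)
Lemma Rint_expB1_eq0 :
  (forall j, intg mu (fun x => G x * y x ^+ j.+1)) ->
  (forall j, \int[mu]_x (G x * y x ^+ j.+1) = 0) ->
  intg mu (fun x => `|G x| * (expR `|y x| - 1)) ->
  \int[mu]_x (G x * (expR (y x) - 1)) = 0.
Proof.
move=> ij j0 dom.
apply: (@Rint_eq0_limit _ _ _ mu
  (fun n x => \sum_(0 <= j < n) j.+1`!%:R^-1 * (G x * y x ^+ j.+1)) _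
  (fun x => `|G x| * (expR `|y x| - 1))) => //.
- move=> n; apply: measurable_sum => j; apply: measurable_funM => //.
  by apply: measurable_funM => //; exact: measurable_funX.
- move=> x.
  have -> : (fun n => \sum_(0 <= j < n) j.+1`!%:R^-1 * (G x * y x ^+ j.+1)) =
     (fun n => G x * (series (exp_coeff (y x)) n.+1 - 1)).
    have e0 : exp_coeff (y x) 0 = 1 by rewrite /exp_coeff /= expr0 fact0 divr1.
    apply/funext => n; rewrite /series/= big_nat_recl// e0.
    rewrite addrAC subrr add0r mulr_sumr; apply: eq_bigr => j _.
    by rewrite /exp_coeff/=; ring.
  apply: cvgM; first exact: cvg_cst.
  apply: cvgB; last exact: cvg_cst.
  have := @is_cvg_series_exp_coeff R (y x); rewrite -/(expR (y x)) => H.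
  by rewrite (cvg_shiftS (series (exp_coeff (y x)))).
- move=> n x.
  have -> : \sum_(0 <= j < n) j.+1`!%:R^-1 * (G x * y x ^+ j.+1) =
     G x * \sum_(0 <= j < n) exp_coeff (y x) j.+1.
    rewrite mulr_sumr; apply: eq_bigr => j _; rewrite /exp_coeff/=; ring.
  by rewrite normrM ler_wpM2l// expR_partial_sum.
- move=> n; rewrite Rint_sum; last by move=> j; exact: intgZ.
  by rewrite big1// => j _; rewrite (RintegralZl _ measurableT (ij j)) j0 mulr0.
Qed.

Lemma Rint_exp_eq0 :
  (forall j, intg mu (fun x => G x * y x ^+ j)) ->
  (forall j, \int[mu]_x (G x * y x ^+ j) = 0) ->
  intg mu (fun x => `|G x| * expR `|y x|) ->
  \int[mu]_x (G x * expR (y x)) = 0.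
Proof.
move=> ij j0 dom.
have iG : intg mu G.
  by have := ij 0; rewrite /intg; congr (integrable _ _ _); apply/funext => x /=; rewrite expr0 mulr1.
have G0 : \int[mu]_x G x = 0.
  by rewrite -(j0 0); apply: eq_Rintegral => x _; rewrite expr0 mulr1.
have dom1 : intg mu (fun x => `|G x| * (expR `|y x| - 1)).
  have := intgB dom (integrable_norm iG : intg mu (fun x => `|G x|)).
  by rewrite /intg; congr (integrable _ _ _); apply/funext => x /=; rewrite mulrBr mulr1.
have H := Rint_expB1_eq0 (fun j => ij j.+1) (fun j => j0 j.+1) dom1.
have i1 : intg mu (fun x => G x * (expR (y x) - 1)).
  apply: intg_le dom1.
    apply: measurable_funM => //; apply: measurable_funB => //.
    exact: measurableT_comp.
  move=> x; rewrite normrM ler_wpM2l// ler_norml.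
  have := ler_norm (y x); rewrite -ler_expR => h1.
  have h2 : 1 - expR (y x) <= expR `|y x| - 1.
    have := expR_ge1Dx (y x); have := expR_ge1Dx `|y x|.
    have := ler_norm (- y x); rewrite normrN; lra.
  by apply/andP; split; lra.
rewrite -(addr0 0) -[X in _ = X + _]H -G0 -(RintegralD measurableT i1 iG).
by apply: eq_Rintegral => x _; ring.
Qed.

End exponential_expansion.

Section gaussian_determinacy.
Context d (T : measurableType d) (R : realType) (mu : {measure set T -> \bar R}).
Variables (F t : T -> R).
Hypotheses (mF : measurable_fun setT F) (mt : measurable_fun setT t).
Hypothesis iF : forall l : R, 0 < l -> intg mu (fun x => F x * expR (- (l * t x ^+ 2))).
Hypothesis F0 : forall k, \int[mu]_x (F x * hermite k (t x)) = 0.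

Let f (l : R) (P : {poly R}) x := F x * (P.[t x] * expR (- (l * t x ^+ 2))).

Let mf l P : measurable_fun setT (f l P).
Proof.
apply: measurable_funM => //; apply: measurable_funM.
  by apply: (measurableT_comp (@measurable_horner R P)).
exact: (measurableT_comp (@measurable_gaussl R l)).
Qed.

Let f_intg l P : 0 < l -> intg mu (f l P).
Proof.
move=> l0; have [C C0 HC] := poly_gauss_le P l0.
have l2 : 0 < l / 2 by rewrite divr_gt0.
have dom : intg mu (fun x => C * (`|F x| * expR (- (l / 2 * t x ^+ 2)))).
  apply: intgZ; have := integrable_norm (iF l2).
  rewrite /intg; congr (integrable _ _ _); apply/funext => x /=.
  by rewrite normrM (ger0_norm (expR_ge0 _)).
apply: intg_le dom => // x.
rewrite /f normrM [leRHS]mulrCA ler_wpM2l// normrM (ger0_norm (expR_ge0 _)); exact: HC.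
Qed.

Let f_norm_intg l P : 0 < l -> intg mu (fun x => `|f l P x|).
Proof. by move=> l0; exact: integrable_norm (f_intg P l0). Qed.

Let JD l P Q : 0 < l -> \int[mu]_x f l (P + Q) x = \int[mu]_x f l P x + \int[mu]_x f l Q x.
Proof.
move=> l0; rewrite -(RintegralD measurableT (f_intg P l0) (f_intg Q l0)).
by apply: eq_Rintegral => x _; rewrite /f hornerD; ring.
Qed.

Let JZ l c P : 0 < l -> \int[mu]_x f l (c%:P * P) x = c * \int[mu]_x f l P x.
Proof.
move=> l0; rewrite -(RintegralZl c measurableT (f_intg P l0)).
by apply: eq_Rintegral => x _; rewrite /f hornerM hornerC; ring.
Qed.

(** Multiplication by X is removed with X H_k = (H_(k+1) + 2 k H_(k-1)) / 2. *)
Let J_hermite k j : \int[mu]_x f 2^-1 (hermite_poly k * 'X^j) x = 0.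
Proof.
have h0 : 0 < 2^-1 :> R by [].
elim: j k => [|j IH] k.
  transitivity (hermite_scale k * \int[mu]_x (F x * hermite k (t x))); last by rewrite F0 mulr0.
  have E : (fun x => F x * hermite k (t x)) = (fun x => (hermite_scale k)^-1 * f 2^-1 (hermite_poly k) x).
    apply/funext => x; rewrite /f hermiteE [t x ^+ 2 / 2]mulrC; ring.
  rewrite expr0 mulr1 E (RintegralZl _ measurableT (f_intg _ h0)) mulrA divff ?mul1r//.
  by rewrite gt_eqF// hermite_scale_gt0.
have E : hermite_poly k * 'X^(j.+1) = 2^-1%:P * (hermite_poly k.+1 * 'X^j +
    (2 * k)%:R%:P * (hermite_poly k.-1 * 'X^j)) :> {poly R}.
  rewrite mulrA -deriv_hermite_poly -mulrDl /= subrK exprS.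
  transitivity ((2^-1%:P * 2%:P) * (hermite_poly k * ('X * 'X^j)) : {poly R}); last by ring.
  by rewrite -polyCM mulVf// mul1r.
by rewrite E JZ// JD// JZ// !IH mulr0 addr0 mulr0.
Qed.

(** Raising the exponent by 1/4 multiplies the weight by exp(- t^2 / 4). The power
series of this factor may be integrated term by term because the exponent
reached so far, at least 1/2, exceeds 1/4. *)
Let J_quarter i k : \int[mu]_x f (2^-1 + i%:R / 4) 'X^k x = 0.
Proof.
elim: i k => [|i IH] k.
  by have := J_hermite 0 k; rewrite mul0r addr0 mul1r.
set l := 2^-1 + i%:R / 4 in IH.
have i0 : 0 <= i%:R / 4 :> R by rewrite divr_ge0.
have l0 : 0 < l by rewrite /l; lra.
have l4 : 0 < l - 4^-1 by rewrite /l; lra.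
have pw j x : f l 'X^k x * (- (4^-1 * t x ^+ 2)) ^+ j = (- 4^-1) ^+ j * f l 'X^(k + 2 * j) x.
  rewrite /f !hornerXn exprD exprM -[- (4^-1 * _)]mulNr exprMn; ring.
have my : measurable_fun setT (fun x => - (4^-1 * t x ^+ 2)).
  by apply: measurableT_comp => //; apply: measurable_funM => //; exact: measurable_funX.
rewrite -[RHS](@Rint_exp_eq0 _ _ _ mu (f l 'X^k) (fun x => - (4^-1 * t x ^+ 2)) (mf _ _) my).
- apply: eq_Rintegral => x _; rewrite /f -!mulrA -expRD; congr (_ * (_ * expR _)).
  by rewrite /l -[i.+1%:R]natr1; field.
- move=> j; under [X in intg _ X]funext do rewrite pw; exact/intgZ/f_intg.
- move=> j; under eq_Rintegral do rewrite pw.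
  by rewrite (RintegralZl _ measurableT (f_intg _ l0)) IH mulr0.
- rewrite (_ : (fun _ => _) = (fun x => `|f (l - 4^-1) 'X^k x|)); first exact: f_norm_intg.
  apply/funext => x; have y0 : 0 <= 4^-1 * t x ^+ 2 by apply: mulr_ge0 => //; exact: sqr_ge0.
  rewrite normrN (ger0_norm y0).
  rewrite /f !normrM !(ger0_norm (expR_ge0 _)) -!mulrA -expRD.
  by congr (_ * (_ * expR _)); ring.
Qed.

Let J_nat n k : (0 < n)%N -> \int[mu]_x f n%:R 'X^k x = 0.
Proof.
case: n => // n _; rewrite -(J_quarter (4 * n + 2) k); apply: eq_Rintegral => x _.
congr (f _ _ x); by rewrite -[n.+1%:R]natr1 natrD natrM; field.
Qed.

Let shifted_dom (c s : R) x : 1 <= c ->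
  expR (- (c * (t x - s) ^+ 2)) <= expR (s ^+ 2) * expR (- (2^-1 * t x ^+ 2)).
Proof.
move=> c1; rewrite -expRD ler_expR.
have h1 : (t x - s) ^+ 2 <= c * (t x - s) ^+ 2 by rewrite ler_peMl ?sqr_ge0.
have := shifted_sqr_ge (t x) s; lra.
Qed.

(** Expanding the square, the shift contributes the factor exp(2 n s t), whose
power series is integrated term by term against polynomial moments. *)
Lemma Rint_shifted_gauss (s : R) n : (0 < n)%N ->
  \int[mu]_x (F x * expR (- (n%:R * (t x - s) ^+ 2))) = 0.
Proof.
move=> n0; have nR : 0 < n%:R :> R by rewrite ltr0n.
have pw j x : f n%:R 1 x * (2 * n%:R * s * t x) ^+ j = (2 * n%:R * s) ^+ j * f n%:R 'X^j x.
  by rewrite /f hornerXn hornerC exprMn; ring.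
have Ef l x : `|f l 1 x| = `|F x| * expR (- (l * t x ^+ 2)).
  by rewrite /f hornerC mul1r normrM (ger0_norm (expR_ge0 _)).
have H : \int[mu]_x (f n%:R 1 x * expR (2 * n%:R * s * t x)) = 0.
  apply: Rint_exp_eq0 => //.
  - exact: measurable_funM.
  - move=> j; under [X in intg _ X]funext do rewrite pw; exact/intgZ/f_intg.
  - move=> j; under eq_Rintegral do rewrite pw.
    by rewrite (RintegralZl _ measurableT (f_intg _ nR)) J_nat// mulr0.
  - apply: (intg_le _ _ (intgZ (expR (2 * n%:R * s ^+ 2)) (@f_norm_intg (n%:R / 2) 1 _))).
    + apply: measurable_funM; first exact: measurableT_comp.
      by do 2 apply: measurableT_comp => //; exact: measurable_funM.
    + move=> x; rewrite ger0_norm ?mulr_ge0 ?expR_ge0// !Ef.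
      rewrite [leRHS]mulrCA -mulrA ler_wpM2l// -!expRD ler_expR !normrM.
      rewrite ![`|2|]ger0_norm// ![`|n%:R|]ger0_norm//.
      rewrite -(real_normK (num_real (t x))) -(real_normK (num_real s)).
      rewrite -subr_ge0 (_ : _ - _ = n%:R * ((`|t x| - 2 * `|s|) ^+ 2 / 2)); last by field.
      by apply: mulr_ge0 => //; apply: divr_ge0 => //; exact: sqr_ge0.
    + by rewrite divr_gt0.
rewrite -[RHS](mulr0 (expR (- (n%:R * s ^+ 2)))) -[X in _ = _ * X]H.
rewrite -RintegralZl//; last first.
  rewrite -/(intg mu (fun x => f n%:R 1 x * expR (2 * n%:R * s * t x))).
  apply: (intg_le _ _ (intgZ (expR (n%:R * s ^+ 2) * expR (s ^+ 2)) (@f_norm_intg 2^-1 1 _))) => //.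
    apply: measurable_funM => //; apply: measurableT_comp => //; exact: measurable_funM.
  move=> x; rewrite normrM !Ef (ger0_norm (expR_ge0 _)) -[leLHS]mulrA.
  rewrite [leRHS]mulrCA ler_wpM2l//.
  have -> : expR (- (n%:R * t x ^+ 2)) * expR (2 * n%:R * s * t x) =
      expR (n%:R * s ^+ 2) * expR (- (n%:R * (t x - s) ^+ 2)).
    by rewrite -!expRD; congr expR; ring.
  by rewrite -mulrA ler_wpM2l ?expR_ge0// shifted_dom// ler1n.
apply: eq_Rintegral => x _; rewrite /f hornerC mul1r.
transitivity (F x * (expR (- (n%:R * s ^+ 2)) * (expR (- (n%:R * t x ^+ 2)) *
   expR (2 * n%:R * s * t x)))); last by ring.
by rewrite -!expRD; congr (_ * expR _); ring.
Qed.

Let shifted_intg (s : R) n : (0 < n)%N -> intg mu (fun x => F x * expR (- (n%:R * (t x - s) ^+ 2))).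
Proof.
move=> n0.
apply: (intg_le _ _ (intgZ (expR (s ^+ 2)) (@f_norm_intg 2^-1 1 _))) => //.
  apply: measurable_funM => //; apply: (measurableT_comp (@measurable_gaussl R n%:R)).
  exact: measurable_funB.
move=> x; rewrite normrM (ger0_norm (expR_ge0 _)) /f hornerC mul1r normrM (ger0_norm (expR_ge0 _)).
by rewrite [leRHS]mulrCA ler_wpM2l// shifted_dom// ler1n.
Qed.

(** The coefficient and the exponent are chosen so that, as k grows, the bump tends
to 0 where (t - s)^2 > q and to - oo where (t - s)^2 <= q. *)
Let bump (s q : R) k (x : T) : R := - (k.+1%:R * expR (k.+1%:R * (q - (t x - s) ^+ 2))).

Let measurable_bump s q k : measurable_fun setT (bump s q k).
Proof.
apply: measurableT_comp => //; apply: measurable_funM => //.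
apply: measurableT_comp => //; apply: measurable_funM => //.
by apply: measurable_funB => //; apply: measurable_funX; exact: measurable_funB.
Qed.

Let bumpE s q k x : bump s q k x =
  - (k.+1%:R * expR (k.+1%:R * q)) * expR (- (k.+1%:R * (t x - s) ^+ 2)).
Proof. by rewrite mulNr -mulrA -expRD /bump; congr (- (_ * expR _)); ring. Qed.

Let bump_le0 s q k x : bump s q k x <= 0.
Proof. by rewrite /bump oppr_le0 mulr_ge0 ?expR_ge0. Qed.

Let Rint_bump s q k : \int[mu]_x (F x * (expR (bump s q k x) - 1)) = 0.
Proof.
set K := k.+1%:R * expR (k.+1%:R * q).
have K0 : 0 <= K by rewrite mulr_ge0 ?expR_ge0.
have pw j x : F x * bump s q k x ^+ j.+1 =
    (- K) ^+ j.+1 * (F x * expR (- ((k.+1 * j.+1)%:R * (t x - s) ^+ 2))).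
  rewrite bumpE -/K exprMn -expRM_natr mulrCA; congr (_ * (_ * expR _)).
  by rewrite natrM; ring.
apply: Rint_expB1_eq0 => //.
- by move=> j; under [X in intg _ X]funext do rewrite pw; exact/intgZ/shifted_intg.
- move=> j; under eq_Rintegral do rewrite pw.
  by rewrite (RintegralZl _ measurableT (shifted_intg s _)) ?Rint_shifted_gauss ?mulr0.
- apply: (intg_le _ _ (intgZ (K * expR (s ^+ 2) * expR K) (@f_norm_intg 2^-1 1 _))) => //.
    apply: measurable_funM; first exact: measurableT_comp.
    by apply: measurable_funB => //; do 2 apply: measurableT_comp => //.
  move=> x; have yK : `|bump s q k x| = K * expR (- (k.+1%:R * (t x - s) ^+ 2)).
    by rewrite bumpE -/K normrM normrN (ger0_norm K0) (ger0_norm (expR_ge0 _)).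
  have yle : `|bump s q k x| <= K.
    rewrite yK ler_piMr// -[leRHS]expR0 ler_expR oppr_le0.
    by apply: mulr_ge0 => //; exact: sqr_ge0.
  have e1 : 0 <= expR `|bump s q k x| - 1 by rewrite subr_ge0 -expR0 ler_expR.
  rewrite normrM normr_id (ger0_norm e1) /f hornerC mul1r normrM (ger0_norm (expR_ge0 _)).
  rewrite [leRHS]mulrCA ler_wpM2l//.
  apply: (@le_trans _ _ (`|bump s q k x| * expR `|bump s q k x|)).
    have := expR_ge1Dx (- `|bump s q k x|); rewrite expRN.
    rewrite -(ler_pM2r (expR_gt0 `|bump s q k x|)) mulVf ?gt_eqF ?expR_gt0//; lra.
  rewrite {1}yK [leRHS](_ : _ = (K * (expR (s ^+ 2) * expR (- (2^-1 * t x ^+ 2)))) * expR K); last by ring.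
  apply: ler_pM; rewrite ?expR_ge0 ?ler_expR//.
    by rewrite mulr_ge0 ?expR_ge0.
  by rewrite ler_wpM2l// shifted_dom// ler1n.
Qed.

(** exp(bump) - 1 tends to minus the indicator of (t - s)^2 <= q as k grows.
The powers of the bump are shifted Gaussians, so each of these functions
integrates to 0 against [F], and exp(1 + q) exp(- (t - s)^2) dominates them. *)
Lemma Rint_interval_eq0 (s q : R) :
  \int[mu]_x (F x * ((t x - s) ^+ 2 <= q)%R%:R) = 0.
Proof.
suff [iI I0] : intg mu (fun x => F x * - (((t x - s) ^+ 2 <= q)%R%:R)) /\
    (fun k => \int[mu]_x (F x * (expR (bump s q k x) - 1))) @ \oo -->
    \int[mu]_x (F x * - (((t x - s) ^+ 2 <= q)%R%:R)).
  transitivity (-1 * \int[mu]_x (F x * - (((t x - s) ^+ 2 <= q)%R%:R))).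
    rewrite -(RintegralZl (-1) measurableT iI).
    by apply: eq_Rintegral => x _; ring.
  move: I0; under eq_fun do rewrite Rint_bump.
  by move=> /cvg_lim <-//; rewrite lim_cst// mulr0.
apply: (@dominated_Rint _ _ _ mu (fun k x => F x * (expR (bump s q k x) - 1)) _
  (fun x => expR (1 + q) * `|F x * expR (- (1%:R * (t x - s) ^+ 2))|)).
- move=> k; apply: measurable_funM => //; apply: measurable_funB => //.
  exact: measurableT_comp.
- move=> x; apply: cvgM; first exact: cvg_cst.
  have [Dq|Dq] := leP ((t x - s) ^+ 2) q.
    rewrite -[X in _ --> X](add0r (-1)); apply: cvgB; last exact: cvg_cst.
    apply: (@squeeze_cvgr _ _ _ _ (cst 0) (fun n : nat => n.+1%:R^-1 : R)); last 2 first.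
    + exact: cvg_cst.
    + exact: cvg_harmonic.
    + apply: nearW => n; rewrite expR_ge0/= /bump expRN lef_pV2 ?posrE ?expR_gt0//.
      apply: (@le_trans _ _ (n.+1%:R * expR (n.+1%:R * (q - (t x - s) ^+ 2)))).
        by rewrite ler_peMr// -[leLHS]expR0 ler_expR mulr_ge0// subr_ge0.
      by apply: le_trans (expR_ge1Dx _); rewrite lerDr.
  rewrite mulr0n oppr0 -[X in _ --> X](subrr 1); apply: cvgB; last exact: cvg_cst.
  rewrite -[X in _ --> X]expR0; apply: continuous_cvg; first exact: continuous_expR.
  set D := (t x - s) ^+ 2 - q; have D0 : 0 < D by rewrite subr_gt0.
  rewrite -[X in _ --> X]oppr0; apply: cvgN.
  apply: (@squeeze_cvgr _ _ _ _ (cst 0) (fun n : nat => 2 / D ^+ 2 * n.+1%:R^-1 : R)); last 2 first.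
  + exact: cvg_cst.
  + rewrite -[X in _ --> X](mulr0 (2 / D ^+ 2)); apply: cvgM; first exact: cvg_cst.
    exact: cvg_harmonic.
  + apply: nearW => n; rewrite mulr_ge0 ?expR_ge0//=.
    have -> : n.+1%:R * (q - (t x - s) ^+ 2) = - (n.+1%:R * D) by rewrite /D; ring.
    rewrite expRN ler_pdivrMr ?expR_gt0//.
    have nD : 0 <= n.+1%:R * D by rewrite mulr_ge0// ltW.
    have := expR_ge1Dxn 1 nD; rewrite (_ : (2`!)%N = 2%N)// => H.
    apply: (@le_trans _ _ (2 / D ^+ 2 / n.+1%:R * ((n.+1%:R * D) ^+ 2 / 2))).
      have D1 : D != 0 by rewrite gt_eqF.
      have mE (m : R) : m != 0 -> 2 / D ^+ 2 / m * ((m * D) ^+ 2 / 2) = m.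
        by move=> m0; field; rewrite D1 m0.
      by rewrite mE.
    rewrite ler_wpM2l//; last by apply: le_trans H; rewrite lerDr.
    by rewrite !divr_ge0 ?sqr_ge0.
- move=> k x; rewrite normrM [in leRHS]normrM (ger0_norm (expR_ge0 _)) [leRHS]mulrCA ler_wpM2l//.
  rewrite mul1r; set D := (t x - s) ^+ 2 - q.
  have -> : expR (1 + q) * expR (- (t x - s) ^+ 2) = expR (1 - D).
    by rewrite -expRD /D; congr expR; ring.
  have yb := bump_le0 s q k x.
  rewrite distrC ger0_norm; last by rewrite subr_ge0 -expR0 ler_expR.
  have [D1|D1] := leP D 1.
    apply: (@le_trans _ _ 1); first by rewrite gerBl expR_ge0.
    by rewrite -[leLHS]expR0 ler_expR subr_ge0.
  apply: (@le_trans _ _ (- bump s q k x)).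
    by have := expR_ge1Dx (bump s q k x); lra.
  rewrite /bump opprK (_ : q - _ = - D); last by rewrite /D opprB.
  apply: (@le_trans _ _ (expR k%:R * expR (k.+1%:R * - D))).
    rewrite ler_wpM2r ?expR_ge0//; have := expR_ge1Dx (k%:R : R).
    by rewrite -natr1 addrC.
  rewrite -expRD ler_expR -natr1.
  have : k%:R * (D - 1) >= 0 by rewrite mulr_ge0// subr_ge0 ltW.
  by rewrite mulrBr mulr1; lra.
- by apply/intgZ/integrable_norm; exact: (@shifted_intg s 1).
Qed.

End gaussian_determinacy.

(** * Absolutely convergent series of square-integrable functions *)

Lemma cvgn_ge {R : realType} (u : nat -> R) (l a : R) :
  u @ \oo --> l -> (forall n, a <= u n) -> a <= l.
Proof.
move=> ul au; rewrite -(cvg_lim _ ul)//.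
by apply: limr_ge; [apply/cvg_ex; exists l|exact: nearW].
Qed.

Lemma cvgn_le {R : realType} (u : nat -> R) (l a : R) :
  u @ \oo --> l -> (forall n, u n <= a) -> l <= a.
Proof.
move=> ul au; rewrite -(cvg_lim _ ul)//.
by apply: limr_le; [apply/cvg_ex; exists l|exact: nearW].
Qed.

Section absolute_l2_series.
Context d (T : measurableType d) (R : realType) (mu : {measure set T -> \bar R}).

Lemma intg_ge0_ereal (f : T -> R) : measurable_fun setT f -> (forall x, 0 <= f x) ->
  (\int[mu]_x (f x)%:E < +oo)%E -> intg mu f.
Proof.
move=> mf f0 foo; apply/integrableP; split; first exact/measurable_EFinP.
by under eq_integral => x _ do rewrite /= ger0_norm//.
Qed.

Lemma Rint_ereal (f : T -> R) : intg mu f -> (\int[mu]_x (f x)%:E)%E = (\int[mu]_x f x)%:E.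
Proof. by move=> fi; rewrite /Rintegral fineK// (integrable_fin_num measurableT fi). Qed.

Lemma monotone_Rint (f_ : nat -> T -> R) (f : T -> R) (A : R) :
  (forall n, intg mu (f_ n)) -> (forall n x, 0 <= f_ n x) ->
  (forall n m, (n <= m)%N -> forall x, f_ n x <= f_ m x) ->
  (forall x, f_ ^~ x @ \oo --> f x) ->
  (forall n, \int[mu]_x f_ n x <= A) -> intg mu f /\ \int[mu]_x f x <= A.
Proof.
move=> if_ f0 fnd ff fA.
have mf_ n : measurable_fun setT (f_ n) := intg_measurable (if_ n).
have mf : measurable_fun setT f by exact: measurable_fun_cvg (fun x _ => ff x).
have fge x : 0 <= f x by apply: (cvgn_ge (ff x)).
have E : (\int[mu]_x (f x)%:E = limn (fun n => \int[mu]_x (f_ n x)%:E))%E.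
  rewrite -(@monotone_convergence _ _ _ mu setT measurableT (fun n x => (f_ n x)%:E)).
  - apply: eq_integral => x _; apply/esym/cvg_lim => //.
    by apply/fine_cvgP; split; [exact: nearW|exact: ff].
  - by move=> n; exact/measurable_EFinP.
  - by move=> n x _; rewrite lee_fin.
  - by move=> x _ n m nm; rewrite lee_fin fnd.
have le : (\int[mu]_x (f x)%:E <= A%:E)%E.
  rewrite E; apply: lime_le.
    apply: ereal_nondecreasing_is_cvgn => n m nm.
    apply: ge0_le_integral => //; try by move=> x _; rewrite lee_fin.
    - exact/measurable_EFinP.
    - exact/measurable_EFinP.
    - by move=> x _; rewrite lee_fin fnd.
  by apply: nearW => n; rewrite Rint_ereal// lee_fin.
have fi : intg mu f by apply: intg_ge0_ereal => //; exact: le_lt_trans le (ltry _).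
by split => //; rewrite -lee_fin -Rint_ereal.
Qed.

(** The Cauchy-Schwarz inequality for the weights |c k|, read off from
sum |c k| (|e k| - S/A)^2 >= 0. *)
Lemma weighted_cauchy (c e : nat -> R) (A : R) n : 0 < A -> abs_sum_le c A ->
  (\sum_(0 <= k < n) `|c k * e k|) ^+ 2 <= A * \sum_(0 <= k < n) `|c k| * e k ^+ 2.
Proof.
move=> A0 cA; set S := \sum_(0 <= k < n) `|c k * e k|; set W := \sum_(0 <= k < n) _.
have H : 0 <= \sum_(0 <= k < n) `|c k| * (`|e k| - S / A) ^+ 2.
  by apply: sumr_ge0 => k _; rewrite mulr_ge0 ?sqr_ge0.
have E (m : R) : \sum_(0 <= k < n) `|c k| * (`|e k| - m) ^+ 2 =
    W - 2 * m * S + m ^+ 2 * \sum_(0 <= k < n) `|c k|.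
  rewrite /W /S !mulr_sumr -sumrB -big_split/=; apply: eq_bigr => k _.
  rewrite normrM -[in RHS](real_normK (num_real (e k))); ring.
have C := cA n; rewrite E in H.
have : (S / A) ^+ 2 * \sum_(0 <= k < n) `|c k| <= (S / A) ^+ 2 * A by rewrite ler_wpM2l ?sqr_ge0.
have -> : (S / A) ^+ 2 * A = S ^+ 2 / A by field; rewrite gt_eqF.
move=> C'; rewrite mulrC -ler_pdivrMr//.
have : 2 * (S / A) * S = 2 * (S ^+ 2 / A) by ring.
lra.
Qed.

Variables (e : nat -> T -> R) (G : T -> R).
Hypothesis ie : forall n, sq_intg mu (e n).
Hypothesis e1 : forall n, \int[mu]_x (e n x ^+ 2) <= 1.
Hypothesis eG : forall n x, `|e n x| <= G x.
Variables (c : nat -> R) (A : R).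
Hypotheses (A0 : 0 < A) (cA : abs_sum_le c A).

Definition l2_series x := tsum (fun n => c n * e n x).

Let W_ n x := \sum_(0 <= k < n) `|c k| * e k x ^+ 2.
Let W x := tsum (fun k => `|c k| * e k x ^+ 2).

Let absW x : abs_sum_le (fun k => `|c k| * e k x ^+ 2) (`|G x ^+ 2| * A).
Proof.
apply: abs_sum_leW (abs_sum_leZ (G x ^+ 2) cA) => k.
rewrite [leLHS]normrM normr_id [leRHS]normrM mulrC ler_wpM2r//.
rewrite [leRHS]normrX [leLHS]normrX; apply: lerXn2r; rewrite ?nnegrE//.
exact: le_trans (eG k x) (ler_norm _).
Qed.

Lemma l2_series_abs x : abs_sum_le (fun n => c n * e n x) (`|G x| * A).
Proof.
apply: abs_sum_leW (abs_sum_leZ (G x) cA) => k.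
by rewrite !normrM mulrC ler_wpM2r// (le_trans (eG k x))// ler_norm.
Qed.

Let W_nd n m : (n <= m)%N -> forall x, W_ n x <= W_ m x.
Proof.
move=> nm x; rewrite /W_ (big_cat_nat (leq0n n) nm)/= lerDl sumr_ge0// => k _.
by rewrite mulr_ge0 ?sqr_ge0.
Qed.

Let W_int : intg mu W /\ \int[mu]_x W x <= A.
Proof.
have iW k : intg mu (fun x => `|c k| * e k x ^+ 2) by apply: intgZ; have [] := ie k.
apply: (@monotone_Rint W_ W A).
- by move=> n; exact: intg_sum.
- by move=> n x; apply: sumr_ge0 => k _; rewrite mulr_ge0 ?sqr_ge0.
- exact: W_nd.
- by move=> x; exact: abs_sum_cvg (absW x).
- move=> n; rewrite Rint_sum//; apply: le_trans (cA n); apply: ler_sum => k _.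
  have [_ ik] := ie k; rewrite (RintegralZl _ measurableT ik).
  by rewrite ler_piMr.
Qed.

Let W_le n x : W_ n x <= W x.
Proof.
apply: (@nondecreasing_cvgn_le _ (fun n => W_ n x)); last exact: abs_sum_cvg (absW x).
by move=> i j ij; exact: W_nd.
Qed.

Let partial_le n x : (\sum_(0 <= k < n) c k * e k x) ^+ 2 <= A * W x.
Proof.
apply: (@le_trans _ _ ((\sum_(0 <= k < n) `|c k * e k x|) ^+ 2)).
  rewrite -[leLHS]real_normK ?num_real//; apply: lerXn2r; rewrite ?nnegrE ?sumr_ge0//.
  exact: ler_norm_sum.
apply: (le_trans (weighted_cauchy _ _ A0 cA)).
by rewrite ler_wpM2l ?W_le// ltW.
Qed.

Let measurable_partial n : measurable_fun setT (fun x => \sum_(0 <= k < n) c k * e k x).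
Proof.
apply: measurable_sum => k; apply: measurable_funM => //.
by have [] := ie k.
Qed.

(** By [weighted_cauchy] the square of every partial sum is at most A times
W = sum |c n| e n ^ 2, and monotone convergence bounds the integral of W by A.
The bound by [G] gives convergence at every point. *)
Lemma l2_series_sq_intg : sq_intg mu l2_series /\ \int[mu]_x (l2_series x ^+ 2) <= A ^+ 2.
Proof.
have [iW WA] := W_int.
have cv x : (fun n => \sum_(0 <= k < n) c k * e k x) @ \oo --> l2_series x.
  exact: abs_sum_cvg (l2_series_abs x).
have mF : measurable_fun setT l2_series.
  exact: measurable_fun_cvg measurable_partial (fun x _ => cv x).
have le x : l2_series x ^+ 2 <= A * W x.
  have cv2 : (fun n => (\sum_(0 <= k < n) c k * e k x) ^+ 2) @ \oo --> l2_series x ^+ 2.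
    by under eq_fun do rewrite expr2; rewrite expr2; exact: cvgM.
  by apply: (cvgn_le cv2) => n; exact: partial_le.
have iF : intg mu (fun x => l2_series x ^+ 2).
  apply: (intg_le _ _ (intgZ A iW)); first exact: measurable_funX.
  by move=> x; rewrite ger0_norm ?sqr_ge0.
split => //; apply: (@le_trans _ _ (\int[mu]_x (A * W x))).
  by apply: le_Rintegral => //; exact: intgZ.
by rewrite (RintegralZl _ measurableT iW) expr2 ler_wpM2l// ltW.
Qed.

(** Dominated convergence, with the bound A W + g^2 on the partial sums. *)
Lemma l2_series_inner (g : T -> R) : sq_intg mu g ->
  (fun n => \sum_(0 <= k < n) c k * \int[mu]_x (e k x * g x)) @ \oo -->
  \int[mu]_x (l2_series x * g x).
Proof.
move=> sg; have [mg ig] := sg; have [iW WA] := W_int.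
have ieg k : intg mu (fun x => e k x * g x) by exact: sq_intgM.
have H1 n : measurable_fun setT (fun x => (\sum_(0 <= k < n) c k * e k x) * g x).
  exact: measurable_funM.
have H2 x : (fun n => (\sum_(0 <= k < n) c k * e k x) * g x) @ \oo --> l2_series x * g x.
  apply: cvgM; last exact: cvg_cst.
  exact: abs_sum_cvg (l2_series_abs x).
have H3 n x : `|(\sum_(0 <= k < n) c k * e k x) * g x| <= A * W x + g x ^+ 2.
  apply: (@le_trans _ _ ((\sum_(0 <= k < n) c k * e k x) ^+ 2 + g x ^+ 2)); last first.
    by rewrite lerD2r.
  exact: normM_le_sqrD.
have [_ H] := dominated_Rint H1 H2 H3 (intgD (intgZ A iW) ig).
rewrite (_ : (fun n => \sum_(0 <= k < n) _) =
  (fun n => \int[mu]_x ((\sum_(0 <= k < n) c k * e k x) * g x)))//.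
apply/funext => n.
transitivity (\int[mu]_x (\sum_(0 <= k < n) c k * (e k x * g x))); last first.
  by apply: eq_Rintegral => x _; rewrite mulr_suml; apply: eq_bigr => k _; rewrite mulrA.
rewrite Rint_sum; last by move=> k; exact: intgZ.
by apply: eq_bigr => k _; rewrite (RintegralZl _ measurableT (ieg k)).
Qed.

End absolute_l2_series.

(** * Completeness of the Hermite system *)

Section tensor_on_euclid.
Context {R : realType} (d : nat).
Local Notation B := (measurableTypeR R).
Local Notation leb := (@lebesgue_measure R).
Local Notation mu := (lebesgue_d R d).
Local Notation E := (euclid R d).

Lemma measurable_coordinate (i : 'I_d) : measurable_fun setT (fun x : E => coordinate x i).
Proof.
apply: (@measurable_borel R d (fun x => tnth x i)).
exact: measurable_tnth.
Qed.

Lemma sq_intg_tensor (h : 'I_d -> B -> R) : (forall i, sq_intg leb (h i)) ->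
  sq_intg mu (fun x : E => \prod_(i < d) h i (coordinate x i)).
Proof.
move=> ih; split.
  apply: measurable_prod => i _; have [mh _] := ih i.
  exact: (measurableT_comp mh (measurable_coordinate i)).
have [H _] := @integrable_prod R d (fun i t => h i t ^+ 2) (fun i => (ih i).2).
have := intg_borel H; rewrite /intg; congr (integrable _ _ _).
by apply/funext => x /=; rewrite -prodrXl.
Qed.

Lemma intg_tensor (u : 'I_d -> B -> R) : (forall i, intg leb (u i)) ->
  \int[mu]_x (\prod_(i < d) u i (coordinate x i)) = \prod_(i < d) \int[leb]_t u i t.
Proof.
move=> iu; have [H1 H2] := @integrable_prod R d u iu.
transitivity (\int[borel_lebesgue d]_x (\prod_(i < d) u i (tnth x i))).
  exact: (Rint_borel H1).
by rewrite /Rintegral H2.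
Qed.

Lemma sq_intg_hermite_d (a : d.-tuple nat) : sq_intg mu (hermite_d a : E -> R).
Proof. exact: (@sq_intg_tensor (fun i => hermite (tnth a i)) (fun i => sq_intg_hermite _)). Qed.

Lemma hermite_d_orthonormal (a b : d.-tuple nat) :
  \int[mu]_x (hermite_d a x * hermite_d b x) = (a == b)%:R.
Proof.
transitivity (\int[mu]_x (\prod_(i < d) (hermite (tnth a i) (coordinate x i) *
    hermite (tnth b i) (coordinate x i)))).
  by apply: eq_Rintegral => x _; rewrite big_split.
rewrite (@intg_tensor (fun i t => hermite (tnth a i) t * hermite (tnth b i) t)); last first.
  by move=> i; apply: sq_intgM; exact: sq_intg_hermite.
under eq_bigr do rewrite hermite_orthonormal.
have [->|ab] := eqVneq a b; first by rewrite big1// => i _; rewrite eqxx.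
have [i /eqP abi] : exists i, tnth a i <> tnth b i.
  by apply/existsNP => H; move/eqP: ab; apply; exact: eq_from_tnth.
by rewrite (bigD1 i)//= (negbTE abi) mul0r.
Qed.

(** An interval in the form in which [Rint_interval_eq0] tests functions. *)
Definition window (s q : R) (r : R) : R := ((r - s) ^+ 2 <= q)%R%:R.

Lemma windowE s q : window s q = \1_[set r | (r - s) ^+ 2 <= q].
Proof. by apply/funext => r; rewrite indicE /window; congr (nat_of_bool _)%:R; apply/idP/idP; rewrite inE. Qed.

Lemma measurable_window_set s q : measurable [set r : B | (r - s) ^+ 2 <= q].
Proof.
have mf : measurable_fun setT (fun r : B => (r - s) ^+ 2).
  by apply: measurable_funX; exact: measurable_funB.
have := mf measurableT `]-oo, q]%classic (measurable_itv _); rewrite setTI.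
by congr measurable; apply/seteqP; split => r /=; rewrite in_itv.
Qed.

Lemma sq_intg_window s q : sq_intg leb (window s q).
Proof.
have mw : measurable_fun setT (window s q : B -> R).
  by rewrite windowE; apply: measurable_indic; exact: measurable_window_set.
split => //.
have h0 : 0 < 2^-1 :> R by [].
apply: (intg_le _ _ (intgZ (expR (q + s ^+ 2)) (@gauss_intg R 2^-1 h0))); first exact: measurable_funX.
move=> r; rewrite normrX /window; have [rq|_] := leP ((r - s) ^+ 2) q.
  rewrite normr1 expr1n -expRD -[leLHS]expR0 ler_expR.
  have := shifted_sqr_ge r s; lra.
by rewrite normr0 expr0n/= mulr_ge0 ?expR_ge0.
Qed.

Variable f : E -> R.
Hypothesis if_ : sq_intg mu f.
Hypothesis f_orth : forall a, \int[mu]_x (f x * hermite_d a x) = 0.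

(** The Hermite functions of the first m coordinates are replaced by windows, one
coordinate at a time: the rest of the product is absorbed into the function,
and [Rint_interval_eq0] is applied to the remaining coordinate. *)
Lemma windows_orth (s q : 'I_d -> R) :
  \int[mu]_x (f x * \prod_(i < d) window (s i) (q i) (coordinate x i)) = 0.
Proof.
pose h m (a : d.-tuple nat) (i : 'I_d) : R -> R :=
  if (i < m)%N then window (s i) (q i) else hermite (tnth a i).
have ih m a i : sq_intg leb (h m a i).
  by rewrite /h; case: ifP => _; [exact: sq_intg_window|exact: sq_intg_hermite].
suff H m a : (m <= d)%N -> \int[mu]_x (f x * \prod_(i < d) h m a i (coordinate x i)) = 0.
  rewrite -(H d [tuple of nseq d 0%N] (leqnn d)); apply: eq_Rintegral => x _.
  by congr (_ * _); apply: eq_bigr => i _; rewrite /h ltn_ord.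
elim: m a => [|m IH] a.
  by move=> _; rewrite -(f_orth a); apply: eq_Rintegral => x _; rewrite /h /=.
move=> md; pose i0 : 'I_d := Ordinal md.
pose g x := f x * \prod_(i < d | i != i0) h m.+1 a i (coordinate x i).
have mg : measurable_fun setT g.
  apply: measurable_funM; first by have [] := if_.
  under eq_fun do rewrite big_mkcond.
  apply: measurable_prod => i _; case: (i != i0); last exact: measurable_cst.
  have [mh _] := ih m.+1 a i.
  exact: (measurableT_comp mh (measurable_coordinate i)).
rewrite -(@Rint_interval_eq0 _ E R mu g (fun x => coordinate x i0) mg
  (measurable_coordinate i0) _ _ (s i0) (q i0)).
- apply: eq_Rintegral => x _; rewrite (bigD1 i0)//= {1}/h ltnS leqnn /g.
  by rewrite mulrCA mulrC.
- move=> l l0.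
  pose h' (i : 'I_d) : B -> R := if i == i0 then (fun r => expR (- (l * r ^+ 2))) else h m.+1 a i.
  have ih' i : sq_intg leb (h' i).
    rewrite /h'; case: ifP => _; last exact: ih.
    split; first exact: measurable_gaussl.
    have l2 : 0 < 2 * l by rewrite mulr_gt0.
    have := gauss_intg l2; rewrite /intg; congr (integrable _ _ _); apply/funext => r /=.
    by rewrite -expRM_natr; congr (expR _)%:E; ring.
  have := sq_intgM if_ (sq_intg_tensor ih').
  rewrite /intg; congr (integrable _ _ _); apply/funext => x /=; congr EFin.
  rewrite (bigD1 i0)//= {1}/h' eqxx /g [LHS]mulrCA [LHS]mulrC; congr (_ * _ * _).
  by apply: eq_bigr => i ii0; rewrite /h' (negbTE ii0).
- move=> k; pose b := [tuple (if i == i0 then k else tnth a i) | i < d].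
  rewrite -(IH b (ltnW md)); apply: eq_Rintegral => x _.
  rewrite (bigD1 i0)//= {1}/h ltnn tnth_mktuple eqxx /g [RHS]mulrCA [RHS]mulrC; congr (_ * _ * _).
  apply: eq_bigr => i ii0; rewrite /h tnth_mktuple (negbTE ii0) ltnS leq_eqVlt.
  by have -> : (i == m :> nat) = false by apply: contraNF ii0 => /eqP im; apply/eqP/val_inj.
Qed.

End tensor_on_euclid.

Section boxes.
Context {R : realType} (d : nat).
Local Notation B := (measurableTypeR R).
Implicit Types a b : 'I_d -> R.

Definition box a b : set (d.-tuple B) := [set x | forall i, a i <= tnth x i <= b i].

Definition cube (N : nat) := box (fun=> - N%:R) (fun=> N%:R).

Definition boxes : set (set (d.-tuple B)) := [set A | exists a b, A = box a b].

Lemma boxes_setI : setI_closed boxes.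
Proof.
move=> _ _ [a1 [b1 ->]] [a2 [b2 ->]].
exists (fun i => Num.max (a1 i) (a2 i)), (fun i => Num.min (b1 i) (b2 i)).
apply/seteqP; split => x /=.
  move=> [H1 H2] i; have /andP[h1 h2] := H1 i; have /andP[h3 h4] := H2 i.
  by rewrite ge_max le_min h1 h2 h3 h4.
by move=> H; split => i; have := H i; rewrite ge_max le_min;
  case/andP => /andP[p1 p2] /andP[p3 p4]; rewrite ?p1 ?p2 ?p3 ?p4.
Qed.

Lemma bounded_coordinates (x : d.-tuple B) : exists N : nat, forall i, `|tnth x i : R| <= N%:R.
Proof.
exists (\max_(i < d) Num.Def.archi_bound `|tnth x i : R|)%N => i.
apply: (le_trans (ltW (archi_boundP (normr_ge0 _)))).
by rewrite ler_nat (leq_bigmax i).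
Qed.

Lemma cube_cover (x : d.-tuple B) : exists N, cube N x.
Proof.
have [N HN] := bounded_coordinates x; exists N => i.
by rewrite -ler_norml.
Qed.

Lemma measurable_box a b : measurable (box a b).
Proof.
rewrite (_ : box a b = \bigcap_(i in [set: 'I_d]) ((fun x : d.-tuple B => tnth x i) @^-1` `[a i, b i])).
  apply: fin_bigcap_measurable => // i _.
  rewrite -[X in measurable X]setTI; exact: (measurable_tnth i measurableT (measurable_itv _)).
apply/seteqP; split => x /= H i; first by move=> _; rewrite /= in_itv/=; exact: H.
by have := H i I; rewrite /= in_itv.
Qed.

(** Half-spaces orthogonal to the axes are countable unions of boxes. *)
Lemma measurable_boxesE (A : set (d.-tuple B)) : measurable A -> <<s boxes >> A.
Proof.
move=> mA.
pose T' := g_sigma_algebraType boxes.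
suff mid : measurable_fun [set: T'] (id : T' -> d.-tuple B).
  by have := mid measurableT A mA; rewrite setTI.
apply/measurable_fun_tnthP => i.
apply: (measurability _ (RGenCInfty.measurableE R)) => _ [_ [c ->] <-].
rewrite setTI.
rewrite (_ : _ @^-1` _ = \bigcup_N box (fun j => if j == i then c else - N%:R) (fun=> N%:R)).
  apply: bigcup_measurable => N _; apply: sub_sigma_algebra.
  by exists (fun j => if j == i then c else - N%:R), (fun=> N%:R).
apply/seteqP; split => x /=.
  rewrite in_itv/= andbT => cx.
  have [N HN] := bounded_coordinates x; exists N => // j.
  have := HN j; rewrite ler_norml => /andP[h1 ->]; rewrite andbT.
  by case: eqVneq => // ->.
by move=> [N _ /(_ i)]; rewrite eqxx in_itv/= andbT => /andP[].
Qed.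

End boxes.

Section completeness.
Context {R : realType} (d : nat).
Local Notation B := (measurableTypeR R).
Local Notation leb := (@lebesgue_measure R).
Local Notation mu := (lebesgue_d R d).
Local Notation E := (euclid R d).

Lemma interval_window (a b : R) : exists s q, forall r, window s q r = (a <= r <= b)%R%:R.
Proof.
have [ab|ba] := leP a b.
  exists ((a + b) / 2), (((b - a) / 2) ^+ 2) => r; rewrite /window; congr (nat_of_bool _)%:R.
  rewrite -[leLHS]real_normK ?num_real// ler_pXn2r// ?nnegrE ?divr_ge0 ?subr_ge0//.
  by rewrite ler_norml; apply/andP/andP => -[h1 h2]; split; lra.
(* An empty interval is a window of negative radius. *)
exists 0, (-1) => r; rewrite /window; congr (nat_of_bool _)%:R.
have -> : ((r - 0) ^+ 2 <= -1) = false.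
  by apply/negbTE; rewrite -ltNge (lt_le_trans _ (sqr_ge0 _))// ltrN10.
by apply/esym/negbTE/negP => /andP[h1 h2]; have := le_lt_trans (le_trans h1 h2) ba; rewrite ltxx.
Qed.

Lemma box_windows (a b : 'I_d -> R) : exists s q : 'I_d -> R, forall x : E,
  \1_(box a b) x = \prod_(i < d) window (s i) (q i) (coordinate x i).
Proof.
pose s i := projT1 (cid (interval_window (a i) (b i))).
pose q i := projT1 (cid (projT2 (cid (interval_window (a i) (b i))))).
have sq i r : window (s i) (q i) r = (a i <= r <= b i)%R%:R.
  by rewrite /s /q; case: cid => s' H /=; case: cid.
exists s, q => x; rewrite indicE.
under eq_bigr do rewrite sq.
have [xin|xout] := boolP (x \in box a b).
  rewrite big1// => i _; move/set_mem: xin => /(_ i) xi.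
  by rewrite /coordinate xi.
have [i Hi] : exists i, ~ (a i <= tnth x i <= b i).
  by apply/existsNP => H; move/negP: xout; apply; apply/mem_set.
by rewrite (bigD1 i)//= /coordinate; move/negP/negbTE: Hi => ->; rewrite mul0r.
Qed.

Lemma sq_intg_box (a b : 'I_d -> R) : sq_intg mu (\1_(box a b) : E -> R).
Proof.
have [s [q H]] := box_windows a b.
have := @sq_intg_tensor R d (fun i => window (s i) (q i)) (fun i => sq_intg_window _ _).
by congr sq_intg; apply/funext => x; rewrite H.
Qed.

Variable f : E -> R.
Hypothesis if_ : sq_intg mu f.
Hypothesis f_orth : forall a, \int[mu]_x (f x * hermite_d a x) = 0.

Let box_orth (a b : 'I_d -> R) : \int[mu]_x (f x * \1_(box a b) x) = 0.
Proof.
have [s [q H]] := box_windows a b.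
by rewrite -(windows_orth if_ f_orth s q); apply: eq_Rintegral => x _; rewrite H.
Qed.

Let fK N x := f x * \1_(@cube R d N) x.

Let fK_intg N : intg mu (fK N).
Proof. by apply: sq_intgM => //; exact: sq_intg_box. Qed.

Let fKA_intg N (A : set E) : measurable A -> intg mu (fun x => fK N x * \1_A x).
Proof.
move=> mA; apply: (intg_le _ _ (integrable_norm (fK_intg N))).
  apply: measurable_funM; first exact: intg_measurable (fK_intg N).
  exact: measurable_indic.
move=> x /=; rewrite normrM ler_piMr// indicE; by case: (_ \in _); rewrite ?normr1 ?normr0.
Qed.

(** The boxes form a pi-system. Cutting [f] by a cube makes it integrable, so that
the sets satisfying the equation form a lambda-system. *)
Lemma orth_borel N (A : set (d.-tuple B)) : measurable A -> \int[mu]_x (fK N x * \1_A x) = 0.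
Proof.
move=> mA.
pose H : set (set (d.-tuple B)) := [set A | measurable A /\ \int[mu]_x (fK N x * \1_A x) = 0].
suff : <<s @boxes R d >> `<=` H by move=> /(_ A (measurable_boxesE mA))[].
apply: (lambda_system_subset (@boxes_setI R d)) => //.
  split.
  - by [].
  - split; first exact: measurableT.
    rewrite -[RHS](box_orth (fun=> - N%:R) (fun=> N%:R)); apply: eq_Rintegral => x _.
    by rewrite indicT mulr1.
  - move=> A1 A2 A21 [m1 i1] [m2 i2]; split; first exact: measurableD.
    rewrite -[RHS](subrr 0) -{1}i1 -i2.
    rewrite -(RintegralB measurableT (fKA_intg N m1) (fKA_intg N m2)).
    apply: eq_Rintegral => x _; rewrite -mulrBr; congr (_ * _).
    rewrite !indicE in_setD; have [x2|x2] := boolP (x \in A2).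
      have -> : x \in A1 by apply/mem_set/A21/set_mem.
      by rewrite subrr.
    by rewrite andbT subr0.
  - move=> F ndF HF; split; first by apply: bigcupT_measurable => i; have [] := HF i.
    apply: (@Rint_eq0_limit _ _ _ mu (fun n x => fK N x * \1_(F n) x) _ (fun x => `|fK N x|)).
    + move=> n; exact: intg_measurable (fKA_intg N (HF n).1).
    + move=> x; apply: cvgM; first exact: cvg_cst.
      apply: cvg_near_cst.
      have [[n _ Fnx]|nF] := pselect ((\bigcup_i F i) x).
        exists n => // m nm; rewrite !indicE !mem_set//; first by exists n.
        by have /subsetPset := ndF n m nm; exact.
      apply: nearW => m; rewrite !indicE !memNset// => Fm; apply: nF; by exists m.
    + move=> n x; rewrite normrM ler_piMr// indicE; by case: (_ \in _); rewrite ?normr1 ?normr0.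
    + exact: integrable_norm (fK_intg N).
    + by move=> n; have [] := HF n.
move=> _ [a [b ->]]; split; first exact: measurable_euclid (measurable_box a b).
have [a' [b' Eab]] := boxes_setI (ex_intro _ (fun=> - N%:R) (ex_intro _ (fun=> N%:R) erefl))
   (ex_intro _ a (ex_intro _ b erefl)) : boxes (@cube R d N `&` box a b).
rewrite -[RHS](box_orth a' b'); apply: eq_Rintegral => x _.
by rewrite -Eab indicI /fK mulrA.
Qed.

Lemma cube_measure N : (mu (@cube R d N : set E) < +oo)%E.
Proof.
have [_ /integrableP[_ H]] := sq_intg_box (fun=> - N%:R) (fun=> N%:R).
have mK : measurable (@cube R d N : set E) by apply: measurable_euclid; exact: measurable_box.
have <- : (\int[mu]_x (\1_(@cube R d N : set E) x)%:E = mu (@cube R d N))%E.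
  by rewrite integral_indic// setIT.
apply: le_lt_trans H; rewrite le_eqVlt; apply/orP; left; apply/eqP.
apply: eq_integral => x _ /=; rewrite indicE.
by case: (_ \in _); rewrite ?expr1n ?expr0n/= ?normr1 ?normr0.
Qed.

(** In a cube, the set where [f] is positive has a Borel hull that exceeds it by a
null set only; the integral of [f] over the hull is 0. *)
Lemma orth_nonpos : mu [set x | 0 < f x] = 0%E.
Proof.
have [mf _] := if_.
have mpos : measurable [set x | 0 < f x].
  have := mf measurableT `]0, +oo[%classic (measurable_itv _); rewrite setTI.
  by congr measurable; apply/seteqP; split => x /=; rewrite in_itv/= andbT.
have mK N : measurable (@cube R d N : set E) by apply: measurable_euclid; exact: measurable_box.
suff H N : mu ([set x | 0 < f x] `&` @cube R d N) = 0%E.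
  apply: measure_negligible => //.
  have -> : [set x | 0 < f x] = \bigcup_N ([set x | 0 < f x] `&` @cube R d N).
    rewrite -setI_bigcupr; apply/esym/setIidPl => x _.
    by have [N KN] := cube_cover x; exists N.
  apply: negligible_bigcup => N; exists ([set x | 0 < f x] `&` @cube R d N).
  by split; [exact: (measurableI _ _ mpos (mK N))|exact: H|].
set S := _ `&` _; have mS : measurable S by exact: (measurableI _ _ mpos (mK N)).
have Soo : (mu S < +oo)%E.
  apply: le_lt_trans (cube_measure N); apply: le_measure; rewrite ?inE//; exact: subIsetr.
have [F [mF SF muF]] := borel_hull mS Soo.
have mFE : measurable (F : set E) by exact: measurable_euclid.
have FS0 : mu (F `\` S) = 0%E.
  have Foo : (mu F < +oo)%E by rewrite muF.
  have sub0 (u v : \bar R) : u = v -> v \is a fin_num -> (u - v = 0)%E by move=> -> /subee.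
  by rewrite (measureD mFE mS Foo) setIidr//; apply: sub0; [exact: muF|rewrite ge0_fin_numE].
have iFS : (\int[mu]_x `|fK N x * \1_S x|%:E = 0)%E.
  have fS x : `|fK N x * \1_S x| = fK N x * \1_S x.
    rewrite ger0_norm// /fK !indicE; have [|_] := boolP (x \in S); last by rewrite mulr0.
    by rewrite inE => -[/= fx _]; rewrite mulr1 mulr_ge0// ltW.
  under eq_integral do rewrite fS.
  rewrite (Rint_ereal (fKA_intg N mS)); suff -> : \int[mu]_x (fK N x * \1_S x) = 0 by [].
  rewrite -[RHS](orth_borel N mF).
  apply: (@ae_eq_Rint _ E R mu (fun x => fK N x * \1_S x) (fun x => fK N x * \1_F x)).
  - exact: intg_measurable (fKA_intg N mS).
  - exact: intg_measurable (fKA_intg N mFE).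
  - exists (F `\` S); split => //; first exact: measurableD.
    move=> x /= nx; apply: contrapT => nFS; apply: nx; congr (_ * _).
    rewrite !indicE; have [xS|xS] := boolP (x \in S).
      by rewrite mem_set//; apply: SF; exact: set_mem.
    rewrite memNset// => Fx; apply: nFS; split => // Sx; move/negP: xS; apply; exact: mem_set.
have := (ae_eq_integral_abs mu measurableT (f := fun x => (fK N x * \1_S x)%:E) _).1.
move=> /(_ _ iFS)[|M [mM M0 HM]].
  by apply/measurable_EFinP; exact: intg_measurable (fKA_intg N mS).
apply/eqP; rewrite -measure_le0 -M0; apply: le_measure; rewrite ?inE//.
move=> x Sx; apply: HM => /= H; have [] := Sx => /= fx Kx.
have := H Logic.I; rewrite /fK !indicE !mem_set// !mulr1 => -[] fx0.
by rewrite fx0 ltxx in fx.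
Qed.

End completeness.

(** * Hermite expansions with summable coefficients *)

Section hermite_completeness.
Context {R : realType} (d : nat).
Local Notation mu := (lebesgue_d R d).
Local Notation E := (euclid R d).

Lemma hermite_complete (f : E -> R) : sq_intg mu f ->
  (forall a, \int[mu]_x (f x * hermite_d a x) = 0) -> {ae mu, forall x, f x = 0}.
Proof.
move=> sf f0; have [mf _] := sf.
have sN : sq_intg mu (fun x => - f x).
  by apply: sq_intg_le sf => [|x]; [exact: measurableT_comp|rewrite normrN].
have N0 a : \int[mu]_x (- f x * hermite_d a x) = 0.
  rewrite -[RHS](mulr0 (-1)) -(f0 a) -(RintegralZl (-1) measurableT (sq_intgM sf (sq_intg_hermite_d a))).
  by apply: eq_Rintegral => x _; rewrite mulN1r mulNr.
have mpos (g : E -> R) : measurable_fun setT g -> measurable [set x | 0 < g x].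
  move=> mg; have := mg measurableT `]0, +oo[%classic (measurable_itv _); rewrite setTI.
  by congr measurable; apply/seteqP; split => x /=; rewrite in_itv/= andbT.
exists ([set x | 0 < f x] `|` [set x | 0 < - f x]); split.
- exact: measurableU (mpos _ mf) (mpos _ sN.1).
- by apply: null_set_setU; [exact: mpos mf|exact: mpos sN.1|exact: orth_nonpos sf f0|exact: orth_nonpos sN N0].
- move=> x /= fx; have [//|//|h] := ltgtP 0 (f x); [by left|right; by rewrite oppr_gt0|].
  by case: fx.
Qed.

End hermite_completeness.

Lemma sqrB_le {R : realType} (u v : R) : (u - v) ^+ 2 <= 2 * u ^+ 2 + 2 * v ^+ 2.
Proof. by rewrite -subr_ge0 (_ : _ - _ = (u + v) ^+ 2) ?sqr_ge0//; ring. Qed.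

Section enumeration.
Context {R : realType} (d : nat).
Local Notation B := (measurableTypeR R).
Local Notation mu := (lebesgue_d R d).
Local Notation E := (euclid R d).

Definition index_of (n : nat) : d.-tuple nat :=
  odflt [tuple of nseq d 0%N] (pickle_inv n).

(** [pickle] may skip integers: on these [index_of] has a default value, and
[enum_coef] is 0 there so that no multi-index is counted twice. *)
Definition enum_coef (c : d.-tuple nat -> R) (n : nat) : R :=
  if @pickle_inv (d.-tuple nat) n is Some a then c a else 0.

Lemma index_ofK (a : d.-tuple nat) : index_of (pickle a) = a.
Proof. by rewrite /index_of pickleK_inv. Qed.

Lemma enum_coef_pickle c (a : d.-tuple nat) : enum_coef c (pickle a) = c a.
Proof. by rewrite /enum_coef pickleK_inv. Qed.

Lemma enum_coefP c n : enum_coef c n = 0 \/ (enum_coef c n = c (index_of n) /\ n = pickle (index_of n)).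
Proof.
rewrite /enum_coef /index_of; case E : (pickle_inv n) => [a|]; last by left.
by right; split => //=; have := @pickle_invK (d.-tuple nat) n; rewrite /ocancel E /= => ->.
Qed.

Definition inv_sqr (k : nat) : R := (k.+1%:R ^+ 2)^-1.

Lemma inv_sqr_sum n : \sum_(0 <= k < n) inv_sqr k <= 2.
Proof.
suff H : \sum_(0 <= k < n.+1) inv_sqr k <= 2 - n.+1%:R^-1.
  apply: (@le_trans _ _ (\sum_(0 <= k < n.+1) inv_sqr k)).
    by rewrite big_nat_recr//= lerDl invr_ge0 exprn_ge0.
  by apply: (le_trans H); rewrite gerBl invr_ge0.
elim: n => [|n IH].
  by rewrite big_nat1 /inv_sqr expr1n invr1; lra.
rewrite big_nat_recr//=; apply: (le_trans (lerD IH (lexx _))).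
rewrite /inv_sqr; set m : R := n.+1%:R; have m0 : 0 < m by rewrite ltr0n.
rewrite -[n.+2%:R]natr1 -/m.
have m1 : 0 < m + 1 by rewrite addr_gt0.
have -> : 2 - (m + 1)^-1 = 2 - m^-1 + (m * (m + 1))^-1.
  by field; rewrite !gt_eqF.
rewrite lerD2l lef_pV2 ?posrE ?mulr_gt0 ?exprn_gt0//.
by rewrite expr2 ler_pM2r// lerDl.
Qed.

(** A summable weight on multi-indices, against which e^(-Theta) is compared. *)
Definition tensor_weight (a : d.-tuple nat) : R := \prod_(i < d) inv_sqr (tnth a i).

Lemma inv_sqr_ge0 k : 0 <= inv_sqr k.
Proof. by rewrite invr_ge0 exprn_ge0. Qed.

Lemma tensor_weight_ge0 a : 0 <= tensor_weight a.
Proof. by apply: prodr_ge0 => i _; exact: inv_sqr_ge0. Qed.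

(** A partial sum runs over distinct multi-indices that all lie in a cube
{0, ..., N-1}^d, over which the sum of the products is a product of sums. *)
Lemma tensor_weight_sum : abs_sum_le (enum_coef tensor_weight) (2 ^+ d).
Proof.
move=> n.
have E1 : \sum_(0 <= i < n) `|enum_coef tensor_weight i| =
    \sum_(a <- pmap (@pickle_inv (d.-tuple nat)) (iota 0 n)) tensor_weight a.
  rewrite /index_iota subn0; elim: (iota 0 n) => [|k l IH]; first by rewrite !big_nil.
  rewrite big_cons IH /= /enum_coef; case: (pickle_inv k) => [a|] /=.
    by rewrite big_cons ger0_norm// tensor_weight_ge0.
  by rewrite normr0 add0r.
have us : uniq (pmap (@pickle_inv (d.-tuple nat)) (iota 0 n)).
  apply: (pmap_uniq (g := pickle)); last exact: iota_uniq.
  exact: pickle_invK.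
rewrite E1; move: (pmap _ _) us => {E1}l us.
have [N HN] : exists N, forall a, a \in l -> forall i, (tnth a i < N)%N.
  exists (\max_(a <- l) \max_(i < d) (tnth a i).+1)%N => a al i.
  apply: (@leq_trans (\max_(i < d) (tnth a i).+1)%N); first exact: (leq_bigmax i).
  by rewrite (big_rem a)//= leq_maxl.
pose V := \sum_(j < N) inv_sqr j.
apply: (@le_trans _ _ (\prod_(i < d) V)); last first.
  rewrite prodr_const card_ord; apply: lerXn2r; rewrite ?nnegrE//.
    by apply: sumr_ge0 => j _; exact: inv_sqr_ge0.
  by rewrite /V -(big_mkord xpredT inv_sqr); exact: inv_sqr_sum.
rewrite /V bigA_distr_bigA/=.
pose h (g : {ffun 'I_d -> 'I_N}) : d.-tuple nat := [tuple (g i : nat) | i < d].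
have hE (g : {ffun 'I_d -> 'I_N}) : \prod_(i < d) inv_sqr (g i) = tensor_weight (h g).
  by apply: eq_bigr => i _; rewrite tnth_mktuple.
rewrite (eq_bigr (fun g => tensor_weight (h g))); last by move=> g _; exact: hE.
rewrite -(big_map h xpredT tensor_weight).
have subl : {subset l <= [seq h g | g <- index_enum _]}.
  move=> a al; apply/mapP.
  exists [ffun i => Ordinal (HN a al i)]; first exact: mem_index_enum.
  by apply: eq_from_tnth => i; rewrite tnth_mktuple ffunE.
move: (map h _) subl => m subl.
elim: l us m subl {HN} => [|a l IH] /=; first
  by move=> *; rewrite big_nil sumr_ge0// => ? _; exact: tensor_weight_ge0.
move=> /andP[al ul] m am; have ain : a \in m by apply: am; rewrite inE eqxx.
rewrite big_cons (big_rem a ain)/= lerD2l; apply: IH => // b bl.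
have bm : b \in m by apply: am; rewrite inE bl orbT.
have := perm_to_rem ain => /perm_mem/(_ b); rewrite bm inE.
by case: eqVneq bl => [->|//] bl; rewrite bl in al.
Qed.

Lemma enum_coef_sum (c : d.-tuple nat -> R) C : 0 <= C ->
  (forall a, `|c a| <= C * tensor_weight a) -> abs_sum_le (enum_coef c) (C * 2 ^+ d).
Proof.
move=> C0 cC; rewrite -[X in _ (X * _)]ger0_norm//.
apply: abs_sum_leW (abs_sum_leZ C tensor_weight_sum) => n.
rewrite /enum_coef; case: pickle_inv => [a|]; last by rewrite normr0.
by rewrite (le_trans (cC a))// ler_norm.
Qed.

Definition hermite_sum (c : d.-tuple nat -> R) (x : E) : R :=
  tsum (fun n => enum_coef c n * hermite_d (index_of n) x).

Definition real_coef (f : E -> R) (a : d.-tuple nat) : R := \int[mu]_x (f x * hermite_d a x).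

Let gauss_bound (x : E) : R := \prod_(j < d) expR (tnth (x : d.-tuple B) j ^+ 2 / 2).

Lemma hermite_d_le a (x : E) : `|hermite_d a x| <= \prod_(j < d) expR (coordinate x j ^+ 2 / 2).
Proof. exact: (@hermite_tensor_le R d a x). Qed.

Lemma hermite_d_norm a : \int[mu]_x (hermite_d a x ^+ 2) <= 1 :> R.
Proof.
rewrite (_ : \int[mu]_x _ = \int[mu]_x (hermite_d a x * hermite_d a x)).
  by rewrite hermite_d_orthonormal eqxx.
by apply: eq_Rintegral => x _; rewrite expr2.
Qed.

Lemma hermite_sum_sq_intg c A : 0 < A -> abs_sum_le (enum_coef c) A ->
  sq_intg mu (hermite_sum c) /\ \int[mu]_x (hermite_sum c x ^+ 2) <= A ^+ 2.
Proof.
move=> A0 cA; apply: (@l2_series_sq_intg _ _ _ mu (fun n => hermite_d (index_of n)) gauss_bound) => //.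
- by move=> n; exact: sq_intg_hermite_d.
- by move=> n; exact: hermite_d_norm.
- by move=> n x; exact: hermite_d_le.
Qed.

Lemma real_coef_hermite_sum c A : 0 < A -> abs_sum_le (enum_coef c) A ->
  forall a, real_coef (hermite_sum c) a = c a.
Proof.
move=> A0 cA a.
have H := @l2_series_inner _ _ _ mu (fun n => hermite_d (index_of n)) gauss_bound
  (fun n => sq_intg_hermite_d _) (fun n => hermite_d_norm _) (fun n x => hermite_d_le _ x)
  _ A A0 cA (hermite_d a) (sq_intg_hermite_d a).
apply: (cvg_unique _ H) => //; apply: cvg_near_cst.
exists (pickle a).+1 => // n /= an.
under eq_bigr do rewrite hermite_d_orthonormal.
have E k : enum_coef c k * (index_of k == a)%:R = (k == pickle a)%:R * c a.
  have [->|ka] := eqVneq k (pickle a); first by rewrite index_ofK eqxx enum_coef_pickle mulr1 mul1r.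
  rewrite mul0r; have [->|[_ kE]] := enum_coefP c k; first by rewrite mul0r.
  have [ia|_] := eqVneq (index_of k) a; last by rewrite mulr0.
  by rewrite kE ia eqxx in ka.
under eq_bigr do rewrite E.
rewrite (bigD1_seq (pickle a))/= ?iota_uniq ?mem_index_iota//.
rewrite eqxx mul1r big1 ?addr0// => k /negbTE ->; by rewrite mul0r.
Qed.

(** The difference of the two sides has zero coefficients. *)
Lemma hermite_sum_ae (f : E -> R) A : 0 < A -> sq_intg mu f ->
  abs_sum_le (enum_coef (real_coef f)) A -> {ae mu, forall x, f x = hermite_sum (real_coef f) x}.
Proof.
move=> A0 sf fA; have [sF _] := hermite_sum_sq_intg A0 fA.
have sB : sq_intg mu (fun x => f x - hermite_sum (real_coef f) x).
  have [mf if_] := sf; have [mF iF] := sF; split; first exact: measurable_funB.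
  apply: (@intg_le _ _ _ mu _ (fun x => 2 * f x ^+ 2 + 2 * hermite_sum (real_coef f) x ^+ 2)).
  - by apply: measurable_funX; exact: measurable_funB.
  - by move=> x; rewrite ger0_norm ?sqr_ge0// sqrB_le.
  - by apply: intgD; exact: intgZ.
have := hermite_complete sB; move=> /(_ _)[a|M [mM M0 HM]].
  under eq_Rintegral do rewrite mulrBl.
  rewrite (RintegralB measurableT (sq_intgM sf (sq_intg_hermite_d a)) (sq_intgM sF (sq_intg_hermite_d a))).
  by rewrite -/(real_coef f a) -/(real_coef (hermite_sum _) a) (real_coef_hermite_sum A0 fA) subrr.
exists M; split => // x /= nx; apply: HM => /= H; apply: nx; exact: subr0_eq H.
Qed.

End enumeration.

(** * Compactness of dominated families of coefficients *)

Lemma ultra_fmap (T V : Type) (f : T -> V) (U : set_system T) :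
  UltraFilter U -> UltraFilter (f @ U).
Proof.
move=> UU; split; first exact: fmap_proper_filter.
move=> H PH UH; apply/seteqP; split => // A HA.
have [//|UnA] := in_ultra_setVsetC (f @^-1` A) UU.
have : H (~` A) by apply: UH.
by move=> HnA; case: (@filter_not_empty _ H PH); rewrite -(setICr A); exact: filterI.
Qed.

Section dominated_compactness.
Context {R : realType}.

Lemma abs_sum_tail (b : nat -> R) (A eta : R) : (forall k, 0 <= b k) -> abs_sum_le b A ->
  0 < eta -> exists m, forall n, \sum_(m <= k < n) b k <= eta.
Proof.
move=> b0 bA eta0; have cb := abs_sum_cvg bA.
have Sb n : \sum_(0 <= k < n) b k <= tsum b.
  apply: (@nondecreasing_cvgn_le _ (series b)) => //.
  by apply: nondecreasing_series => k _ _; exact: b0.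
have [m _ Hm] : \forall n \near \oo, tsum b - eta < series b n.
  by apply: (cvgr_gt (tsum b)) => //; rewrite ltrBlDr ltrDl.
exists m => n; have [nm|mn] := leqP n m; first by rewrite big_geq// ltW.
have := Sb n; rewrite (big_cat_nat (leq0n m) (ltnW mn))/=.
have := Hm m (leqnn m); rewrite /series/=; lra.
Qed.

(** An ultrafilter finer than the neighbourhoods of infinity provides limits for
all coordinates at once; finitely many coordinates are close to their limits,
and the tails are small uniformly in n by domination. *)
Lemma dominated_subsequence (u : nat -> nat -> R) (b : nat -> R) (A : R) :
  (forall n k, `|u n k| <= b k) -> abs_sum_le b A ->
  exists2 c : nat -> R, forall k, `|c k| <= b k &
    forall eta N, 0 < eta -> exists2 n, (N <= n)%N & abs_sum_le (fun k => u n k - c k) eta.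
Proof.
move=> ub bA; have b0 k : 0 <= b k by apply: le_trans (ub 0 k).
have [U [UU Uoo]] := @ultraFilterLemma nat \oo _.
have PU : ProperFilter U := @ultra_proper _ _ UU.
have lim k : exists2 ck : R, `|ck| <= b k & u ^~ k @ U --> ck.
  have := @segment_compact R (- b k) (b k); rewrite compact_ultra.
  move=> /(_ (u ^~ k @ U) (ultra_fmap (u ^~ k) UU))[|ck [/= ckI uck]].
    apply: (@filterS _ U _ setT); last exact: filterT.
    by move=> n _ /=; rewrite in_itv/= -ler_norml.
  by exists ck => //; move: ckI; rewrite in_itv/= -ler_norml.
pose c k := projT1 (cid2 (lim k)).
have cb k : `|c k| <= b k by rewrite /c; case: cid2.
have ucU k : u ^~ k @ U --> c k by rewrite /c; case: cid2.
exists c => // eta N eta0.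
have [m Hm] := @abs_sum_tail b A (eta / 4) b0 bA ltac:(by rewrite divr_gt0).
have fin : \sum_(0 <= k < m) `|u n k - c k| @[n --> U] --> 0.
  have H : \sum_(0 <= k < m) `|u n k - c k| @[n --> U] --> \sum_(0 <= k < m) `|c k - c k|.
    apply: cvg_big => [|k _]; first exact: add_continuous.
    by apply: cvg_norm; apply: cvgB; [exact: ucU|exact: cvg_cst].
  by move: H; rewrite big1// => k _; rewrite subrr normr0.
have near1 : \forall n \near U, \sum_(0 <= k < m) `|u n k - c k| < eta / 2.
  by apply: (cvgr_lt 0 fin); rewrite divr_gt0.
have near2 : \forall n \near U, (N <= n)%N by apply: Uoo; exact: nbhs_infty_ge.
have [n [Hn Nn]] := filter_ex (filterI near1 near2).
exists n => // l; apply: (@le_trans _ _ (\sum_(0 <= k < maxn l m) `|u n k - c k|)).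
  by rewrite (big_cat_nat (leq0n l) (leq_maxl l m))/= lerDl sumr_ge0.
rewrite (big_cat_nat (leq0n m) (leq_maxr l m))/=.
have T : \sum_(m <= k < maxn l m) `|u n k - c k| <= 2 * (eta / 4).
  apply: (@le_trans _ _ (2 * \sum_(m <= k < maxn l m) b k)); last by rewrite ler_pM2l.
  rewrite mulr_sumr; apply: ler_sum => k _; apply: (le_trans (ler_normB _ _)).
  by have := ub n k; have := cb k; lra.
lra.
Qed.

End dominated_compactness.

(** * The compactness argument *)

Section small_sublevels.
Context d (T : measurableType d) (R : realType) (mu : {measure set T -> \bar R}).

(** Continuity from above along the levels 1/(j+1). *)
Lemma small_sublevel (F : T -> R) (K : set T) (kappa : R) :
  measurable_fun setT F -> measurable K -> (mu K < +oo)%E ->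
  mu [set x | F x = 0] = 0%E -> 0 < kappa ->
  exists2 eta : R, 0 < eta & (mu (K `&` [set x | (`|F x| <= eta)%R]) < kappa%:E)%E.
Proof.
move=> mF mK Koo F0 k0.
have mS eta : measurable [set x | `|F x| <= eta] by exact: measurable_sublevel.
pose A j := K `&` [set x | `|F x| <= j.+1%:R^-1].
have mA j : measurable (A j) by exact: measurableI.
have Aoo j : (mu (A j) < +oo)%E.
  by apply: le_lt_trans Koo; apply: le_measure; rewrite ?inE//; exact: subIsetl.
have mZ : measurable [set x | F x = 0].
  by rewrite -[X in measurable X]setTI; exact: mF measurableT _ (measurable_set1 0).
have capA : mu (\bigcap_j A j) = 0%E.
  apply/eqP; rewrite -measure_le0 -F0; apply: le_measure; rewrite ?inE//.
    exact: bigcapT_measurable.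
  move=> x Ax /=; apply/eqP; rewrite -normr_le0.
  apply: (cvgn_ge (@cvg_harmonic R)) => j.
  by have [] := Ax j I.
have H : mu \o A @ \oo --> mu (\bigcap_j A j).
  apply: nonincreasing_cvg_mu => //; first exact: bigcapT_measurable.
  move=> i j ij; apply/subsetPset; apply: setIS => x /= /le_trans; apply.
  by rewrite lef_pV2 ?posrE// ler_nat.
rewrite capA in H.
have : \forall j \near \oo, (mu (A j) < kappa%:E)%E.
  move/fine_cvgP : H => [_ H].
  have : \forall j \near \oo, (fine \o (mu \o A)) j < kappa by apply: (cvgr_lt 0 H).
  apply: filterS => j /= jk; rewrite -(@fineK _ (mu (A j))) ?lte_fin//.
  by rewrite ge0_fin_numE.
by move=> [j _ /(_ j (leqnn j)) Hj]; exists j.+1%:R^-1.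
Qed.

Lemma level_lower_bound (u v : T -> R) (W : set T) (eta : R) :
  measurable W -> 0 <= eta -> measurable_fun setT u ->
  (forall x, W x -> eta <= `|u x|) -> intg mu (fun x => u x ^+ 2 * v x) ->
  (forall x, \1_W x <= v x) ->
  ((eta ^+ 2)%:E * mu W <= (\int[mu]_x (u x ^+ 2 * v x))%:E)%E.
Proof.
move=> mW eta0 mu_ ue iv Wv.
rewrite -Rint_ereal//.
have -> : ((eta ^+ 2)%:E * mu W = \int[mu]_x ((eta ^+ 2)%:E * (\1_W x)%:E))%E.
  have m1 : measurable_fun setT (fun x => (\1_W x)%:E : \bar R).
    by apply/measurable_EFinP; exact: measurable_indic.
  have e2 : (0 <= (eta ^+ 2)%:E)%E by rewrite lee_fin sqr_ge0.
  by rewrite ge0_integralZl// integral_indic// setIT.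
apply: ge0_le_integral => //.
- by move=> x _; rewrite -EFinM lee_fin mulr_ge0// sqr_ge0.
- by apply/measurable_EFinP; apply: measurable_funM => //; exact: measurable_indic.
- exact: measurable_int iv.
move=> x _; rewrite -EFinM lee_fin.
have v0 : 0 <= v x by apply: le_trans (Wv x).
have [xW|xW] := pselect (W x); last by rewrite indicE memNset// mulr0 mulr_ge0 ?sqr_ge0.
apply: ler_pM => //; first exact: sqr_ge0.
rewrite -(real_normK (num_real (u x))); apply: lerXn2r; rewrite ?nnegrE//.
exact: ue.
Qed.

End small_sublevels.

Section compactness_core.
Context {R : realType} (d : nat).
Local Notation B := (measurableTypeR R).
Local Notation mu := (lebesgue_d R d).
Local Notation E := (euclid R d).
Variables (M : nat -> R).
Hypothesis M_gt0 : forall p, 0 < M p.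
Hypothesis M_logconvex : forall p, M p.+1 ^+ 2 <= M p * M p.+2.
Hypothesis M_pp : exists C L : R, [/\ 0 < C, 1 <= L &
  forall p : nat, p%:R ^+ p <= C * L ^+ p * M p].
Local Notation N p := (Num.sqrt (M p)).
Hypothesis N_div : forall A : R, exists n, A <= \sum_(1 <= p < n) N p.-1 / N p.

Variables (w : d.-tuple nat -> R) (A : R).
Hypothesis wA : forall p, abs_sum_le
  (fun n => enum_coef w n * Num.sqrt (mindex_size (@index_of d n))%:R ^+ p) (A * N p).
Variables (K : set E) (G0 kappa : R).
Hypotheses (mK : measurable K) (Koo : (mu K < +oo)%E).
Hypothesis KG : forall x, K x -> \prod_(j < d) expR (coordinate x j ^+ 2 / 2) <= G0.
Hypothesis kappa0 : 0 < kappa.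

Let A' := A * N 0 + 1.

Let wA0 : abs_sum_le (enum_coef w) (A * N 0).
Proof. by have := wA 0; apply: abs_sum_le_ext => n; rewrite expr0 mulr1. Qed.

Let A'0 : 0 < A'.
Proof. by rewrite /A' ltr_wpDl//; exact: abs_sum_le_ge0 wA0. Qed.

Let sumA' (c : d.-tuple nat -> R) : (forall a, `|c a| <= w a) -> abs_sum_le (enum_coef c) A'.
Proof.
move=> cw n; apply: (@le_trans _ _ (A * N 0)); last by rewrite lerDl.
move: n; apply: abs_sum_leW wA0 => n.
by rewrite /enum_coef; case: pickle_inv => [a|//]; rewrite (le_trans (cw a))// ler_norm.
Qed.

Lemma sum_null_set (c : nat -> R) : (forall k, `|c k| <= enum_coef w k) ->
  (exists x : E, tsum (fun n => c n * hermite_d (@index_of d n) x) != 0) ->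
  mu [set x | tsum (fun n => c n * hermite_d (@index_of d n) x) = 0] = 0%E.
Proof.
move=> cw [x xn0].
have cA p : abs_sum_le (fun n => c n * Num.sqrt (mindex_size (@index_of d n))%:R ^+ p) (A * N p).
  apply: abs_sum_leW (wA p) => n; rewrite !normrM ler_wpM2r//.
  exact: le_trans (cw n) (ler_norm _).
have cA0 : abs_sum_le c (A * N 0).
  by have := cA 0; apply: abs_sum_le_ext => n; rewrite expr0 mulr1.
have mZ : measurable [set x : d.-tuple B |
    tsum (fun n => c n * hermite_tensor (index_of d n) x) = 0].
  rewrite -[X in measurable X]setTI.
  exact: (measurable_tensor_series (@index_of d) cA0 measurableT (measurable_set1 0)).
transitivity (borel_lebesgue d [set x : d.-tuple B |
    tsum (fun n => c n * hermite_tensor (index_of d n) x) = 0]).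
  exact: (lebesgue_d_borel mZ).
apply/eqP; apply: contraNT xn0 => Z0; apply/eqP.
exact: (@tensor_series_unique R M M_gt0 M_logconvex M_pp N_div d (@index_of d) c A cA Z0 x).
Qed.

(** The bound 1/(n+1) is uniform over all sets that meet [K] in measure at least
[kappa] and all unit functions with coefficients dominated by [w]. The
argument by contradiction extracts an l^1 limit of the coefficients of a
sequence of counterexamples. *)
Lemma compactness_core : exists n : nat, forall (omega : set E) (u : E -> R),
  measurable omega -> (kappa%:E <= mu (omega `&` K))%E -> sq_intg mu u ->
  \int[mu]_x (u x ^+ 2) = 1 -> (forall a, `|real_coef u a| <= w a) ->
  n.+1%:R^-1 < \int[mu]_x (u x ^+ 2 * \1_omega x).
Proof.
apply: contrapT => /forallNP H.
have {H} bad n : exists ou : set E * (E -> R), [/\ measurable ou.1,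
    (kappa%:E <= mu (ou.1 `&` K))%E, sq_intg mu ou.2, \int[mu]_x (ou.2 x ^+ 2) = 1 &
    (forall a, `|real_coef ou.2 a| <= w a) /\
    \int[mu]_x (ou.2 x ^+ 2 * \1_(ou.1) x) <= n.+1%:R^-1].
  have /existsNP[om /existsNP[u /not_implyP[mo /not_implyP[ko /not_implyP[su /not_implyP[u1
     /not_implyP[uw /negP]]]]]]] := H n.
  by rewrite -leNgt => un; exists (om, u).
have [ou Hou] := choice bad.
pose om n := (ou n).1; pose u n := (ou n).2.
have mom n : measurable (om n) by case: (Hou n).
have kom n : (kappa%:E <= mu (om n `&` K))%E by case: (Hou n).
have su n : sq_intg mu (u n) by case: (Hou n).
have u1 n : \int[mu]_x (u n x ^+ 2) = 1 by case: (Hou n).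
have uw n a : `|real_coef (u n) a| <= w a by case: (Hou n) => _ _ _ _ [].
have un n : \int[mu]_x (u n x ^+ 2 * \1_(om n) x) <= n.+1%:R^-1.
  by case: (Hou n) => _ _ _ _ [].
pose c n := enum_coef (real_coef (u n)).
have cA n : abs_sum_le (c n) A' := sumA' (uw n).
have cw n k : `|c n k| <= enum_coef w k.
  by rewrite /c /enum_coef; case: pickle_inv => [a|]; [exact: uw|rewrite normr0].
have [c' c'w c'sub] := dominated_subsequence cw wA0.
have c'A : abs_sum_le c' (A * N 0).
  apply: abs_sum_leW wA0 => k; exact: le_trans (c'w k) (ler_norm _).
have uE n : {ae mu, forall x, u n x = hermite_sum (real_coef (u n)) x}.
  exact: hermite_sum_ae A'0 (su n) (cA n).
pose F x := tsum (fun n => c' n * hermite_d (index_of d n) x) : R.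
have [[x Fx]|F0] := pselect (exists x, F x != 0); last first.
  (* If F = 0 then the limit coefficients vanish, and some u n has norm <= 1/4. *)
  pose g a := c' (pickle (a : d.-tuple nat)).
  have gE k : enum_coef g k = c' k.
    have := c'w k; rewrite /enum_coef.
    case E : (pickle_inv k) => [a|]; last by rewrite normr_le0 => /eqP.
    by move=> _; rewrite /g; congr c'; have := @pickle_invK (d.-tuple nat) k; rewrite /ocancel E.
  have gA : abs_sum_le (enum_coef g) A'.
    move=> n; under eq_bigr do rewrite gE; apply: (le_trans (c'A n)); by rewrite lerDl.
  have c'0 k : c' k = 0.
    rewrite -gE; have [->//|[-> _]] := enum_coefP g k.
    rewrite -(real_coef_hermite_sum A'0 gA) /real_coef.
    transitivity (\int[mu]_x (0 * 0) : R).
      apply: eq_Rintegral => x _; rewrite mul0r (_ : hermite_sum g x = 0) ?mul0r//.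
      rewrite /hermite_sum; under [X in tsum X]funext do rewrite gE.
      by have [//|/eqP Fx] := eqVneq (F x) 0; case: F0; exists x; apply/eqP.
    by rewrite mul0r /Rintegral integral0.
  have [n _ Hn] := c'sub 4^-1 0 ltac:(by []).
  have c4 : abs_sum_le (enum_coef (real_coef (u n))) 4^-1.
    by apply: abs_sum_le_ext Hn => k; rewrite c'0 subr0.
  have [_ small] := hermite_sum_sq_intg (ltac:(by []) : 0 < 4^-1 :> R) c4.
  have : \int[mu]_x (u n x ^+ 2) <= 4^-1 ^+ 2 :> R.
    apply: le_trans small; rewrite le_eqVlt; apply/orP; left; apply/eqP.
    apply: (@ae_eq_Rint _ E R mu (fun x => u n x ^+ 2)
      (fun x => hermite_sum (real_coef (u n)) x ^+ 2)).
    - by apply: measurable_funX; have [] := su n.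
    - by apply: measurable_funX; have [[]] := hermite_sum_sq_intg A'0 (cA n).
    - by apply: filterS (uE n) => z ->.
  rewrite u1 exprVn; apply/negP; rewrite -ltNge invf_lt1// ?exprn_gt0//.
  by rewrite -natrX ltr1n.
(* Otherwise |u n| >= eta / 2 on W, the part of om n `&` K where |F| > eta. *)
have mF : measurable_fun setT F :=
  measurable_borel (@measurable_tensor_series R d (@index_of d) c' _ c'A).
have FZ : mu [set x | F x = 0] = 0%E by apply: sum_null_set => //; exists x.
have k2 : 0 < kappa / 2 by rewrite divr_gt0.
have [eta eta0 small] := small_sublevel mF mK Koo FZ k2.
have G00 : 0 < `|G0| + 1 by rewrite ltr_wpDl.
pose eta' := eta / 2; have eta'0 : 0 < eta' by rewrite divr_gt0.
(* The mass that u n carries on W, to be compared with 1/(n+1). *)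
pose bnd := eta' ^+ 2 * (kappa / 2).
have bnd0 : 0 < bnd by rewrite mulr_gt0 ?exprn_gt0.
have [n0 n0E] : exists n0 : nat, bnd^-1 < n0%:R.
  by exists (Num.Def.archi_bound bnd^-1); apply: archi_boundP; rewrite invr_ge0 ltW.
(* On K the Hermite functions are bounded by G0, so l^1 closeness of the
   coefficients is uniform closeness of the sums. *)
have [n nn0 Hn] := c'sub (eta' / (`|G0| + 1)) n0 ltac:(by rewrite divr_gt0).
have close y : K y -> `|hermite_sum (real_coef (u n)) y - F y| <= eta'.
  move=> Ky; pose P := \prod_(j < d) expR (coordinate y j ^+ 2 / 2).
  have P0 : 0 <= P by apply: prodr_ge0 => j _; exact: expR_ge0.
  rewrite -(tsumB (hermite_tensor_sum _ (cA n) y) (hermite_tensor_sum _ c'A y)).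
  have := @hermite_tensor_sum R d (@index_of d) (fun k => c n k - c' k) _ Hn y.
  move=> /(@abs_sum_le_ext R _ (fun k => c n k * hermite_tensor (index_of d k) y -
     c' k * hermite_tensor (index_of d k) y) _ (fun k => mulrBl _ _ _))/tsum_le/le_trans; apply.
  rewrite -/P.
  have KP : P <= `|G0| + 1.
    by apply: (le_trans (KG Ky)); rewrite (le_trans (ler_norm _))// lerDl.
  apply: (@le_trans _ _ ((`|G0| + 1) * (eta' / (`|G0| + 1)))).
    by apply: ler_wpM2r => //; rewrite divr_ge0 // ltW.
  by rewrite mulrC divfK// gt_eqF.
pose S := K `&` [set x | `|F x| <= eta].
pose W := (om n `&` K) `\` S.
have mS : measurable S by apply: measurableI => //; exact: measurable_sublevel.
have moK : measurable (om n `&` K) by exact: measurableI.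
have mW : measurable W by exact: measurableD.
have muW : ((kappa / 2)%:E <= mu W)%E.
  rewrite leNgt; apply/negP => Wlt.
  have : (mu (om n `&` K) <= mu W + mu S)%E.
    apply: (@le_trans _ _ (mu (W `|` S))); last exact: measureU2.
    apply: le_measure; rewrite ?inE//; first exact: measurableU.
    by move=> z zo; have [zS|zS] := pselect (S z); [right|left].
  move=> /(le_trans (kom n)); apply/negP; rewrite -ltNge.
  have -> : kappa%:E = ((kappa / 2)%:E + (kappa / 2)%:E)%E by rewrite -EFinD -splitr.
  by apply: lteD.
have [sFn _] := hermite_sum_sq_intg A'0 (cA n); have [mFn _] := sFn.
have iv := intg_sqr_indic sFn (mom n).
have Hle : (bnd%:E <= (\int[mu]_x (hermite_sum (real_coef (u n)) x ^+ 2 * \1_(om n) x))%:E)%E.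
  apply: (@le_trans _ _ ((eta' ^+ 2)%:E * mu W)%E).
    by rewrite /bnd EFinM lee_wpmul2l// lee_fin sqr_ge0.
  apply: (@level_lower_bound _ _ R mu (hermite_sum (real_coef (u n))) (\1_(om n)) W eta') => //.
  - exact: ltW.
  - move=> z [[oz Kz] nS].
    have Fz : eta < `|F z| by rewrite ltNge; apply/negP => h; apply: nS.
    have := close z Kz;
    have := ler_normB (F z - hermite_sum (real_coef (u n)) z) (- hermite_sum (real_coef (u n)) z).
    rewrite opprK subrK normrN distrC /eta'.
    have h2 : eta = eta / 2 + eta / 2 by rewrite -splitr.
    lra.
  - move=> z; rewrite !indicE; have [zW|_] := boolP (z \in W); last by case: (_ \in _).
    by rewrite mem_set//; have [[]] := set_mem zW.
rewrite lee_fin in Hle.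
have EI : \int[mu]_x (u n x ^+ 2 * \1_(om n) x) =
    \int[mu]_x (hermite_sum (real_coef (u n)) x ^+ 2 * \1_(om n) x).
  apply: (@ae_eq_Rint _ E R mu (fun x => u n x ^+ 2 * \1_(om n) x)
    (fun x => hermite_sum (real_coef (u n)) x ^+ 2 * \1_(om n) x)).
  - exact: intg_measurable (intg_sqr_indic (su n) (mom n)).
  - exact: intg_measurable iv.
  - by apply: filterS (uE n) => z ->.
have := un n; rewrite EI => /(le_trans Hle); apply/negP; rewrite -ltNge.
rewrite invf_plt ?posrE//; apply: (lt_le_trans n0E).
by rewrite ler_nat (leq_trans nn0).
Qed.

End compactness_core.

(** * Moments of the weight *)

Section sup_moments.
Context {R : realType} (Theta : R -> R).
Hypothesis Mseq_fin : forall p, (0 < Mseq Theta p < +oo)%E.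
Local Notation M p := (fine (Mseq Theta p)).

Lemma Mseq_fin_num p : Mseq Theta p \is a fin_num.
Proof.
by have /andP[m0 moo] := Mseq_fin p; rewrite ge0_fin_numE// ltW.
Qed.

Lemma Mseq_gt0 p : 0 < M p.
Proof. by rewrite fine_gt0. Qed.

Lemma Mseq_ub p t : 0 <= t -> t ^+ p * expR (- Theta t) <= M p.
Proof.
move=> t0; rewrite -lee_fin fineK ?Mseq_fin_num//; apply: ereal_sup_ubound.
by exists t => //=; rewrite in_itv/= t0.
Qed.

Lemma Mseq_le p (b : R) :
  (forall t, 0 <= t -> t ^+ p * expR (- Theta t) <= b) -> M p <= b.
Proof.
move=> H; rewrite -lee_fin fineK ?Mseq_fin_num//; apply: ge_ereal_sup => _ [t /= + <-].
by rewrite in_itv/= andbT lee_fin => /H.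
Qed.

(** The square of t^(p+1) e^(-Theta t) is the product of the functions defining
the two neighbouring suprema. *)
Lemma Mseq_logconvex p : M p.+1 ^+ 2 <= M p * M p.+2.
Proof.
have MM0 : 0 <= M p * M p.+2 by rewrite mulr_ge0// ltW// Mseq_gt0.
rewrite -[leRHS]sqr_sqrtr//; apply: lerXn2r; rewrite ?nnegrE ?sqrtr_ge0 ?(ltW (Mseq_gt0 _))//.
apply: Mseq_le => t t0.
have x0 : 0 <= t ^+ p.+1 * expR (- Theta t) by rewrite mulr_ge0 ?exprn_ge0 ?expR_ge0.
rewrite -[leLHS]ger0_norm// -sqrtr_sqr ler_wsqrtr//.
have -> : (t ^+ p.+1 * expR (- Theta t)) ^+ 2 =
    (t ^+ p * expR (- Theta t)) * (t ^+ p.+2 * expR (- Theta t)).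
  by rewrite (exprS t p.+1) (exprS t p); ring.
by apply: ler_pM; first [exact: Mseq_ub | apply: mulr_ge0; [exact: exprn_ge0|exact: expR_ge0]].
Qed.

Lemma Mseq_ratio p : M p.+1 / M p.+2 <= M p / M p.+1.
Proof.
rewrite ler_pdivrMr ?Mseq_gt0// mulrAC ler_pdivlMr ?Mseq_gt0// -expr2.
exact: Mseq_logconvex.
Qed.

Lemma Mseq_ratio_le1 p : (0 < p)%N -> M p.-1 / M p <= M 0 / M 1.
Proof.
case: p => // p _ /=; elim: p => // p IH; exact: le_trans (Mseq_ratio p) IH.
Qed.

(** The ratios r_p = M_(p-1)/M_p are decreasing, so
r_p^((1 + delta)/2) <= r_1^(delta/2) sqrt(r_p). *)
Lemma sqrt_series_div (delta : R) : 0 <= delta ->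
  (\sum_(1 <= p <oo) ((M p.-1 / M p) `^ ((1 + delta) / 2))%:E = +oo)%E ->
  forall A : R, exists n,
    A <= \sum_(1 <= p < n) Num.sqrt (M p.-1) / Num.sqrt (M p).
Proof.
move=> delta0 Hoo A; apply: contrapT => /forallNP HA.
pose b := (M 0 / M 1) `^ (delta / 2).
have r0 p : 0 < M p.-1 / M p by rewrite divr_gt0 ?Mseq_gt0.
have b0 : 0 <= b by exact: powR_ge0.
have term p : (0 < p)%N ->
    (M p.-1 / M p) `^ ((1 + delta) / 2) <= b * (Num.sqrt (M p.-1) / Num.sqrt (M p)).
  move=> p0; rewrite mulrDl powRD; last by rewrite (gt_eqF (r0 p)) implybT.
  rewrite mul1r powR12_sqrt ?(ltW (r0 p))//.
  rewrite sqrtrM ?(ltW (Mseq_gt0 _))// sqrtrV ?(ltW (Mseq_gt0 _))// mulrC.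
  apply: ler_wpM2r; first by rewrite divr_ge0 ?sqrtr_ge0.
  apply: ge0_ler_powR; rewrite ?nnegrE ?(ltW (r0 _)) ?divr_ge0 ?(ltW (Mseq_gt0 _))//.
  exact: Mseq_ratio_le1.
suff : (\sum_(1 <= p <oo) ((M p.-1 / M p) `^ ((1 + delta) / 2))%:E <= (b * A)%:E)%E.
  by rewrite Hoo.
apply: lime_le.
  by apply: is_cvg_nneseries => n _ _; rewrite lee_fin powR_ge0.
apply: nearW => n; rewrite sumEFin lee_fin.
apply: (@le_trans _ _ (\sum_(1 <= p < n) b * (Num.sqrt (M p.-1) / Num.sqrt (M p)))).
  by apply: ler_sum_nat => p /andP[p0 _]; exact: term.
rewrite -mulr_sumr; apply: ler_wpM2l => //; apply: ltW.
by have := HA n; move/negP; rewrite -ltNge.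
Qed.

Context (d : nat).

Lemma tensor_weight_lower (a : d.-tuple nat) :
  1 <= ((mindex_size a).+1%:R : R) ^+ (d * 2) * tensor_weight a.
Proof.
have -> : ((mindex_size a).+1%:R : R) ^+ (d * 2) = \prod_(i < d) (mindex_size a).+1%:R ^+ 2.
  by rewrite prodr_const card_ord -exprM mulnC.
rewrite /tensor_weight -big_split/=; apply: (@le_trans _ _ (\prod_(i < d) 1)); first by rewrite big1_eq.
apply: ler_prod => i _; rewrite ler01/= /inv_sqr ler_pdivlMr ?exprn_gt0// mul1r.
apply: lerXn2r; rewrite ?nnegrE// ler_nat ltnS /mindex_size.
by rewrite (bigD1 i)//= leq_addr.
Qed.

(** Half of the weight e^(-Theta) ensures summability over multi-indices:
(1 + |a|)^(2 d) bounds the inverse of [tensor_weight a], and it is absorbed by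
the moment of order 4 d. *)
Lemma sqrt_weight_le : exists2 C : R, 0 <= C &
  forall a : d.-tuple nat,
    Num.sqrt (expR (- Theta (mindex_size a)%:R)) <= C * tensor_weight a.
Proof.
pose C : R := Num.sqrt (M 0) + 2 ^+ (d * 2) * Num.sqrt (M (d * 2 + d * 2)%N).
exists C; first by rewrite addr_ge0 ?mulr_ge0 ?exprn_ge0 ?sqrtr_ge0.
move=> a; set n := mindex_size a; set s := Num.sqrt _.
have s0 : 0 <= s by exact: sqrtr_ge0.
suff H : s * n.+1%:R ^+ (d * 2) <= C.
  apply: (@le_trans _ _ (s * (n.+1%:R ^+ (d * 2) * tensor_weight a))).
    by apply: ler_peMr => //; exact: tensor_weight_lower.
  by rewrite mulrA; apply: ler_wpM2r => //; exact: tensor_weight_ge0.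
rewrite /C; case: (posnP n) => [n0|n0].
  rewrite n0 expr1n mulr1; apply: (@le_trans _ _ (Num.sqrt (M 0))).
    rewrite /s n0 ler_wsqrtr//.
    by have := @Mseq_ub 0 0 (lexx _); rewrite expr0 mul1r.
  by rewrite lerDl mulr_ge0 ?exprn_ge0 ?sqrtr_ge0.
apply: (@le_trans _ _ (2 ^+ (d * 2) * Num.sqrt (M (d * 2 + d * 2)%N))); last first.
  by rewrite lerDr sqrtr_ge0.
apply: (@le_trans _ _ (s * (2 ^+ (d * 2) * n%:R ^+ (d * 2)))).
  apply: ler_wpM2l => //; rewrite -exprMn; apply: lerXn2r; rewrite ?nnegrE ?mulr_ge0//.
  by rewrite -natrM ler_nat mul2n -addnn -addn1 leq_add2l.
rewrite mulrCA; apply: ler_wpM2l; first by rewrite exprn_ge0.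
have nn : 0 <= n%:R ^+ (d * 2) :> R by rewrite exprn_ge0.
rewrite -[n%:R ^+ _]ger0_norm// -sqrtr_sqr /s -sqrtrM ?expR_ge0// ler_wsqrtr//.
by rewrite expr2 -exprD mulrC; exact: Mseq_ub.
Qed.

(** The other half of e^(-Theta) is bounded with the moment of order p, which
produces the factor sqrt(M_p). *)
Lemma weight_moments : exists2 C : R, 0 <= C &
  forall K0 : R, 0 <= K0 -> forall p,
  abs_sum_le (fun n => enum_coef (fun a : d.-tuple nat => K0 * expR (- Theta (mindex_size a)%:R)) n
     * Num.sqrt (mindex_size (@index_of d n))%:R ^+ p) (K0 * C * 2 ^+ d * Num.sqrt (M p)).
Proof.
have [C C0 HC] := sqrt_weight_le; exists C => // K0 K00 p.
pose c (a : d.-tuple nat) := K0 * expR (- Theta (mindex_size a)%:R)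
  * Num.sqrt (mindex_size a)%:R ^+ p.
have ca a : `|c a| <= K0 * C * Num.sqrt (M p) * tensor_weight a.
  rewrite /c; set n := mindex_size a.
  rewrite ger0_norm; last by rewrite !mulr_ge0 ?expR_ge0 ?exprn_ge0 ?sqrtr_ge0.
  have -> : expR (- Theta n%:R) = Num.sqrt (expR (- Theta n%:R)) * Num.sqrt (expR (- Theta n%:R)) :> R.
    by rewrite -expr2 sqr_sqrtr// expR_ge0.
  have -> : K0 * (Num.sqrt (expR (- Theta n%:R)) * Num.sqrt (expR (- Theta n%:R))) * Num.sqrt n%:R ^+ p =
     K0 * (Num.sqrt (expR (- Theta n%:R)) * (Num.sqrt (expR (- Theta n%:R)) * Num.sqrt n%:R ^+ p)) by ring.
  have -> : K0 * C * Num.sqrt (M p) * tensor_weight a =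
     K0 * ((C * tensor_weight a) * Num.sqrt (M p)) by ring.
  apply: ler_wpM2l => //.
  apply: ler_pM; rewrite ?mulr_ge0 ?exprn_ge0 ?sqrtr_ge0//; first exact: HC.
  have -> : Num.sqrt n%:R ^+ p = Num.sqrt (n%:R ^+ p) :> R.
    by elim: p {c}=> [|q IH]; rewrite ?expr0 ?sqrtr1// !exprS IH sqrtrM.
  rewrite -sqrtrM ?expR_ge0// ler_wsqrtr// mulrC; exact: Mseq_ub.
have -> : K0 * C * 2 ^+ d * Num.sqrt (M p) = K0 * C * Num.sqrt (M p) * 2 ^+ d by ring.
apply: abs_sum_le_ext (enum_coef_sum _ ca) => [n|]; last by rewrite !mulr_ge0 ?sqrtr_ge0.
rewrite /enum_coef /index_of; case: pickle_inv => [a|]/=; last by rewrite mul0r.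
by [].
Qed.

End sup_moments.

(** * The ball at the origin *)

Section origin_ball.
Context {R : realType} (d : nat).
Local Notation B := (measurableTypeR R).
Local Notation mu := (lebesgue_d R d).
Local Notation E := (euclid R d).
Local Notation leb := (@lebesgue_measure R).

Definition origin : E := ([tuple of nseq d (0 : B)] : d.-tuple B).

Lemma origin_ballE (r : R) : 0 < r ->
  eucl_ball origin r = [set y : E | \sum_(i < d) coordinate y i ^+ 2 < r ^+ 2].
Proof.
move=> r0; apply/seteqP.
have key (y : E) : (eucl_dist origin y < r) = (\sum_(i < d) coordinate y i ^+ 2 < r ^+ 2).
  have S0 : 0 <= \sum_(i < d) coordinate y i ^+ 2 by apply: sumr_ge0 => i _; exact: sqr_ge0.
  rewrite /eucl_dist (eq_bigr (fun i => coordinate y i ^+ 2)); last first.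
    by move=> i _; rewrite {1}/coordinate tnth_nseq sub0r sqrrN.
  by rewrite -[X in _ < X](ger0_norm (ltW r0)) -sqrtr_sqr ltr_sqrt// exprn_gt0.
by split => y; rewrite /eucl_ball /= key.
Qed.

Lemma measurable_origin_ball (r : R) : 0 < r -> measurable (eucl_ball origin r : set E).
Proof.
move=> r0; rewrite origin_ballE//.
have mS : measurable_fun setT (fun y : E => \sum_(i < d) coordinate y i ^+ 2).
  by apply: measurable_sum => i; apply: measurable_funX; exact: measurable_coordinate.
have := mS measurableT `]-oo, r ^+ 2[%classic (measurable_itv _); rewrite setTI.
by congr measurable; apply/seteqP; split => y /=; rewrite in_itv.
Qed.

Lemma origin_ball_cube (r : R) : 0 < r -> exists N,
  (eucl_ball origin r : set E) `<=` @cube R d N.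
Proof.
move=> r0; exists (Num.Def.archi_bound r); rewrite origin_ballE// => y /= yr i.
have rN : r < (Num.Def.archi_bound r)%:R by apply: archi_boundP; exact: ltW.
rewrite -ler_norml; apply: le_trans (ltW rN).
rewrite -(ler_pXn2r (ltn0Sn 1)) ?nnegrE ?(ltW r0)//.
rewrite real_normK ?num_real//; apply: le_trans (ltW yr).
rewrite (bigD1 i)//= /coordinate lerDl; apply: sumr_ge0 => j _; exact: sqr_ge0.
Qed.

(** The ball contains a cube of half-side r / (d + 1), whose measure is a product
of lengths. *)
Lemma origin_ball_gt0 (r : R) : 0 < r -> (0 < mu (eucl_ball origin r))%E.
Proof.
move=> r0.
pose s := r / d.+1%:R.
have s0 : 0 < s by rewrite divr_gt0.
pose W : set E := @box R d (fun=> - s) (fun=> s).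
have mW : measurable W by apply: measurable_euclid; exact: measurable_box.
have WB : W `<=` eucl_ball origin r.
  rewrite origin_ballE// => y Wy /=.
  apply: (@le_lt_trans _ _ (\sum_(i < d) s ^+ 2)).
    apply: ler_sum => i _; rewrite -[leLHS]real_normK ?num_real//.
    by apply: lerXn2r; rewrite ?nnegrE ?(ltW s0)// ler_norml; exact: Wy.
  rewrite sumr_const card_ord -[_ *+ d]mulr_natl /s expr_div_n.
  rewrite mulrCA -[ltRHS]mulr1 ltr_pM2l ?exprn_gt0// ltr_pdivrMr ?exprn_gt0// mul1r.
  by rewrite -natrX ltr_nat expnS expn1 (leq_trans (ltnSn d))// leq_pmulr.
apply: (@lt_le_trans _ _ (mu W)); last first.
  by apply: le_measure; rewrite ?inE//; exact: measurable_origin_ball.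
rewrite lt0e measure_ge0 andbT; apply/eqP => W0.
pose h (t : B) : R := \1_`[- s, s] t.
have hE (x : E) : \1_W x = \prod_(i < d) h (coordinate x i).
  rewrite indicE; have [xW|xW] := boolP (x \in W).
    rewrite big1// => i _; rewrite /h indicE mem_set//= in_itv/=.
    by move: xW; rewrite inE; apply.
  have [i Hi] : exists i, ~ (- s <= coordinate x i <= s).
    by apply/existsNP => H; move/negP: xW; apply; rewrite inE => i; exact: H.
  by rewrite (bigD1 i)//= /h indicE memNset ?mul0r//= in_itv.
have ih : intg leb h by exact: integrable_indic_itv.
have := intg_tensor (fun _ : 'I_d => ih).
have -> : \int[mu]_x \prod_(i < d) h (coordinate x i) = 0.
  rewrite /Rintegral (_ : integral _ _ _ = 0%E)//.
  rewrite -W0 -[X in mu X]setIT -integral_indic//.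
  by apply: eq_integral => x _; rewrite hE.
rewrite prodr_const card_ord => /esym/eqP; rewrite expf_eq0 => /andP[_ /eqP].
have hl : (leb `[(- s)%R, s]%classic = (s + s)%:E)%E.
  by rewrite lebesgue_measure_itv/= lte_fin (lt_trans _ s0) ?oppr_lt0//= -EFinD opprK.
have hi : (\int[leb]_t (h t)%:E = (s + s)%:E)%E.
  by rewrite -hl -[X in _ = leb X]setIT; apply: integral_indic.
by rewrite /Rintegral hi/= => s20; have := addr_gt0 s0 s0; rewrite s20 ltxx.
Qed.

Lemma cube_exp_le N (x : E) : @cube R d N x ->
  \prod_(j < d) expR (coordinate x j ^+ 2 / 2) <= \prod_(j < d) expR (N%:R ^+ 2 / 2).
Proof.
move=> xN; apply: ler_prod => i _; rewrite expR_ge0/= ler_expR ler_pM2r//.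
rewrite -[leLHS]real_normK ?num_real//; apply: lerXn2r; rewrite ?nnegrE//.
by rewrite ler_norml; exact: xN.
Qed.

End origin_ball.

(** * The inequality for real and complex functions *)

Section real_inequality.
Context {R : realType} (d : nat) (Theta : R -> R).
Local Notation mu := (lebesgue_d R d).
Local Notation E := (euclid R d).
Local Notation M p := (fine (Mseq Theta p)).
Hypothesis Mseq_fin : forall p, (0 < Mseq Theta p < +oo)%E.
Hypothesis M_pp : exists C L : R, [/\ 0 < C, 1 <= L &
  forall p : nat, p%:R ^+ p <= C * L ^+ p * M p].
Hypothesis N_div : forall A : R, exists n,
  A <= \sum_(1 <= p < n) Num.sqrt (M p.-1) / Num.sqrt (M p).
Variables (K : set E) (G0 kappa : R).
Hypotheses (mK : measurable K) (Koo : (mu K < +oo)%E).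
Hypothesis KG : forall x, K x -> \prod_(j < d) expR (coordinate x j ^+ 2 / 2) <= G0.
Hypothesis kappa0 : 0 < kappa.

(** If the integral of g^2 is at most eps S there is nothing to prove. Otherwise
the normalised function has coefficients at most eps^(-1/2) e^(-Theta), and
[compactness_core] yields the constant. *)
Lemma real_inequality (eps : R) : 0 < eps -> exists2 D : R, 0 < D &
  forall (omega : set E) (g : E -> R) (S : R),
  measurable omega -> (kappa%:E <= mu (omega `&` K))%E -> sq_intg mu g ->
  (forall a, (expR (Theta (mindex_size a)%:R) * real_coef g a) ^+ 2 <= S) ->
  \int[mu]_x (g x ^+ 2) <= D * \int[mu]_x (g x ^+ 2 * \1_omega x) + eps * S.
Proof.
move=> eps0; have [C C0 HC] := weight_moments Mseq_fin d.
pose K0 := Num.sqrt eps^-1; have K00 : 0 <= K0 by exact: sqrtr_ge0.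
pose w (a : d.-tuple nat) := K0 * expR (- Theta (mindex_size a)%:R).
have [n Hn] := @compactness_core R d (fun p => M p) (Mseq_gt0 Mseq_fin)
  (Mseq_logconvex Mseq_fin) M_pp N_div w _ (HC K0 K00) K G0 kappa mK Koo KG kappa0.
exists n.+1%:R; first by rewrite ltr0n.
move=> om g S mo ko sg Sg.
have gi := intg_sqr_indic sg mo.
pose I := \int[mu]_x (g x ^+ 2); pose J := \int[mu]_x (g x ^+ 2 * \1_om x).
rewrite -/I -/J.
have J0 : 0 <= J by apply: Rintegral_ge0 => x _; rewrite mulr_ge0 ?sqr_ge0.
have S0 : 0 <= S by apply: le_trans (Sg [tuple of nseq d 0%N]); exact: sqr_ge0.
have [IS|SI] := leP I (eps * S).
  by apply: (le_trans IS); rewrite lerDr mulr_ge0.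
have I0 : 0 < I by apply: le_lt_trans SI; rewrite mulr_ge0// ltW.
suff H : n.+1%:R^-1 < J / I.
  rewrite ler_wpDr ?mulr_ge0 ?(ltW eps0)// ltW//.
  by move: H; rewrite ltr_pdivlMr// mulrC ltr_pdivrMr// mulrC.
pose r := Num.sqrt I; have r0 : 0 < r by rewrite sqrtr_gt0.
have r2 : r ^+ 2 = I by rewrite sqr_sqrtr// ltW.
pose u x := r^-1 * g x.
have u2 x : u x ^+ 2 = I^-1 * g x ^+ 2 by rewrite /u exprMn exprVn r2.
have -> : J / I = \int[mu]_x (u x ^+ 2 * \1_om x).
  rewrite mulrC -RintegralZl//; apply: eq_Rintegral => x _; by rewrite u2 mulrA.
have [mg ig] := sg.
apply: Hn => //.
- split; first exact: measurable_funM.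
  have := intgZ I^-1 ig; rewrite /intg; congr integrable.
  by apply/funext => x /=; rewrite u2.
- transitivity (\int[mu]_x (I^-1 * g x ^+ 2)); first by apply: eq_Rintegral => x _.
  by rewrite RintegralZl// mulVf// gt_eqF.
move=> a; have -> : real_coef u a = r^-1 * real_coef g a.
  rewrite /real_coef -RintegralZl//; last exact: sq_intgM sg (sq_intg_hermite_d a).
  by apply: eq_Rintegral => x _; rewrite /u mulrA.
rewrite normrM gtr0_norm ?invr_gt0// /w mulrC ler_pdivrMr//.
set e := expR _; set c := real_coef g a.
have e0 : 0 < e by exact: expR_gt0.
have ec : `|c| * e^-1 <= Num.sqrt S.
  have := Sg a; rewrite -/c => /ler_wsqrtr; rewrite sqrtr_sqr normrM.
  by rewrite gtr0_norm ?expR_gt0// mulrC /e expRN invrK.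
have : `|c| <= Num.sqrt S * e by rewrite -ler_pdivrMr.
move/le_trans; apply; rewrite mulrAC ler_pM2r//.
rewrite /K0 /r -sqrtrM ?invr_ge0 ?(ltW eps0)// ler_wsqrtr//.
by rewrite mulrC ler_pdivlMr// mulrC ltW.
Qed.

End real_inequality.

Section complex_norms.
Context {R : realType} (d : nat).
Local Notation mu := (lebesgue_d R d).
Local Notation E := (euclid R d).

Lemma sqrte_sqr (x : \bar R) : (0 <= x -> (x `^ 2^-1) ^+ 2 = x)%E.
Proof.
case: x => [x||]//.
  rewrite lee_fin => x0; rewrite /poweR powR12_sqrt// expe2 -EFinM -expr2.
  by rewrite sqr_sqrtr.
by move=> _; rewrite /= gt_eqF ?invr_gt0// expe2.
Qed.

Lemma absC_sqr (z : R[i]) : absC z ^+ 2 = complex.Re z ^+ 2 + complex.Im z ^+ 2.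
Proof. by case: z => a b; rewrite /absC /= sqr_sqrtr// addr_ge0 ?sqr_ge0. Qed.

Lemma L2norm_sqr (omega : set E) (f : E -> R[i]) :
  ((L2norm omega f) ^+ 2 = \int[mu]_(x in omega) (absC (f x) ^+ 2)%:E)%E.
Proof.
apply: sqrte_sqr; apply: integral_ge0 => x _; by rewrite lee_fin sqr_ge0.
Qed.

Lemma inL2_sq_intg (f : E -> R[i]) : inL2 f ->
  sq_intg mu (fun x => complex.Re (f x)) /\ sq_intg mu (fun x => complex.Im (f x)).
Proof.
move=> [[mr mi] foo].
have mab : measurable_fun setT (fun x => absC (f x) ^+ 2).
  under eq_fun do rewrite absC_sqr.
  by apply: measurable_funD; exact: measurable_funX.
have iab : intg mu (fun x => absC (f x) ^+ 2).
  apply/integrableP; split; first exact/measurable_EFinP.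
  rewrite (eq_integral (fun x => (absC (f x) ^+ 2)%:E)); last first.
    by move=> x _ /=; rewrite ger0_norm// sqr_ge0.
  rewrite -L2norm_sqr expe2; apply: lte_mul_pinfty => //.
    exact: poweR_ge0.
  by rewrite ge0_fin_numE// poweR_ge0.
by split; split => //; apply: intg_le iab; [exact: measurable_funX| |exact: measurable_funX|];
  move=> x; rewrite ger0_norm ?sqr_ge0// absC_sqr ?lerDl ?lerDr sqr_ge0.
Qed.

Lemma L2norm_indic (omega : set E) (f : E -> R[i]) : measurable omega -> inL2 f ->
  ((L2norm omega f) ^+ 2 = (\int[mu]_x (complex.Re (f x) ^+ 2 * \1_omega x)
     + \int[mu]_x (complex.Im (f x) ^+ 2 * \1_omega x))%:E)%E.
Proof.
move=> mo /inL2_sq_intg [sr si].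
have H1 := intg_sqr_indic sr mo; have H2 := intg_sqr_indic si mo.
rewrite L2norm_sqr -(RintegralD measurableT H1 H2) -(Rint_ereal (intgD H1 H2)).
rewrite [LHS]integral_mkcond; apply: eq_integral => x _.
rewrite patchE indicE; case: ifP => _; first by rewrite !mulr1 absC_sqr.
by rewrite !mulr0 addr0.
Qed.

Lemma GSnorm_coef (Theta : R -> R) (f : E -> R[i]) : inGS Theta f ->
  exists2 S : R, ((GSnorm Theta f) ^+ 2 = S%:E)%E &
  forall a, (expR (Theta (mindex_size a)%:R) * real_coef (fun x => complex.Re (f x)) a) ^+ 2 <= S
    /\ (expR (Theta (mindex_size a)%:R) * real_coef (fun x => complex.Im (f x)) a) ^+ 2 <= S.
Proof.
move=> [_ foo].
have G0 : (0 <= GSnorm Theta f)%E by exact: poweR_ge0.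
exists (fine (GSnorm Theta f ^+ 2)%E).
  rewrite fineK// expe2 fin_numM// ge0_fin_numE//.
move=> a; rewrite -!lee_fin fineK; last by rewrite expe2 fin_numM// ge0_fin_numE//.
have H : (((expR (Theta (mindex_size a)%:R) * absC (hermite_coef f a)) ^+ 2)%:E
    <= GSnorm Theta f ^+ 2)%E.
  rewrite /GSnorm sqrte_sqr; last by apply: esum_ge0 => b _; rewrite lee_fin sqr_ge0.
  apply: esum_ge; exists [set a]; first by split => //; exact: finite_set1.
  by rewrite fsbig_set1.
split; apply: le_trans H; rewrite lee_fin !exprMn ler_wpM2l ?exprn_ge0 ?expR_ge0//
  absC_sqr/= ?lerDl ?lerDr sqr_ge0//.
Qed.

End complex_norms.

Theorem theorem2p6 (R : realType) (d : nat) (delta : R) (Theta : R -> R) :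
  (1 <= d)%N ->
  0 <= delta <= 1 ->
  {within `[0, +oo[, continuous Theta} ->
  (forall t, 0 <= t -> 0 <= Theta t) ->
  (forall p, (0 < Mseq Theta p < +oo)%E) ->
  (exists C L : R, [/\ 0 < C, 1 <= L &
    forall p : nat, p%:R ^+ p <= C * L ^+ p * fine (Mseq Theta p)]) ->
  (\sum_(1 <= p <oo)
     ((fine (Mseq Theta p.-1) / fine (Mseq Theta p)) `^ ((1 + delta) / 2))%:E
   = +oo)%E ->
  exists2 eps0 : R, 0 < eps0 &
  forall (rho : euclid R d -> R),
  (forall x, 0 < rho x) ->
  contraction_mapping rho ->
  (exists m R0 : R, [/\ 0 < m, 0 < R0 &
    forall x, m <= rho x <= R0 * japanese x `^ delta]) ->
  forall gamma : R, 0 < gamma <= 1 ->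
  forall eps : R, 0 < eps <= eps0 ->
  exists2 D : R, 0 < D &
  forall omega : set (euclid R d),
  measurable omega ->
  thick gamma rho omega ->
  forall f : euclid R d -> R[i], inGS Theta f ->
  (L2norm [set: euclid R d] f ^+ 2
   <= D%:E * L2norm omega f ^+ 2 + eps%:E * GSnorm Theta f ^+ 2)%E.
Proof.
move=> _ /andP[delta0 _] _ _ Mfin Mpp Mdiv; exists 1 => // rho rho0 _ _ gamma /andP[gamma0 _].
move=> eps /andP[eps0 _].
have r0 := rho0 (origin d).
pose K := eucl_ball (origin d) (rho (origin d)).
have mK : measurable K := measurable_origin_ball r0.
have [N KN] := @origin_ball_cube R d _ r0.
have Koo : (lebesgue_d R d K < +oo)%E.
  apply: le_lt_trans (@cube_measure R d N).
  apply: le_measure; rewrite ?inE//; exact: measurable_euclid (measurable_box _ _).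
have K0 : (0 < lebesgue_d R d K)%E := @origin_ball_gt0 R d _ r0.
pose kappa := gamma * fine (lebesgue_d R d K).
have kappa0 : 0 < kappa by rewrite mulr_gt0// fine_gt0// K0 Koo.
have KG x : K x -> \prod_(j < d) expR (coordinate x j ^+ 2 / 2) <= \prod_(j < d) expR (N%:R ^+ 2 / 2).
  by move=> /KN; exact: cube_exp_le.
have e2 : 0 < eps / 2 by rewrite divr_gt0.
have [D D0 HD] := real_inequality Mfin Mpp (sqrt_series_div Mfin delta0 Mdiv) mK Koo KG kappa0 e2.
exists D => // omega mo th f fGS.
have ko : (kappa%:E <= lebesgue_d R d (omega `&` K))%E.
  have := th (origin d); rewrite /kappa EFinM fineK// ge0_fin_numE//.
have [S GE HS] := GSnorm_coef fGS; have [fL2 _] := fGS.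
have [sr si] := inL2_sq_intg fL2.
rewrite GE !L2norm_indic// -!EFinM -EFinD lee_fin.
have all1 (g : euclid R d -> R) : \int[lebesgue_d R d]_x (g x ^+ 2 * \1_setT x) =
    \int[lebesgue_d R d]_x (g x ^+ 2).
  by apply: eq_Rintegral => x _; rewrite indicT mulr1.
rewrite !all1.
have Hr := HD omega _ S mo ko sr (fun a => (HS a).1).
have Hi := HD omega _ S mo ko si (fun a => (HS a).2).
have -> : eps * S = eps / 2 * S + eps / 2 * S by field.
by rewrite mulrDr addrACA; exact: lerD.
Qed.
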